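(* Let $(M,\{\eta_1,\dots,\eta_k\})$ be a $k$-pre-contact manifold. There exist a $k$-contact manifold $(\widetilde M,\{\widetilde\eta_1,\dots,\widetilde\eta_k\})$ and an embedding $\mathfrak i\colon M\hookrightarrow\widetilde M$ with $\mathfrak i^*\widetilde\eta_j=\eta_j$ for $j=1,\dots,k$ such that $\mathfrak i(M)$ is a $k$-coisotropic submanifold of $\widetilde M$.
   Context: All manifolds, forms and maps are smooth. A $k$-pre-contact manifold is a pair $(M,\{\eta_1,\dots,\eta_k\})$ with $M$ a finite-dimensional manifold and $\eta_j\in\Omega^1(M)$. Put $\mathcal D=\bigcap_{j=1}^k\ker\eta_j$. Its characteristic distribution is $\mathcal V=\mathcal D\cap\bigcap_{j=1}^k\ker(d\eta_j|_{\mathcal D})$. Standing assumptions on such a manifold $M$: each $\ker\eta_j$ and $\mathcal D$ have constant rank, the restriction of each $d\eta_j$ to $\mathcal D$ has constant rank, and $\mathcal V$ has constant rank. A $k$-contact manifold is a manifold with $k$ 1-forms whose characteristic distribution (defined by the same formula) is $\{0\}$. A submanifold $N$ of a $k$-contact manifold $(\widetilde M,\{\widetilde\eta_j\})$ is $\ell$-coisotropic ($1\le\ell\le k$) if for every $n\in N$ the subspace $\{X\in\bigcap_{j=1}^\ell\ker(\widetilde\eta_j)_n: d\widetilde\eta_j(X,Y)=0\ \forall j\in\{1,\dots,\ell\},\ \forall Y\in T_nN\}$ is contained in $T_nN$. *)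

(* Defs.v *)
From HB Require Import structures.
From mathcomp Require Import all_boot all_order all_algebra.
From mathcomp Require Import all_classical all_reals all_analysis.

Set Implicit Arguments.
Unset Strict Implicit.
Unset Printing Implicit Defensive.

Import Order.TTheory GRing.Theory Num.Theory.
Import numFieldNormedType.Exports.

Local Open Scope classical_set_scope.
Local Open Scope ring_scope.

(* The values of [f] outside the open set [U] are irrelevant. *)
Fixpoint Ck (R : realType) (n : nat) (W : normedModType R) (k : nat)
    (U : set 'rV[R]_n) (f : 'rV[R]_n -> W) : Prop :=
  match k with
  | 0 => forall x, U x -> {for x, continuous f}
  | k'.+1 => (forall x, U x -> differentiable f x) /\
             (forall v, Ck k' U ('D_v f))
  end.

Definition smooth_on (R : realType) (n : nat) (W : normedModType R)
    (U : set 'rV[R]_n) (f : 'rV[R]_n -> W) : Prop :=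
  forall k, Ck k U f.

(* A homeomorphism from the open set [dom] onto an open set of R^n; both maps
   are total functions, with irrelevant values outside these sets. *)
Record chart (R : realType) (n : nat) (T : topologicalType) := Chart {
  dom : set T;
  chart_fun :> T -> 'rV[R]_n;
  chart_inv : 'rV[R]_n -> T;
  open_dom : open dom;
  open_cod : open (chart_fun @` dom);
  chart_funK : forall p, dom p -> chart_inv (chart_fun p) = p;
  chart_fun_continuous : forall p, dom p -> {for p, continuous chart_fun};
  chart_inv_continuous :
    forall x, (chart_fun @` dom) x -> {for x, continuous chart_inv}
}.

Definition cod (R : realType) (n : nat) (T : topologicalType)
    (c : chart R n T) : set 'rV[R]_n := c @` dom c.

(* The preferred charts [chart_at] do not affect the smooth structure; they
   identify each tangent space T_pM with row vectors, namely the coordinates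
   of tangent vectors in the chart [chart_at p]. *)
Record manifold (R : realType) (n : nat) := Manifold {
  carrier :> topologicalType;
  manifold_hausdorff : hausdorff_space carrier;
  manifold_second_countable : @second_countable carrier;
  atlas : set (chart R n carrier);
  chart_at : carrier -> chart R n carrier;
  chart_at_atlas : forall p, atlas (chart_at p);
  chart_at_dom : forall p, dom (chart_at p) p;
  transition_smooth : forall c d, atlas c -> atlas d ->
    smooth_on (c @` (dom c `&` dom d)) (d \o chart_inv c)
}.

Arguments atlas {R n} M : rename.
Arguments chart_at {R n M} p : rename.

Definition smooth_map (R : realType) (m n : nat) (M : manifold R m)
    (N : manifold R n) (f : M -> N) : Prop :=
  continuous f /\
  forall c d, atlas M c -> atlas N d ->
    smooth_on (c @` (dom c `&` f @^-1` dom d)) (d \o f \o chart_inv c).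

(* The differential T_pM -> T_(f p)N is [X |-> X *m tangent_map f p]; its image
   is the row space of [tangent_map f p]. *)
Definition tangent_map (R : realType) (m n : nat) (M : manifold R m)
    (N : manifold R n) (f : M -> N) (p : M) : 'M[R]_(m, n) :=
  jacobian (chart_at (f p) \o f \o chart_inv (chart_at p)) (chart_at p p).

Definition embedding (R : realType) (m n : nat) (M : manifold R m)
    (N : manifold R n) (f : M -> N) : Prop :=
  [/\ smooth_map f,
      forall p, row_free (tangent_map f p),
      injective f &
      forall U : set M, open U -> exists2 W : set N, open W & U = f @^-1` W].

(* A field of covectors: the covector [eta p] on T_pM is
   [X |-> (X *m eta p) 0 0]. *)
Definition covector_field (R : realType) (n : nat) (M : manifold R n) :=
  M -> 'cV[R]_n.

(* The coefficients (a_1, ..., a_n) of eta = sum_i a_i dx_i in the chart [c],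
   as functions on [cod c]. *)
Definition coefs (R : realType) (n : nat) (M : manifold R n)
    (eta : covector_field M) (c : chart R n M) (x : 'rV[R]_n) : 'cV[R]_n :=
  let p := chart_inv c x in
  jacobian (chart_at p \o chart_inv c) x *m eta p.

Record oneform (R : realType) (n : nat) (M : manifold R n) := OneForm {
  covector :> M -> 'cV[R]_n;
  oneform_smooth : forall c, atlas M c -> smooth_on (cod c) (coefs covector c)
}.

Definition pullback (R : realType) (m n : nat) (M : manifold R m)
    (N : manifold R n) (f : M -> N) (eta : oneform N) : covector_field M :=
  fun p => tangent_map f p *m eta (f p).

(* d eta (X, Y) is the entry of [X *m extd eta p *m Y^T], for X, Y in T_pM. *)
Definition extd (R : realType) (n : nat) (M : manifold R n)
    (eta : oneform M) (p : M) : 'M[R]_n :=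
  let a := coefs eta (chart_at p) in
  let x := chart_at p p in
  \matrix_(i, j) (('D_(delta_mx 0 i) a x) j 0 - ('D_(delta_mx 0 j) a x) i 0).

(* Subspaces of T_pM are represented below by row spaces of matrices. *)
Section Distributions.
Variables (R : realType) (n : nat) (M : manifold R n) (k : nat).
Variable eta : 'I_k -> oneform M.

Definition distr (p : M) : 'M[R]_n := (\bigcap_(j < k) kermx (eta j p))%MS.

(* {X in T_pM | d eta_j (X, Y) = 0 for all Y in the row space of A} *)
Definition extd_orth (j : 'I_k) (p : M) (r : nat) (A : 'M[R]_(r, n)) :
    'M[R]_n :=
  kermx (extd (eta j) p *m A^T).

Definition ker_extd_distr (j : 'I_k) (p : M) : 'M[R]_n :=
  (distr p :&: extd_orth j p (distr p))%MS.

Definition char_distr (p : M) : 'M[R]_n :=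
  (distr p :&: \bigcap_(j < k) ker_extd_distr j p)%MS.

(* The rank of the restriction of [d eta_j] to [distr p]. *)
Definition rank_extd_distr (j : 'I_k) (p : M) : nat :=
  \rank (distr p *m extd (eta j) p *m (distr p)^T).

Definition constant_rank (r : M -> nat) : Prop := exists c, forall p, r p = c.

Definition precontact : Prop :=
  [/\ forall j, constant_rank (fun p => \rank (kermx (eta j p))),
      constant_rank (fun p => \rank (distr p)),
      forall j, constant_rank (rank_extd_distr j) &
      constant_rank (fun p => \rank (char_distr p))].

Definition contact : Prop := forall p, char_distr p = 0.

(* The submanifold is the image N of an embedding [f], so that
   T_(f p)N is the row space of [tangent_map f p]. *)
Definition coisotropic (l : nat) (m : nat) (N : manifold R m) (f : N -> M) :
    Prop :=
  (1 <= l <= k)%N /\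
  forall p : N,
    (\bigcap_(j < k | (j < l)%N)
       (kermx (eta j (f p)) :&: extd_orth j (f p) (tangent_map f p))
     <= tangent_map f p)%MS.

End Distributions.

(* Main.v *)
(* Let V be the characteristic distribution, P a smooth projector of TM onto V,
   A the subbundle of T*M of the covectors al with al \o P = al (so that A is
   isomorphic to V* ), and K the bundle of the relations z in R^k between the
   values eta_1(p), ..., eta_k(p).  On the total space of A^k + K over M put
     etat_j = pi^* eta_j + al_j \o d pi + d z_j.
   Along the zero section the kernel of etat is D + A^k, because the image of
   eta is the orthogonal of K, and there
     d etat_j ((X, al), (Y, be)) = d eta_j (X, Y) + al_j (Y) - be_j (X).
   Testing against be gives P X = 0, testing against Y in V gives al = 0, and
   then X lies in V, so X = X P = 0: etat is contact at the zero section, hence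
   nearby since the etat_j are independent there.  The same computation with Y
   tangent to M shows that the zero section is coisotropic.

   P exists because V, having constant rank, is locally the image of a smooth
   projector, and projectors onto V can be averaged by a partition of unity.
   That V is smooth in one chart although it is defined at each point in the
   preferred chart of that point is the invariance of the exterior derivative,
   hence Schwarz's theorem.  The contact condition, on the other hand, is only
   checked in one chart around each point of the new manifold, since its
   preferred charts can be chosen freely. *)
Require Import Defs.
From HB Require Import structures.
From mathcomp Require Import all_boot all_order all_algebra.
From mathcomp Require Import all_classical all_reals all_analysis.
From mathcomp Require Import ring lra zify.
Set Implicit Arguments.
Unset Strict Implicit.
Unset Printing Implicit Defensive.

Import Order.TTheory GRing.Theory Num.Theory.
Import numFieldNormedType.Exports.

Local Open Scope classical_set_scope.
Local Open Scope ring_scope.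

(** * Smooth maps *)

(** The forms [eta j] need not be independent, and this is what K is for. Without the summands d z_j
    the common kernel could lose rank off the zero section; there would then be fewer vectors Y to
    test against, and nondegeneracy at the zero section would not propagate to nearby points. The
    summands d z_j fill the orthogonal complement of the image of eta in R^k, so they make the forms
    independent while adding nothing to the kernel along M; this use of the standard inner product
    is where the positivity of squares enters.

    The matrices that represent D and V are computed point by point by Gaussian elimination and need
    not vary smoothly. Each subspace is therefore described by an equation X *m B = 0 with B smooth:
    if B has constant rank, an invertible minor yields a smooth projector onto the solutions, and if
    0 is the only solution, this persists nearby. *)

Lemma near_eq_differentiable (R : realType) (V W : normedModType R)
    (f g : V -> W) (x : V) :
  (\forall y \near x, f y = g y) -> differentiable f x -> differentiable g x.
Proof.
move=> fg df.
(* The difference vanishes near [x], so 0 is a differential for it; adding [f] back gives the claim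
   for [g]. *)
suff dh : differentiable (g \- f) x.
  rewrite (_ : g = f + (g \- f)); first exact: differentiableD.
  by apply/funext => y; rewrite /= addrC subrK.
apply/diffP; apply: (@getPex _ (fun df : {linear V -> W} => continuous df /\
  forall y, (g \- f) y = (g \- f) (lim (nbhs x)) + df (y - lim (nbhs x))
                  +o_(y \near x) (y - lim (nbhs x)))).
exists (\0 : {linear V -> W}); split; first by move=> ?; exact: cst_continuous.
suff /funeqP E : g \- f = (cst ((g \- f) (lim (nbhs x))) + 0) +o_ (nbhs x)
    (fun y => y - lim (nbhs x)).
  by apply: eqaddoEx => y; exact: E y.
apply/eqaddoP => e e0; near=> y; rewrite lim_id.
have -> : (g \- f - (cst ((g \- f) x) + 0)) y = g y - f y - (g x - f x + 0) by [].
rewrite -(nbhs_singleton fg) subrr addr0 subr0.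
have -> : f y = g y by near: y.
by rewrite subrr normr0 mulr_ge0 // ltW.
Unshelve. all: by end_near. Qed.

Section CkGeneral.
Variables (R : realType) (n : nat).
Implicit Types (W : normedModType R) (U A : set 'rV[R]_n) (k : nat).

Lemma Ck_sub W U A k (f : 'rV[R]_n -> W) : A `<=` U -> Ck k U f -> Ck k A f.
Proof.
move=> AU; elim: k f => [|k IH] f /=; first by move=> cf x /AU /cf.
by move=> [df dvf]; split=> [x /AU /df //|v]; exact: IH.
Qed.

Lemma Ck_local W U k (f : 'rV[R]_n -> W) :
  (forall x, U x -> exists2 A, A x & Ck k A f) -> Ck k U f.
Proof.
elim: k f => [|k IH] f /= loc; first by move=> x /loc[A Ax cf]; exact: cf.
split=> [x /loc[A Ax [df _]]|v]; first exact: df.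
by apply: IH => x /loc[A Ax [_ /(_ v)]]; exists A.
Qed.

(** A derivative at a point depends on the germ there; openness of [U] lets agreement on [U] pass to
    the derivatives ['D_v]. *)
Lemma Ck_ext W U k (f g : 'rV[R]_n -> W) :
  open U -> (forall x, U x -> f x = g x) -> Ck k U f -> Ck k U g.
Proof.
move=> oU.
have nr x (h1 h2 : 'rV[R]_n -> W) : (forall x, U x -> h1 x = h2 x) -> U x ->
    \forall y \near x, h1 y = h2 y.
  move=> h12 Ux; near=> y; apply: h12; near: y.
  exact: open_nbhs_nbhs.
elim: k f g => [|k IH] f g /= fg.
  move=> cf x Ux; have /= {}cf := cf x Ux.
  rewrite /prop_for /continuous_at -fg //.
  exact: cvg_trans (near_eq_cvg (nr _ _ _ fg Ux)) cf.
case=> df dvf; split=> [x Ux|v].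
  by apply: near_eq_differentiable (df x Ux); exact: nr.
apply: IH (dvf v) => x Ux; exact: near_eq_derive (nr _ _ _ fg Ux).
Unshelve. all: by end_near. Qed.

Lemma CkS W U k (f : 'rV[R]_n -> W) : Ck k.+1 U f -> Ck k U f.
Proof.
elim: k f => [|k IH] f [df dvf].
  by move=> x /df; exact: differentiable_continuous.
by split=> // v; apply: IH; exact: dvf.
Qed.

Lemma Ck_cst W U k (c : W) : Ck k U (cst c).
Proof.
elim: k c => [|k IH] c /=; first by move=> x _; exact: cst_continuous.
split=> [x _|v]; first exact: differentiable_cst.
rewrite (_ : 'D_v _ = cst 0); first exact: IH.
by apply/funext => x; rewrite derive_cst.
Qed.

Lemma Ck_continuous W U k (f : 'rV[R]_n -> W) :
  Ck k U f -> forall x, U x -> {for x, continuous f}.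
Proof. by elim: k => [//|k IH] /CkS/IH. Qed.

End CkGeneral.

Section CkScalar.
Variables (R : realType) (n : nat).
Implicit Types (U A : set 'rV[R]_n) (k : nat) (f g : 'rV[R]_n -> R).

Lemma Ck_add U k f g : open U -> Ck k U f -> Ck k U g -> Ck k U (f + g).
Proof.
move=> oU; elim: k f g => [|k IH] f g /=.
  by move=> cf cg x Ux; apply: continuousD; [exact: cf|exact: cg].
move=> [df dvf] [dg dvg]; split=> [x Ux|v].
  by apply: differentiableD; [exact: df|exact: dg].
apply: Ck_ext oU _ (IH _ _ (dvf v) (dvg v)) => x Ux /=.
by rewrite deriveD //; apply: diff_derivable; [exact: df|exact: dg].
Qed.

Lemma Ck_mul U k f g : open U -> Ck k U f -> Ck k U g -> Ck k U (f * g).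
Proof.
move=> oU; elim: k f g => [|k IH] f g.
  by move=> cf cg x Ux; apply: continuousM; [exact: cf|exact: cg].
move=> Cf Cg; have [df dvf] := Cf; have [dg dvg] := Cg; split=> [x Ux|v].
  by apply: differentiableM; [exact: df|exact: dg].
apply: Ck_ext oU _ (Ck_add oU (IH _ _ (CkS Cf) (dvg v))
  (IH _ _ (CkS Cg) (dvf v))) => x Ux /=.
by rewrite deriveM //; apply: diff_derivable; [exact: df|exact: dg].
Qed.

Lemma Ck_inv U k f : open U -> (forall x, U x -> f x != 0) ->
  Ck k U f -> Ck k U (fun x => (f x)^-1).
Proof.
move=> oU f0; elim: k => [|k IH].
  by move=> cf x Ux; apply: continuousV; [exact: f0|exact: cf].
move=> Cf; have [df dvf] := Cf; split=> [x Ux|v].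
  by apply: differentiableV; [exact: df|exact: f0].
have Ci := IH (CkS Cf).
have C1 : Ck k U (cst (-1) : 'rV[R]_n -> R) by exact: Ck_cst.
apply: Ck_ext oU _ (Ck_mul oU (Ck_mul oU C1 (Ck_mul oU Ci Ci)) (dvf v)) => x Ux.
rewrite deriveV; [|exact: f0|by apply: diff_derivable; exact: df].
have -> (a b : R) : a *: b = a * b by [].
by rewrite !fctE expr2 invfM mulN1r.
Qed.

Lemma derive_coord (x v : 'rV[R]_n) i :
  'D_v (fun y : 'rV[R]_n => y 0 i) x = v 0 i.
Proof.
have := derive_mx (@derivable_id _ _ x v); rewrite derive_id.
by move/(congr1 (fun M : 'rV_n => M 0 i)); rewrite mxE => <-.
Qed.

Lemma Ck_coord U k (i : 'I_n) : Ck k U (fun x => x 0 i).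
Proof.
case: k => [|k]; first by move=> x _; exact: coord_continuous.
split=> [x _|v]; first exact: differentiable_coord.
rewrite (_ : 'D_v _ = cst (v 0 i)); first exact: Ck_cst.
by apply/funext => x; rewrite derive_coord.
Qed.

(** A family closed under derivation lets the induction replace [h] by its derivative. It serves for
    the functions built from exp (-1/t). *)
Lemma Ck_family (F : set (R -> R)) :
  (forall h, F h -> (forall t, derivable h t 1) /\ F (derive1 h)) ->
  forall U k h g, open U -> F h -> Ck k U g -> Ck k U (h \o g).
Proof.
move=> HF U k h g oU; elim: k h g => [|k IH] h g Fh.
  move=> cg x Ux; apply: continuous_comp; first exact: cg.
  by apply/differentiable_continuous/derivable1_diffP; have [] := HF _ Fh.
have [dh Fh'] := HF _ Fh.
move=> Cg; have [dg dvg] := Cg; split=> [x Ux|v].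
  by apply: differentiable_comp; [exact: dg|exact/derivable1_diffP].
apply: Ck_ext oU _ (Ck_mul oU (IH _ _ Fh' (CkS Cg)) (dvg v)) => x Ux /=.
have dhg : differentiable h (g x) by exact/derivable1_diffP.
rewrite [RHS]deriveE; last by apply: differentiable_comp dhg; exact: dg.
rewrite diff_comp //=; last exact: dg.
have Dg : 'D_v g x = 'd g x v by rewrite deriveE //; exact: dg.
rewrite diff1E // -Dg; have -> (a b : R) : a *: b = a * b by [].
by rewrite mulrC.
Qed.

End CkScalar.

Section CkMatrix.
Variables (R : realType) (n a b : nat).
Implicit Types (U A : set 'rV[R]_n) (k : nat) (M : 'rV[R]_n -> 'M[R]_(a, b)).

Lemma differentiable_mxP M x :
  differentiable M x <-> forall i j, differentiable (fun y => M y i j) x.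
Proof.
split=> [dM i j|dM].
  apply: (@differentiable_comp _ _ _ _ M (fun N : 'M[R]_(a, b) => N i j)) => //.
  exact: differentiable_coord.
rewrite (_ : M = \sum_(i < a) \sum_(j < b) fun y => M y i j *: delta_mx i j).
  apply: differentiable_sum => i; apply: differentiable_sum => j.
  exact: differentiableZl.
apply/funext => y; rewrite [LHS]matrix_sum_delta fct_sumE.
by apply: eq_bigr => i _; rewrite fct_sumE.
Qed.

Lemma continuous_mxP (T : topologicalType) (M : T -> 'M[R]_(a, b)) (x : T) :
  {for x, continuous M} <-> forall i j, {for x, continuous (fun y => M y i j)}.
Proof.
split=> [cM i j|cM].
  apply: (@continuous_comp _ _ _ M (fun N : 'M[R]_(a, b) => N i j)) => //.
  exact: coord_continuous.
move=> A [P MP PA]; rewrite nbhs_simpl /=.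
have : \forall y \near x, forall ij, P ij.1 ij.2 (M y ij.1 ij.2).
  by apply: filter_forall => -[i j]; exact: cM (MP i j).
by apply: filterS => y /= Py; apply: PA => i j; exact: Py (i, j).
Qed.

Lemma Ck_mxP U k M : open U ->
  Ck k U M <-> forall i j, Ck k U (fun y => M y i j).
Proof.
move=> oU; elim: k M => [|k IH] M /=.
  split=> [cM i j x Ux|cM x Ux].
    by have /continuous_mxP := cM _ Ux; apply.
  by apply/continuous_mxP => i j; exact: cM.
have dvM v : (forall x, U x -> differentiable M x) -> forall x, U x ->
    'D_v M x = \matrix_(i, j) 'D_v (fun y => M y i j) x.
  by move=> dM x /dM/diff_derivable-/(_ v)/derive_mx.
split=> [[dM CM] i j|CM].
  split=> [x Ux|v]; first by have /differentiable_mxP := dM _ Ux; apply.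
  have /IH-/(_ i j) := CM v.
  by apply: Ck_ext oU _ => x Ux; rewrite dvM // mxE.
have dM x : U x -> differentiable M x.
  by move=> Ux; apply/differentiable_mxP => i j; have [+ _] := CM i j; apply.
split=> // v; apply/IH => i j; have [_ /(_ v)] := CM i j.
by apply: Ck_ext oU _ => x Ux; rewrite dvM // mxE.
Qed.

End CkMatrix.

Section SmoothScalar.
Variables (R : realType) (n : nat).
Implicit Types (U A : set 'rV[R]_n) (f g : 'rV[R]_n -> R).

Lemma smooth_sub (W : normedModType R) U A (f : 'rV[R]_n -> W) :
  A `<=` U -> smooth_on U f -> smooth_on A f.
Proof. by move=> AU sf k; exact: Ck_sub AU (sf k). Qed.

Lemma smooth_local (W : normedModType R) U (f : 'rV[R]_n -> W) :
  (forall x, U x -> exists2 A, A x & smooth_on A f) -> smooth_on U f.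
Proof.
by move=> loc k; apply: Ck_local => x /loc[A Ax sf]; exists A => //; exact: sf.
Qed.

Lemma smooth_ext (W : normedModType R) U (f g : 'rV[R]_n -> W) : open U ->
  (forall x, U x -> f x = g x) -> smooth_on U f -> smooth_on U g.
Proof. by move=> oU fg sf k; exact: Ck_ext oU fg (sf k). Qed.

Lemma smooth_cst (W : normedModType R) U (c : W) : smooth_on U (fun=> c).
Proof. by move=> k; exact: Ck_cst. Qed.

Lemma smooth_derive (W : normedModType R) U (f : 'rV[R]_n -> W) v :
  smooth_on U f -> smooth_on U ('D_v f).
Proof. by move=> sf k; have [_] := sf k.+1; exact. Qed.

Lemma smooth_differentiable (W : normedModType R) U (f : 'rV[R]_n -> W) x :
  smooth_on U f -> U x -> differentiable f x.
Proof. by move=> sf Ux; have [+ _] := sf 1%N; exact. Qed.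

Lemma smooth_continuous (W : normedModType R) U (f : 'rV[R]_n -> W) x :
  smooth_on U f -> U x -> {for x, continuous f}.
Proof. by move=> sf Ux; exact: (Ck_continuous (sf 0%N)). Qed.

Lemma smooth_add U f g : open U ->
  smooth_on U f -> smooth_on U g -> smooth_on U (fun x => f x + g x).
Proof. by move=> oU sf sg k; exact: (Ck_add oU (sf k) (sg k)). Qed.

Lemma smooth_mul U f g : open U ->
  smooth_on U f -> smooth_on U g -> smooth_on U (fun x => f x * g x).
Proof. by move=> oU sf sg k; exact: (Ck_mul oU (sf k) (sg k)). Qed.

Lemma smooth_opp U f : open U -> smooth_on U f -> smooth_on U (fun x => - f x).
Proof.
move=> oU sf.
have C1 : smooth_on U (cst (-1) : 'rV[R]_n -> R) by exact: smooth_cst.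
by apply: smooth_ext oU _ (smooth_mul oU C1 sf) => x _; rewrite mulN1r.
Qed.

Lemma smooth_inv U f : open U -> (forall x, U x -> f x != 0) ->
  smooth_on U f -> smooth_on U (fun x => (f x)^-1).
Proof. by move=> oU f0 sf k; exact: (Ck_inv oU f0 (sf k)). Qed.

Lemma smooth_coord U (i : 'I_n) : smooth_on U (fun x => x 0 i).
Proof. by move=> k; exact: Ck_coord. Qed.

Lemma Ck_sum U k (I : Type) (r : seq I) (P : pred I) (F : I -> 'rV[R]_n -> R) :
  open U -> (forall i, P i -> Ck k U (F i)) ->
  Ck k U (fun x => \sum_(i <- r | P i) F i x).
Proof.
move=> oU sF; elim: r => [|i r IH].
  have C0 : Ck k U (cst 0 : 'rV[R]_n -> R) by exact: Ck_cst.
  by apply: Ck_ext oU _ C0 => x _; rewrite big_nil.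
case Pi : (P i).
  by apply: Ck_ext oU _ (Ck_add oU (sF i Pi) IH) => x _; rewrite big_cons Pi.
by apply: Ck_ext oU _ IH => x _; rewrite big_cons Pi.
Qed.

Lemma smooth_sum U (I : Type) (r : seq I) (P : pred I) (F : I -> 'rV[R]_n -> R) :
  open U -> (forall i, P i -> smooth_on U (F i)) ->
  smooth_on U (fun x => \sum_(i <- r | P i) F i x).
Proof. by move=> oU sF k; apply: Ck_sum => // i Pi; exact: sF. Qed.

Lemma smooth_prod U (I : Type) (r : seq I) (P : pred I) (F : I -> 'rV[R]_n -> R) :
  open U -> (forall i, P i -> smooth_on U (F i)) ->
  smooth_on U (fun x => \prod_(i <- r | P i) F i x).
Proof.
move=> oU sF; elim: r => [|i r IH].
  have C1 : smooth_on U (cst 1 : 'rV[R]_n -> R) by exact: smooth_cst.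
  by apply: smooth_ext oU _ C1 => x _; rewrite big_nil.
case Pi : (P i).
  apply: smooth_ext oU _ (smooth_mul oU (sF i Pi) IH) => x _.
  by rewrite big_cons Pi.
by apply: smooth_ext oU _ IH => x _; rewrite big_cons Pi.
Qed.

Lemma derive_sum_delta (W : normedModType R) (f : 'rV[R]_n -> W) x v :
  differentiable f x ->
  'D_v f x = \sum_i v 0 i *: 'D_(delta_mx 0 i) f x.
Proof.
move=> df; rewrite deriveE // [in LHS](row_sum_delta v) linear_sum.
by apply: eq_bigr => i _; rewrite linearZ deriveE.
Qed.

End SmoothScalar.

Lemma derive_comp (R : realType) (V V' W : normedModType R) (f : V -> V')
    (g : V' -> W) x v :
  differentiable f x -> differentiable g (f x) ->
  'D_v (g \o f) x = 'D_('D_v f x) g (f x).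
Proof.
move=> df dg; rewrite deriveE; last exact: differentiable_comp.
by rewrite diff_comp //= !deriveE.
Qed.

(** The chain rule writes ['D_v (g \o f)] as a sum of products of derivatives of [f] and partial
    derivatives of [g] composed with [f]; the induction lowers the order of [g] while [f] stays
    smooth. *)
Lemma Ck_comp (R : realType) (n m : nat) (U : set 'rV[R]_n) (U' : set 'rV[R]_m)
    k (f : 'rV[R]_n -> 'rV[R]_m) (g : 'rV[R]_m -> R) :
  open U -> (forall x, U x -> U' (f x)) -> smooth_on U f -> Ck k U' g ->
  Ck k U (g \o f).
Proof.
move=> oU fU sf; elim: k g => [|k IH] g.
  move=> cg x Ux; apply: continuous_comp; first exact: smooth_continuous Ux.
  exact/cg/fU.
move=> [dg dvg]; split=> [x Ux|v].
  apply: differentiable_comp; first exact: smooth_differentiable Ux.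
  exact/dg/fU.
have /Ck_mxP-/(_ oU) Cdf := smooth_derive v sf k.
have : Ck k U (fun x => \sum_i ('D_v f x) 0 i * ('D_(delta_mx 0 i) g \o f) x).
  by apply: Ck_sum => // i _; exact: (Ck_mul oU (Cdf 0 i) (IH _ (dvg _))).
apply: Ck_ext => // x Ux.
have df : differentiable f x by exact: smooth_differentiable Ux.
rewrite [RHS]derive_comp //; last exact/dg/fU.
by rewrite [RHS]derive_sum_delta //; exact/dg/fU.
Qed.

Lemma smooth_comp (R : realType) (n m : nat) (U : set 'rV[R]_n)
    (U' : set 'rV[R]_m) (f : 'rV[R]_n -> 'rV[R]_m) (g : 'rV[R]_m -> R) :
  open U -> (forall x, U x -> U' (f x)) -> smooth_on U f -> smooth_on U' g ->
  smooth_on U (fun x => g (f x)).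
Proof. by move=> oU fU sf sg k; exact: Ck_comp fU sf (sg k). Qed.

Section SmoothMatrix.
Variables (R : realType) (n : nat) (U : set 'rV[R]_n).
Hypothesis oU : open U.
Local Notation sm M := (smooth_on U M).

Lemma smooth_mxP a b (M : 'rV[R]_n -> 'M[R]_(a, b)) :
  sm M <-> forall i j, sm (fun x => M x i j).
Proof.
split=> [sM i j k|sM k]; first by move: i j; apply/Ck_mxP => //; exact: sM.
by apply/Ck_mxP => // i j; exact: sM.
Qed.

Lemma smooth_comp_mx m a b (U' : set 'rV[R]_m) (f : 'rV[R]_n -> 'rV[R]_m)
    (M : 'rV[R]_m -> 'M[R]_(a, b)) : open U' ->
  (forall x, U x -> U' (f x)) -> sm f -> smooth_on U' M ->
  sm (fun x => M (f x)).
Proof.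
move=> oU' fU sf sM; apply/smooth_mxP => i j.
apply: (smooth_comp oU fU sf (g := fun y => M y i j)) => k.
by move: i j; apply/Ck_mxP => //; exact: sM.
Qed.

Lemma smooth_addmx a b (M N : 'rV[R]_n -> 'M[R]_(a, b)) :
  sm M -> sm N -> sm (fun x => M x + N x).
Proof.
move=> /smooth_mxP sM /smooth_mxP sN; apply/smooth_mxP => i j.
by apply: smooth_ext (smooth_add oU (sM i j) (sN i j)) => // x _; rewrite mxE.
Qed.

Lemma smooth_scalemx a b (c : 'rV[R]_n -> R) (N : 'rV[R]_n -> 'M[R]_(a, b)) :
  sm c -> sm N -> sm (fun x => c x *: N x).
Proof.
move=> sc /smooth_mxP sN; apply/smooth_mxP => i j.
by apply: smooth_ext (smooth_mul oU sc (sN i j)) => // x _; rewrite mxE.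
Qed.

Lemma smooth_oppmx a b (M : 'rV[R]_n -> 'M[R]_(a, b)) :
  sm M -> sm (fun x => - M x).
Proof.
move=> /smooth_mxP sM; apply/smooth_mxP => i j.
by apply: smooth_ext (smooth_opp oU (sM i j)) => // x _; rewrite mxE.
Qed.

Lemma smooth_mulmx a b c (M : 'rV[R]_n -> 'M[R]_(a, b))
    (N : 'rV[R]_n -> 'M[R]_(b, c)) :
  sm M -> sm N -> sm (fun x => M x *m N x).
Proof.
move=> /smooth_mxP sM /smooth_mxP sN; apply/smooth_mxP => i j.
have : sm (fun x => \sum_l M x i l * N x l j).
  by apply: smooth_sum => // l _; exact: smooth_mul.
by apply: smooth_ext => // x _; rewrite mxE.
Qed.

Lemma smooth_trmx a b (M : 'rV[R]_n -> 'M[R]_(a, b)) :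
  sm M -> sm (fun x => (M x)^T).
Proof.
move=> /smooth_mxP sM; apply/smooth_mxP => i j.
by apply: smooth_ext (sM j i) => // x _; rewrite mxE.
Qed.

Lemma smooth_row_mx a b c (M : 'rV[R]_n -> 'M[R]_(a, b))
    (N : 'rV[R]_n -> 'M[R]_(a, c)) :
  sm M -> sm N -> sm (fun x => row_mx (M x) (N x)).
Proof.
move=> /smooth_mxP sM /smooth_mxP sN; apply/smooth_mxP => i j.
case: (split_ordP j) => l ->.
  by apply: smooth_ext (sM i l) => // x _; rewrite row_mxEl.
by apply: smooth_ext (sN i l) => // x _; rewrite row_mxEr.
Qed.

Lemma smooth_det a (M : 'rV[R]_n -> 'M[R]_a) : sm M -> sm (fun x => \det (M x)).
Proof.
move=> /smooth_mxP sM; apply: smooth_sum => // s _.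
apply: smooth_mul => //; first exact: smooth_cst.
by apply: smooth_prod => // i _; exact: sM.
Qed.

Lemma smooth_invmx a (M : 'rV[R]_n -> 'M[R]_a) :
  (forall x, U x -> M x \in unitmx) -> sm M -> sm (fun x => invmx (M x)).
Proof.
move=> uM sM.
have : sm (fun x => (\det (M x))^-1 *: \adj (M x)).
  apply: smooth_scalemx.
    apply: smooth_inv => //; last exact: smooth_det.
    by move=> x /uM; rewrite unitmxE unitfE.
  apply/smooth_mxP => i j.
  have : sm (fun x => (-1) ^+ (j + i) * \det (row' j (col' i (M x)))).
    apply: smooth_mul => //; first exact: smooth_cst.
    apply: smooth_det; apply/smooth_mxP => i' j'.
    move/smooth_mxP: sM => /(_ (lift j i') (lift i j')).
    by apply: smooth_ext => // x _; rewrite !mxE.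
  by apply: smooth_ext => // x _; rewrite mxE.
by apply: smooth_ext => // x /uM uMx; rewrite /invmx uMx.
Qed.

End SmoothMatrix.

Section Jacobian.
Variables (R : realType).

Lemma jacobianE n m (f : 'rV[R]_n -> 'rV[R]_m) x i j :
  jacobian f x i j = 'd f x (delta_mx 0 i) 0 j.
Proof. by rewrite mxE. Qed.

Lemma row_jacobian n m (f : 'rV[R]_n -> 'rV[R]_m) x i :
  differentiable f x -> row i (jacobian f x) = 'D_(delta_mx 0 i) f x.
Proof. by move=> df; rewrite deriveEjacobian // -rowE. Qed.

Lemma jacobian_comp n m l (f : 'rV[R]_n -> 'rV[R]_m) (g : 'rV[R]_m -> 'rV[R]_l)
    x :
  differentiable f x -> differentiable g (f x) ->
  jacobian (g \o f) x = jacobian f x *m jacobian g (f x).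
Proof.
move=> df dg; have dgf := differentiable_comp df dg.
apply/row_matrixP => i; rewrite row_mul (row_jacobian _ dgf) (row_jacobian _ df).
by rewrite (@derive_comp _ _ _ _ f g) // -deriveEjacobian.
Qed.

Lemma jacobian_near n m (f g : 'rV[R]_n -> 'rV[R]_m) x :
  differentiable f x -> (\forall y \near x, f y = g y) ->
  jacobian f x = jacobian g x.
Proof.
move=> df fg; have dg := near_eq_differentiable fg df.
apply/row_matrixP => i.
exact: etrans (row_jacobian _ df)
  (etrans (near_eq_derive _ fg) (esym (row_jacobian _ dg))).
Qed.

Lemma jacobian_id n (x : 'rV[R]_n) : jacobian id x = 1%:M.
Proof.
by apply/row_matrixP => i; rewrite row_jacobian // derive_id row1.
Qed.

Lemma smooth_jacobian n m (U : set 'rV[R]_n) (f : 'rV[R]_n -> 'rV[R]_m) :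
  open U -> smooth_on U f -> smooth_on U (jacobian f).
Proof.
move=> oU sf; apply/smooth_mxP => // i j.
have /smooth_mxP-/(_ oU 0 j) := smooth_derive (delta_mx 0 i) sf.
apply: smooth_ext => // x Ux.
by rewrite jacobianE deriveE //; exact: smooth_differentiable Ux.
Qed.

End Jacobian.

(** * Symmetry of second derivatives *)

Section Schwarz.
Variables (R : realType).

Lemma MVT_line (V : normedModType R) (f : V -> R) (y w : V) (h : R) : 0 < h ->
  (forall t, 0 <= t <= h -> differentiable f (y + t *: w)) ->
  exists2 t, 0 <= t <= h & f (y + h *: w) - f y = h * 'D_w f (y + t *: w).
Proof.
move=> h0 df; pose l (t : R) := y + t *: w.
have dl t : is_diff t l (fun s => s *: w).
  rewrite (_ : (fun _ => _) = 0 + ( *:%R^~ w)); last first.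
    by apply/funext => s; rewrite /= add0r.
  exact: is_diffD.
have dfl t : 0 <= t <= h -> differentiable (f \o l) t.
  by move=> th; apply: differentiable_comp => //; exact: df.
have H t : t \in `]0, h[%R -> is_derive t 1 (f \o l) ('D_w f (l t)).
  rewrite in_itv /= => /andP[t0 th].
  have th' : 0 <= t <= h by rewrite !ltW.
  apply: DeriveDef; first exact: diff_derivable (dfl _ _).
  rewrite derive_comp //; last exact: df.
  suff -> : 'D_1 l t = w by [].
  by have [dlt El] := dl t; rewrite deriveE // El scale1r.
have [|t tI E] := MVT h0 H.
  apply: continuous_in_subspaceT => t; rewrite inE /= in_itv /= => th.
  exact/differentiable_continuous/dfl.
exists t; first by move: tI; rewrite in_itv /= => /andP[? ?]; rewrite !ltW.
by move: E; rewrite /= /l scale0r addr0 subr0 mulrC.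
Qed.

(** The mean value theorem is used along [v] for the first difference of [g] in the direction [u],
    then along [u] for ['D_v g]. *)
Lemma second_difference n (U : set 'rV[R]_n) (g : 'rV[R]_n -> R) x u v h :
  smooth_on U g -> 0 < h ->
  (forall s t, 0 <= s <= h -> 0 <= t <= h -> U (x + s *: u + t *: v)) ->
  exists s t, [/\ 0 <= s <= h, 0 <= t <= h &
    g (x + h *: u + h *: v) - g (x + h *: u) - (g (x + h *: v) - g x) =
    h * (h * 'D_u ('D_v g) (x + s *: u + t *: v))].
Proof.
move=> sg h0 xU.
have hh : 0 <= h <= h by apply/andP; split=> //; exact: ltW.
have h00 : 0 <= (0 : R) <= h by apply/andP; split=> //; exact: ltW.
have dg y : U y -> differentiable g y by exact: smooth_differentiable.
pose f y := g (y + h *: u) - g y.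
have dgu y : U (y + h *: u) -> differentiable (fun y => g (y + h *: u)) y.
  move=> Uy; apply: (@differentiable_comp _ _ _ _ (fun y => y + h *: u) g) => //.
  exact: dg.
have U1 t : 0 <= t <= h -> U (x + t *: v + h *: u).
  by move=> th; rewrite addrAC; exact: xU.
have U2 t : 0 <= t <= h -> U (x + t *: v).
  by move=> th; have := xU 0 t h00 th; rewrite scale0r addr0.
have [t th Et] : exists2 t, 0 <= t <= h &
    f (x + h *: v) - f x = h * 'D_v f (x + t *: v).
  apply: MVT_line => // t th; apply: differentiableB.
    by apply: dgu; exact: U1.
  by apply: dg; exact: U2.
have [s sh Es] : exists2 s, 0 <= s <= h &
    'D_v g (x + t *: v + h *: u) - 'D_v g (x + t *: v) =
    h * 'D_u ('D_v g) (x + t *: v + s *: u).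
  apply: (@MVT_line _ ('D_v g) (x + t *: v) u h h0) => s sh.
  apply: smooth_differentiable (smooth_derive v sg) _.
  by rewrite addrAC; exact: xU.
exists s, t; split=> //.
rewrite [in RHS]addrAC -Es; move: Et; rewrite /f.
have -> : 'D_v f (x + t *: v) =
    'D_v g (x + t *: v + h *: u) - 'D_v g (x + t *: v).
  rewrite deriveB; last 2 first.
  - by apply/diff_derivable/dgu/U1.
  - by apply/diff_derivable/dg/U2.
  congr (_ - _).
  rewrite (@derive_comp _ _ _ _ (fun y => y + h *: u) g) //; last exact/dg/U1.
  by rewrite deriveD // derive_id derive_cst addr0.
move=> <-; rewrite [x + h *: v + _]addrAC; ring.
Qed.

(** The limiting half of Schwarz's theorem: values of [F] and [G] that agree somewhere in
    arbitrarily small parallelograms at [x] agree at [x] by continuity. *)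
Lemma eq_from_small_squares n (U : set 'rV[R]_n) (F G : 'rV[R]_n -> R) x u v :
  open U -> U x -> {for x, continuous F} -> {for x, continuous G} ->
  (forall h, 0 < h ->
    (forall s t, 0 <= s <= h -> 0 <= t <= h -> U (x + s *: u + t *: v)) ->
    exists s t s' t', [/\ 0 <= s <= h, 0 <= t <= h, 0 <= s' <= h, 0 <= t' <= h &
      F (x + s *: u + t *: v) = G (x + s' *: u + t' *: v)]) ->
  F x = G x.
Proof.
move=> oU Ux cF cG FG.
apply/eqP; rewrite -subr_eq0 -normr_le0; apply/ler_addgt0Pr => e e0.
have e20 : 0 < e / 2 by rewrite divr_gt0.
have nF : \forall y \near x, `|F x - F y| < e / 2.
  by move/cvgrPdist_lt : cF; apply.
have nG : \forall y \near x, `|G x - G y| < e / 2.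
  by move/cvgrPdist_lt : cG; apply.
pose P y := [/\ U y, `|F x - F y| < e / 2 & `|G x - G y| < e / 2].
have nP : nbhs x P.
  by near=> y; split; near: y => //; exact: open_nbhs_nbhs.
have cl : {for ((0, 0) : R * R),
    continuous (fun st : R * R => x + st.1 *: u + st.2 *: v)}.
  apply: continuousD.
    apply: continuousD; first exact: cst_continuous.
    by apply: continuousZr_tmp; exact: cvg_fst.
  by apply: continuousZr_tmp; exact: cvg_snd.
have : nbhs ((0, 0) : R * R) [set st | P (x + st.1 *: u + st.2 *: v)].
  by apply: cl; rewrite /= !scale0r !addr0.
move=> [[A B] /= [/nbhs_ballP[a /= a0 aA] /nbhs_ballP[b /= b0 bB]] AB].
(* Half of the smaller radius, so that the closed range from 0 to [h] lies in both open balls. *)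
pose h := Num.min a b / 2.
have m0 : 0 < Num.min a b by rewrite lt_min a0.
have h0 : 0 < h by rewrite divr_gt0.
have hP s t : 0 <= s <= h -> 0 <= t <= h -> P (x + s *: u + t *: v).
  have small r c : 0 <= r <= h -> Num.min a b <= c -> ball 0 c r.
    move=> /andP[r0 rh] mc; rewrite -ball_normE /= sub0r normrN ger0_norm //.
    rewrite (le_lt_trans rh) // (lt_le_trans _ mc) // ltr_pdivrMr //.
    by rewrite ltr_pMr // ltr1n.
  move=> sh th; apply: (AB (s, t)); split => /=.
    by apply: aA; apply: small; rewrite ?ge_min ?lexx.
  by apply: bB; apply: small; rewrite ?ge_min ?lexx ?orbT.
have [|s [t [s' [t' [sh th sh' th' E]]]]] := FG h h0.
  by move=> s t sh th; have [] := hP s t sh th.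
have [_ H1 _] := hP s t sh th.
have [_ _ H2] := hP s' t' sh' th'.
rewrite E in H1; rewrite add0r.
set z := G _ in H1 H2.
rewrite (_ : F x - G x = (F x - z) - (G x - z)); last by ring.
by apply: le_trans (ler_normB _ _) _; rewrite ltW // [ltRHS]splitr ltrD.
Unshelve. all: by end_near. Qed.

(** The second difference over a parallelogram is symmetric in [u] and [v], and it is h^2 times a
    value of either mixed derivative. *)
Lemma schwarz n (U : set 'rV[R]_n) (g : 'rV[R]_n -> R) x u v :
  open U -> smooth_on U g -> U x -> 'D_u ('D_v g) x = 'D_v ('D_u g) x.
Proof.
move=> oU sg Ux.
apply: (@eq_from_small_squares n U ('D_u ('D_v g)) ('D_v ('D_u g)) x u v) => //.
- by apply: (@smooth_continuous _ _ _ U) => //; do 2!apply: smooth_derive.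
- by apply: (@smooth_continuous _ _ _ U) => //; do 2!apply: smooth_derive.
move=> h h0 xU.
have [s [t [sh th E1]]] := @second_difference n U g x u v h sg h0 xU.
have [|s' [t' [sh' th' E2]]] := @second_difference n U g x v u h sg h0.
  by move=> s' t' sh' th'; rewrite addrAC; exact: xU.
exists s, t, t', s'; split; [exact: sh|exact: th|exact: th'|exact: sh'|].
apply: (mulfI (lt0r_neq0 h0)); apply: (mulfI (lt0r_neq0 h0)).
rewrite [x + s' *: v + _]addrAC in E2.
apply: etrans (esym E1) (etrans _ E2).
by rewrite [x + h *: v + _]addrAC; ring.
Qed.

End Schwarz.

(** * Matrices of constant rank *)

Section ConstantRank.
Variable F : fieldType.

(** An invertible minor of maximal size forces [L *m B] to span the rows of [B]. Thus
    [Q *m invmx (L *m B *m Q) *m L] is a generalised inverse of [B], rational in its entries: this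
    is how constant rank yields smoothness. *)
Lemma rank_factor n m s (B : 'M[F]_(n, m)) (L : 'M[F]_(s, n)) (Q : 'M[F]_(m, s)) :
  (\rank B <= s)%N -> L *m B *m Q \in unitmx ->
  B *m Q *m invmx (L *m B *m Q) *m L *m B = B.
Proof.
move=> rB uM.
have sLB : (L *m B <= B)%MS by exact: submxMl.
have : (B <= L *m B)%MS.
  rewrite -(geq_leqif (mxrank_leqif_sup sLB)) (leq_trans rB) //.
  by have := mxrank_unit uM => rM; rewrite -[leqLHS]rM mxrankM_maxl.
move=> /submxP[Z BE].
have -> : B *m Q = Z *m (L *m B *m Q) by rewrite {1}BE !mulmxA.
by rewrite mulmxK // -mulmxA -BE.
Qed.

Lemma rank_section n m (B : 'M[F]_(n, m)) :
  exists (L : 'M[F]_(\rank B, n)) (Q : 'M[F]_(m, \rank B)), L *m B *m Q = 1%:M.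
Proof.
exists (pinvmx (col_base B)), (pinvmx (row_base B)).
have : pinvmx (col_base B) *m (col_base B *m row_base B) *m
    pinvmx (row_base B) = 1%:M.
  by rewrite mulmxA mulVpmx ?col_base_full // mul1mx mulmxVp ?row_base_free.
by rewrite mulmx_base.
Qed.

(* The [k] blocks are laid side by side. *)
Definition juxtapose n m k (B : 'I_k -> 'M[F]_(n, m)) : 'M[F]_(n, k * m) :=
  \matrix_i mxvec (\matrix_(j, l) B j i l).

Lemma mul_juxtapose_eq0 r n m k (X : 'M[F]_(r, n)) (B : 'I_k -> 'M[F]_(n, m)) :
  X *m juxtapose B = 0 <-> forall j, X *m B j = 0.
Proof.
have E i j l : (X *m juxtapose B) i (mxvec_index j l) = (X *m B j) i l.
  by rewrite !mxE; apply: eq_bigr => c _; rewrite mxE mxvecE mxE.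
split=> [X0 j|X0].
  by apply/matrixP => i l; rewrite -E X0 !mxE.
by apply/matrixP => i jl; case/mxvec_indexP: jl => j l; rewrite E X0 !mxE.
Qed.

End ConstantRank.

Section SmoothConstantRank.
Variables (R : realType) (n : nat).
Implicit Types (U A : set 'rV[R]_n).

Lemma open_neq0 U (f : 'rV[R]_n -> R) : open U -> smooth_on U f ->
  open [set x | U x /\ f x != 0].
Proof.
move=> oU sf; rewrite openE => x [Ux fx0].
have cf : {for x, continuous f} by exact: smooth_continuous Ux.
have n0 : nbhs (f x) [set t | t != 0].
  by apply: open_nbhs_nbhs; split; [exact: open_neq|].
by near=> y; split; near: y; [exact: open_nbhs_nbhs|exact: (cf _ n0)].
Unshelve. all: by end_near. Qed.

Lemma open_unitmx U a (M : 'rV[R]_n -> 'M[R]_a) : open U -> smooth_on U M ->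
  open [set x | U x /\ M x \in unitmx].
Proof.
move=> oU sM; rewrite (_ : [set x | _] = [set x | U x /\ \det (M x) != 0]).
  by apply: open_neq0 => //; exact: smooth_det.
by apply/seteqP; split=> x /=; rewrite unitmxE unitfE.
Qed.

(** [L] and [Q] are chosen at [x0] and then frozen. The minor that they cut out stays invertible
    nearby, and the generalised inverse that it defines gives the projector onto the left kernel. *)
Lemma smooth_kernel_projector U a b (B : 'rV[R]_n -> 'M[R]_(a, b)) x0 :
  open U -> smooth_on U B -> U x0 ->
  (forall x, U x -> \rank (B x) = \rank (B x0)) ->
  exists A (pi : 'rV[R]_n -> 'M[R]_a),
    [/\ open A, A x0, A `<=` U, smooth_on A pi &
     forall x, A x -> pi x *m B x = 0 /\
       forall r (X : 'M[R]_(r, a)), X *m B x = 0 -> X *m pi x = X].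
Proof.
move=> oU sB Ux0 rB; have [L [Q LBQ]] := rank_section (B x0).
pose M x := L *m B x *m Q.
pose A := [set x | U x /\ M x \in unitmx].
have sM : smooth_on U M.
  by do 2!(apply: smooth_mulmx => //; last exact: smooth_cst);
     exact: smooth_cst.
have AU : A `<=` U by move=> x [].
exists A, (fun x => 1%:M - B x *m Q *m invmx (M x) *m L).
have oA : open A by exact: open_unitmx.
split=> //.
- by split=> //; rewrite /M LBQ unitmx1.
- apply: smooth_addmx => //; first exact: smooth_cst.
  apply: smooth_oppmx => //.
  apply: smooth_mulmx => //; last exact: smooth_cst.
  apply: smooth_mulmx => //.
    by apply: smooth_mulmx => //; [exact: smooth_sub sB|exact: smooth_cst].
  by apply: smooth_invmx => //; [move=> x []|exact: smooth_sub sM].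
move=> x [Ux uM]; split=> [|r X XB].
  by rewrite mulmxBl mul1mx rank_factor ?rB // subrr.
by rewrite mulmxBr mulmx1 !mulmxA XB !mul0mx subr0.
Qed.

(** The rows of [L *m P x] span the image near [x0]. Multiplying them by the inverse of the minor
    makes [P x *m Q] the matching coordinate map, since [P x] is idempotent. *)
Lemma smooth_frame U a (P : 'rV[R]_n -> 'M[R]_a) r x0 :
  open U -> smooth_on U P -> U x0 ->
  (forall x, U x -> P x *m P x = P x) -> (forall x, U x -> \rank (P x) = r) ->
  exists A (Fr : 'rV[R]_n -> 'M[R]_(r, a)) (Co : 'rV[R]_n -> 'M[R]_(a, r)),
    [/\ open A, A x0, A `<=` U, smooth_on A Fr /\ smooth_on A Co &
     forall x, A x -> Fr x *m Co x = 1%:M /\ Co x *m Fr x = P x].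
Proof.
move=> oU sP Ux0 PP rP.
have [L [Q LPQ]] : exists (L : 'M[R]_(r, a)) (Q : 'M[R]_(a, r)), L *m P x0 *m Q = 1%:M.
  by rewrite -(rP _ Ux0); exact: rank_section.
pose M x := L *m P x *m Q.
pose A := [set x | U x /\ M x \in unitmx].
have sLP : smooth_on U (fun x => L *m P x).
  by apply: smooth_mulmx => //; exact: smooth_cst.
have sM : smooth_on U M.
  by apply: smooth_mulmx => //; exact: smooth_cst.
have AU : A `<=` U by move=> x [].
have oA : open A by exact: open_unitmx.
exists A, (fun x => invmx (M x) *m (L *m P x)), (fun x => P x *m Q); split=> //.
- by split=> //; rewrite /M LPQ unitmx1.
- split; apply: smooth_mulmx => //.
  + by apply: smooth_invmx => //; [move=> x []|exact: smooth_sub sM].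
  + exact: smooth_sub sLP.
  + exact: smooth_sub sP.
  + exact: smooth_cst.
move=> x [Ux uM]; split.
  have -> : invmx (M x) *m (L *m P x) *m (P x *m Q) =
      invmx (M x) *m (L *m (P x *m P x) *m Q) by rewrite !mulmxA.
  by rewrite PP // mulVmx.
by rewrite !mulmxA rank_factor // rP.
Qed.

(** A right inverse found at [x0] and kept fixed turns full row rank into the invertibility of a
    square matrix. *)
Lemma open_row_free U a b (M : 'rV[R]_n -> 'M[R]_(a, b)) x0 :
  open U -> smooth_on U M -> U x0 -> row_free (M x0) ->
  exists A, [/\ open A, A x0, A `<=` U & forall x, A x -> row_free (M x)].
Proof.
move=> oU sM Ux0 fM; pose Q := pinvmx (M x0).
exists [set x | U x /\ M x *m Q \in unitmx]; split.
- by apply: open_unitmx => //; apply: smooth_mulmx => //; exact: smooth_cst.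
- by split=> //; rewrite mulmxVp // unitmx1.
- by move=> x [].
move=> x [_ /mxrank_unit rMQ].
by rewrite /row_free eqn_leq rank_leq_row /= -[X in (X <= _)%N]rMQ mxrankM_maxl.
Qed.

Lemma smooth_juxtapose U a b k (B : 'I_k -> 'rV[R]_n -> 'M[R]_(a, b)) :
  open U -> (forall j, smooth_on U (B j)) ->
  smooth_on U (fun x => juxtapose (B^~ x)).
Proof.
move=> oU sB; apply/smooth_mxP => // i jl; case/mxvec_indexP: jl => j l.
have /smooth_mxP-/(_ oU i l) := sB j.
by apply: smooth_ext => // x _; rewrite mxE mxvecE mxE.
Qed.

End SmoothConstantRank.

(** * Exterior derivatives in coordinates *)

(* Unification would otherwise unfold derivatives at distinct points down to
   their limits. *)
Opaque derive jacobian.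

Section DirectionalDerivatives.
Variables (R : realType) (V : normedModType R).

Lemma derive_mxE a b (M : V -> 'M[R]_(a, b)) x v i j :
  differentiable M x -> ('D_v M x) i j = 'D_v (fun y => M y i j) x.
Proof. by move=> dM; rewrite derive_mx ?mxE //; exact: diff_derivable. Qed.

Lemma derive_sum_mul m (f g : 'I_m -> V -> R) x v :
  (forall l, differentiable (f l) x) -> (forall l, differentiable (g l) x) ->
  'D_v (fun y => \sum_l f l y * g l y) x =
  \sum_l (f l x * 'D_v (g l) x + g l x * 'D_v (f l) x).
Proof.
move=> df dg.
rewrite (_ : (fun y => _) = \sum_l (f l * g l)); last first.
  by apply/funext => y; rewrite fct_sumE.
rewrite derive_sum; last first.
  by move=> l; apply: diff_derivable; exact: differentiableM.
apply: eq_bigr => l _.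
by rewrite deriveM //; exact: diff_derivable.
Qed.

End DirectionalDerivatives.

Section ExteriorDerivative.
Variable R : realType.

(** The expression defining [extd], for arbitrary coefficients, so that it makes sense in every
    chart and at every point of it. *)
Definition antisym_derive n (a : 'rV[R]_n -> 'cV[R]_n) (x : 'rV[R]_n) :=
  \matrix_(i, j) (('D_(delta_mx 0 i) a x) j 0 - ('D_(delta_mx 0 j) a x) i 0).

(** The identity d (phi^* b) = phi^* (d b). Differentiating [jacobian phi y *m b (phi y)] also
    produces second derivatives of [phi]; they are symmetric and cancel in the
    antisymmetrisation. *)
Lemma antisym_derive_pullback n (U : set 'rV[R]_n) (U' : set 'rV[R]_n)
    (phi : 'rV[R]_n -> 'rV[R]_n) (a b : 'rV[R]_n -> 'cV[R]_n) x :
  open U -> open U' -> U x -> (forall y, U y -> U' (phi y)) ->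
  smooth_on U phi -> smooth_on U' b ->
  (forall y, U y -> a y = jacobian phi y *m b (phi y)) ->
  antisym_derive a x =
  jacobian phi x *m antisym_derive b (phi x) *m (jacobian phi x)^T.
Proof.
move=> oU oU' Ux phiU sphi sb aE.
have sJ := smooth_jacobian oU sphi.
have sbphi : smooth_on U (fun y => b (phi y)) by exact: smooth_comp_mx sb.
have sa : smooth_on U a.
  by apply: smooth_ext (smooth_mulmx oU sJ sbphi) => // y /aE.
have da : differentiable a x by exact: smooth_differentiable sa Ux.
have dphi : differentiable phi x by exact: smooth_differentiable sphi Ux.
have db : differentiable b (phi x).
  by apply: smooth_differentiable sb _; exact: phiU.
have dbphi : differentiable (b \o phi) x by exact: differentiable_comp.
have dJ j l : differentiable (fun y => jacobian phi y j l) x.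
  move/(smooth_mxP oU): sJ => /(_ j l) sJ.
  exact: smooth_differentiable sJ Ux.
pose J := jacobian phi x; pose D i j := ('D_(delta_mx 0 i) b (phi x)) j 0.
have Dbphi i l : 'D_(delta_mx 0 i) (fun y => b (phi y) l 0) x =
    \sum_m J i m * D m l.
  rewrite -(derive_mxE _ l 0 dbphi) (derive_comp _ dphi db).
  rewrite derive_sum_delta // summxE; apply: eq_bigr => m _.
  by rewrite mxE deriveEjacobian // -rowE mxE.
have sphil l : smooth_on U (fun y => phi y 0 l).
  by move/(smooth_mxP oU): sphi; apply.
have DJ i j l : 'D_(delta_mx 0 i) (fun y => jacobian phi y j l) x =
    'D_(delta_mx 0 i) ('D_(delta_mx 0 j) (fun y => phi y 0 l)) x.
  apply: near_eq_derive; near=> y.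
  have Uy : U y by near: y; exact: open_nbhs_nbhs.
  have dy : differentiable phi y by exact: smooth_differentiable sphi Uy.
  by rewrite -(derive_mxE _ 0 l dy) deriveEjacobian // -rowE [RHS]mxE.
have Da i j : ('D_(delta_mx 0 i) a x) j 0 =
    \sum_l (J j l * \sum_m J i m * D m l + b (phi x) l 0 *
       'D_(delta_mx 0 i) ('D_(delta_mx 0 j) (fun y => phi y 0 l)) x).
  rewrite (derive_mxE _ j 0 da).
  transitivity ('D_(delta_mx 0 i)
      (fun y => \sum_l jacobian phi y j l * b (phi y) l 0) x).
    apply: near_eq_derive; near=> y.
    by rewrite aE ?mxE //; near: y; exact: open_nbhs_nbhs.
  rewrite derive_sum_mul //; last first.
    move=> l; move/differentiable_mxP : dbphi; exact.
  by apply: eq_bigr => l _; rewrite Dbphi DJ.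
apply/matrixP => i j; rewrite [LHS]mxE !Da -sumrB.
transitivity (\sum_l \sum_m (J i m * D m l * J j l - J j m * D m l * J i l)).
  apply: eq_bigr => l _.
  rewrite (schwarz (delta_mx 0 j) (delta_mx 0 i) oU (sphil l) Ux).
  rewrite opprD addrACA subrr addr0 !mulr_sumr -sumrB.
  by apply: eq_bigr => m _; ring.
rewrite mxE.
transitivity (\sum_l \sum_m J i m * antisym_derive b (phi x) m l * J j l).
  have dist (f g : 'I_n -> 'I_n -> R) : \sum_l \sum_m (f l m - g l m) =
      \sum_l \sum_m f l m - \sum_l \sum_m g l m.
    by rewrite -sumrB; apply: eq_bigr => l _; rewrite sumrB.
  have AE m l : antisym_derive b (phi x) m l = D m l - D l m by rewrite mxE.
  rewrite dist [X in _ - X]exchange_big -dist.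
  apply: eq_bigr => l _; apply: eq_bigr => m _.
  by rewrite AE; ring.
apply: eq_bigr => l _.
by rewrite [(_ *m _) i l]mxE [_^T l j]mxE mulr_suml.
Unshelve. all: by end_near. Qed.

(** The formula d a (X, Y) = X (a (Y)) - Y (a (X)) for constant vector fields, whose bracket
    vanishes. *)
Lemma antisym_deriveP n (a : 'rV[R]_n -> 'cV[R]_n) x (X Y : 'rV[R]_n) :
  differentiable a x ->
  X *m antisym_derive a x *m Y^T = Y *m 'D_X a x - X *m 'D_Y a x.
Proof.
move=> da; pose D := \matrix_(i, j) ('D_(delta_mx 0 i) a x) j 0.
have DE Z : 'D_Z a x = (Z *m D)^T.
  rewrite derive_sum_delta //; apply/colP => l.
  rewrite summxE !mxE; apply: eq_bigr => i _.
  by rewrite !mxE.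
have -> : antisym_derive a x = D - D^T by apply/matrixP => i j; rewrite !mxE.
rewrite !DE mulmxBr mulmxBl; congr (_ - _).
  by rewrite -[LHS]trmxK trmx_mul trmxK [LHS]mx11_scalar [RHS]mx11_scalar mxE.
by rewrite trmx_mul mulmxA.
Qed.

End ExteriorDerivative.

(** * Charts of a manifold *)

Section Charts.
Variables (R : realType) (n : nat) (T : topologicalType).
Implicit Types (c : chart R n T) (A : set T).

Lemma cod_chart c p : dom c p -> cod c (c p).
Proof. by move=> cp; exists p. Qed.

Lemma dom_chart_inv c x : cod c x -> dom c (chart_inv c x).
Proof. by move=> [p cp <-]; rewrite chart_funK. Qed.

Lemma chart_invK c x : cod c x -> c (chart_inv c x) = x.
Proof. by move=> [p cp <-]; rewrite chart_funK. Qed.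

Lemma chart_imageE c A :
  c @` (dom c `&` A) = [set x | cod c x /\ A (chart_inv c x)].
Proof.
apply/seteqP; split=> [_ [p [cp Ap] <-]|x [cx Ax]] /=.
  by rewrite chart_funK //; split=> //; exact: cod_chart.
exists (chart_inv c x); last exact: chart_invK.
by split=> //; exact: dom_chart_inv.
Qed.

Lemma open_chart_image c A : open A -> open (c @` (dom c `&` A)).
Proof.
move=> oA; rewrite chart_imageE openE => x [cx Ax].
have nA : nbhs (chart_inv c x) A by exact: open_nbhs_nbhs.
have ci := chart_inv_continuous cx.
near=> y; split; near: y.
  by apply: open_nbhs_nbhs; split=> //; exact: open_cod.
exact: (ci _ nA).
Unshelve. all: by end_near. Qed.

Lemma open_chart_preimage c (U : set 'rV[R]_n) :
  open U -> open (dom c `&` c @^-1` U).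
Proof.
move=> oU; rewrite openE => p [cp Up].
have nU : nbhs (c p) U by exact: open_nbhs_nbhs.
have cc := chart_fun_continuous cp.
near=> y; split; near: y.
  by apply: open_nbhs_nbhs; split=> //; exact: open_dom.
exact: (cc _ nU).
Unshelve. all: by end_near. Qed.

End Charts.

(* Tangent vectors at [p] satisfy [X_d = X_c *m jac c d p]. *)
HB.lock Definition jac (R : realType) (n : nat) (M : manifold R n)
    (c d : chart R n M) (p : M) : 'M[R]_n := jacobian (d \o chart_inv c) (c p).

Section ManifoldCharts.
Variables (R : realType) (n : nat) (M : manifold R n).
Implicit Types (c d e : chart R n M) (p : M).

Lemma open_overlap c d : open (c @` (dom c `&` dom d)).
Proof. exact/open_chart_image/open_dom. Qed.

Lemma differentiable_transition c d p : atlas M c -> atlas M d ->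
  dom c p -> dom d p -> differentiable (d \o chart_inv c) (c p).
Proof.
by move=> Mc Md cp dp; apply: smooth_differentiable (transition_smooth Mc Md) _;
  exists p.
Qed.

Lemma jac_comp c d e p : atlas M c -> atlas M d -> atlas M e ->
  dom c p -> dom d p -> dom e p -> jac c e p = jac c d p *m jac d e p.
Proof.
move=> Mc Md Me cp dp ep.
have E : (d \o chart_inv c) (c p) = d p by rewrite /= chart_funK.
have dcd := differentiable_transition Mc Md cp dp.
have dde := differentiable_transition Md Me dp ep; rewrite -E in dde.
have := jacobian_comp dcd dde; rewrite E jac.unlock => <-.
apply/esym/jacobian_near; first exact: differentiable_comp.
near=> x; have : (c @` (dom c `&` dom d)) x.
  near: x; apply: open_nbhs_nbhs; split; first exact: open_overlap.
  by exists p.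
by move=> [q [cq dq] <-]; rewrite /= chart_funK // chart_funK.
Unshelve. all: by end_near. Qed.

Lemma jac_refl c p : atlas M c -> dom c p -> jac c c p = 1%:M.
Proof.
move=> Mc cp; rewrite jac.unlock -(jacobian_id (c p)); apply: jacobian_near.
  exact: differentiable_transition.
near=> x; have : cod c x.
  near: x; apply: open_nbhs_nbhs; split; first exact: open_cod.
  by exists p.
by move=> [q cq <-]; rewrite /= chart_funK.
Unshelve. all: by end_near. Qed.

Lemma jacK c d p : atlas M c -> atlas M d -> dom c p -> dom d p ->
  jac c d p *m jac d c p = 1%:M.
Proof. by move=> Mc Md cp dp; rewrite -jac_comp // jac_refl. Qed.

Lemma smooth_jac c d : atlas M c -> atlas M d ->
  smooth_on (c @` (dom c `&` dom d)) (fun x => jac c d (chart_inv c x)).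
Proof.
move=> Mc Md; have := smooth_jacobian (@open_overlap c d) (transition_smooth Mc Md).
apply: smooth_ext => [|x]; first exact: open_overlap.
by move=> [p [cp dp] <-]; rewrite jac.unlock chart_funK.
Qed.

Lemma transition_overlap c d x :
  (c @` (dom c `&` dom d)) x -> (d @` (dom d `&` dom c)) (d (chart_inv c x)).
Proof.
by move=> [p [cp dp] <-]; exists p => //; rewrite chart_funK.
Qed.

Lemma smooth_jac_inv c d : atlas M c -> atlas M d ->
  smooth_on (c @` (dom c `&` dom d)) (fun x => jac d c (chart_inv c x)).
Proof.
move=> Mc Md.
have := smooth_comp_mx (@open_overlap c d) (@open_overlap d c)
  (fun x => @transition_overlap c d x) (transition_smooth Mc Md) (smooth_jac Md Mc).
apply: smooth_ext => [|x]; first exact: open_overlap.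
by move=> [p [cp dp] <-]; rewrite /= (chart_funK cp) chart_funK.
Qed.

Lemma coefsE (eta : covector_field M) c p : dom c p ->
  coefs eta c (c p) = jac c (chart_at p) p *m eta p.
Proof. by move=> cp; rewrite /coefs jac.unlock chart_funK. Qed.

Lemma coefs_change (eta : covector_field M) c d p :
  atlas M c -> atlas M d -> dom c p -> dom d p ->
  coefs eta c (c p) = jac c d p *m coefs eta d (d p).
Proof.
move=> Mc Md cp dp; rewrite !coefsE // mulmxA -jac_comp //.
- exact: chart_at_atlas.
- exact: chart_at_dom.
Qed.

Lemma antisym_coefs_change (eta : oneform M) c d p :
  atlas M c -> atlas M d -> dom c p -> dom d p ->
  antisym_derive (coefs eta c) (c p) =
  jac c d p *m antisym_derive (coefs eta d) (d p) *m (jac c d p)^T.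
Proof.
move=> Mc Md cp dp; rewrite jac.unlock (_ : d p = (d \o chart_inv c) (c p)); last first.
  by rewrite /= chart_funK.
apply: (@antisym_derive_pullback _ _ (c @` (dom c `&` dom d)) (cod d)).
- exact: open_overlap.
- exact: open_cod.
- by exists p.
- by move=> _ [q [cq dq] <-]; rewrite /= chart_funK //; exists q.
- exact: transition_smooth.
- exact: oneform_smooth.
- move=> _ [q [cq dq] <-]; have := coefs_change eta Mc Md cq dq.
  by rewrite jac.unlock /= chart_funK.
Qed.

(* The matrix in the chart [c] of the endomorphism [X |-> X *m s p] of T_pM. *)
Definition endo_in c (s : M -> 'M[R]_n) p :=
  jac c (chart_at p) p *m s p *m jac (chart_at p) c p.

Definition smooth_endo (A : set M) (s : M -> 'M[R]_n) := forall c, atlas M c ->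
  smooth_on (c @` (dom c `&` A)) (fun x => endo_in c s (chart_inv c x)).

Lemma endo_in_change c d s p : atlas M c -> atlas M d -> dom c p -> dom d p ->
  endo_in d s p = jac d c p *m endo_in c s p *m jac c d p.
Proof.
move=> Mc Md cp dp; rewrite /endo_in.
have [Mp pp] := (chart_at_atlas p, chart_at_dom p).
by rewrite (jac_comp Md Mc Mp) // (jac_comp Mp Mc Md) // !mulmxA.
Qed.

(** One chart covering [A] suffices, because a change of chart conjugates the matrix by Jacobians
    that are smooth. *)
Lemma smooth_endo_chart c (A : set M) s : atlas M c -> open A -> A `<=` dom c ->
  smooth_on (c @` A) (fun x => endo_in c s (chart_inv c x)) -> smooth_endo A s.
Proof.
move=> Mc oA Ac ss d Md.
have oAd : open (d @` (dom d `&` A)) by exact: open_chart_image.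
have sub : d @` (dom d `&` A) `<=` d @` (dom d `&` dom c).
  by move=> _ [p [dp Ap] <-]; exists p => //; split=> //; exact: Ac.
have oAc : open (c @` A).
  by have := open_chart_image (c := c) oA; rewrite setIC (setIidl Ac).
have s1 := smooth_sub sub (smooth_jac Md Mc).
have s2 := smooth_sub sub (smooth_jac_inv Md Mc).
have s3 : smooth_on (d @` (dom d `&` A))
    (fun x => endo_in c s (chart_inv c ((c \o chart_inv d) x))).
  apply: (smooth_comp_mx oAd oAc _ (smooth_sub sub (transition_smooth Md Mc)) ss).
  by move=> _ [p [dp Ap] <-]; exists p => //=; rewrite chart_funK.
apply: smooth_ext (smooth_mulmx oAd (smooth_mulmx oAd s1 s3) s2) => //.
move=> _ [p [dp Ap] <-] /=; have cp := Ac p Ap.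
by rewrite !chart_funK // [in RHS](@endo_in_change c d).
Qed.

End ManifoldCharts.

(** * The characteristic distribution *)

Section Distributions.
Variables (R : realType) (n : nat) (M : manifold R n) (k : nat).
Variable eta : 'I_k -> oneform M.
Implicit Types (c : chart R n M) (p : M).

(** The linear map eta from T_pM to R^k: its left kernel is D, and the left kernel of its transpose
    consists of the relations between the forms. *)
Definition forms_mx p : 'M[R]_(n, k) := \matrix_(i, j) eta j p i 0.

Lemma mul_forms_mx r (X : 'M[R]_(r, n)) p i j :
  (X *m forms_mx p) i j = (X *m eta j p) i 0.
Proof. by rewrite !mxE; apply: eq_bigr => l _; rewrite mxE. Qed.

Lemma sub_distrP r (X : 'M[R]_(r, n)) p :
  (X <= distr eta p)%MS <-> X *m forms_mx p = 0.
Proof.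
split=> [/sub_bigcapmxP XD|X0].
  apply/matrixP => i j; rewrite mul_forms_mx.
  by have /sub_kermxP-> := XD j isT; rewrite !mxE.
apply/sub_bigcapmxP => j _; apply/sub_kermxP/matrixP => i l.
by rewrite ord1 -mul_forms_mx X0 !mxE.
Qed.

Lemma sub_char_distrP r (X : 'M[R]_(r, n)) p :
  (X <= char_distr eta p)%MS <-> X *m forms_mx p = 0 /\
    forall j, X *m extd (eta j) p *m (distr eta p)^T = 0.
Proof.
rewrite /char_distr sub_capmx; split.
  case/andP => /sub_distrP XD /sub_bigcapmxP XE; split=> // j.
  have := XE j isT; rewrite sub_capmx => /andP[_ /sub_kermxP].
  by rewrite mulmxA.
case=> XD XE; apply/andP; split; first exact/sub_distrP.
apply/sub_bigcapmxP => j _; rewrite sub_capmx; apply/andP; split.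
  exact/sub_distrP.
by apply/sub_kermxP; rewrite mulmxA.
Qed.

Lemma rank_distr p : \rank (distr eta p) = (n - \rank (forms_mx p))%N.
Proof.
rewrite -mxrank_ker; apply: eqmx_rank; apply/andP; split.
  by apply/sub_kermxP/sub_distrP.
exact/sub_distrP/mulmx_ker.
Qed.

Definition coefs_mx c (x : 'rV[R]_n) : 'M[R]_(n, k) :=
  \matrix_(i, j) coefs (eta j) c x i 0.

Lemma coefs_mxE c p : dom c p ->
  coefs_mx c (c p) = jac c (chart_at p) p *m forms_mx p.
Proof.
move=> cp; apply/matrixP => i j.
by rewrite mul_forms_mx mxE coefsE.
Qed.

Lemma smooth_coefs_mx c : atlas M c -> smooth_on (cod c) (coefs_mx c).
Proof.
move=> Mc; apply/(smooth_mxP (@open_cod _ _ _ c)) => i j.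
have /(smooth_mxP (@open_cod _ _ _ c))/(_ i 0) := oneform_smooth (eta j) Mc.
by apply: smooth_ext => [|x _]; [exact: open_cod|rewrite [RHS]mxE].
Qed.

Definition extd_in c j x := antisym_derive (coefs (eta j) c) x.

Lemma extd_inE c j p : atlas M c -> dom c p ->
  extd_in c j (c p) =
  jac c (chart_at p) p *m extd (eta j) p *m (jac c (chart_at p) p)^T.
Proof.
move=> Mc cp; apply: (antisym_coefs_change _ Mc) => //.
  exact: chart_at_atlas.
exact: chart_at_dom.
Qed.

Lemma smooth_antisym_derive (U : set 'rV[R]_n) (a : 'rV[R]_n -> 'cV[R]_n) :
  open U -> smooth_on U a -> smooth_on U (antisym_derive a).
Proof.
move=> oU sa; apply/smooth_mxP => // i j.
have /(smooth_mxP oU)/(_ j 0) si := smooth_derive (delta_mx 0 i) sa.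
have /(smooth_mxP oU)/(_ i 0) sj := smooth_derive (delta_mx 0 j) sa.
apply: smooth_ext (smooth_add oU si (smooth_opp oU sj)) => // x _.
by rewrite mxE.
Qed.

Lemma smooth_extd_in c j : atlas M c -> smooth_on (cod c) (extd_in c j).
Proof.
move=> Mc; apply: smooth_antisym_derive; first exact: open_cod.
exact: oneform_smooth.
Qed.

Hypothesis pc : precontact eta.

Lemma rank_forms_mx p q : \rank (forms_mx p) = \rank (forms_mx q).
Proof.
case: pc => _ [d rd] _ _; have := rd p; have := rd q; rewrite !rank_distr => <-.
have := rank_leq_row (forms_mx p); have := rank_leq_row (forms_mx q).
by move=> *; lia.
Qed.

Lemma rank_char_distr p q :
  \rank (char_distr eta p) = \rank (char_distr eta q).
Proof. by case: pc => _ _ _ [v rv]; rewrite !rv. Qed.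

(** In the chart at [q], V is the left kernel of a smooth matrix [B] of rank n minus the rank of V.
    The equations of V involve all Y in D, and [distr] need not be smooth; D therefore enters [B]
    through a smooth projector [pD] onto it, obtained beforehand from the constant rank of D. *)
Lemma local_char_projector q : exists (A : set M) (s : M -> 'M[R]_n),
  [/\ open A, A q, smooth_endo A s & forall p, A p ->
    (s p <= char_distr eta p)%MS /\ char_distr eta p *m s p = char_distr eta p].
Proof.
pose c := chart_at q; have Mc : atlas M c := chart_at_atlas q.
have cq : dom c q := chart_at_dom q.
pose J p := jac c (chart_at p) p; pose J' p := jac (chart_at p) c p.
have JJ' p : dom c p -> J p *m J' p = 1%:M.
  by move=> cp; apply: jacK => //; [exact: chart_at_atlas|exact: chart_at_dom].
have J'J p : dom c p -> J' p *m J p = 1%:M.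
  by move=> cp; apply: jacK => //; [exact: chart_at_atlas|exact: chart_at_dom].
have uJ p : dom c p -> J p \in unitmx by move=> /JJ'/mulmx1_unit[].
have [U1 [pD [oU1 U1q U1c spD pDP]]] : exists U1 (pi : 'rV[R]_n -> 'M[R]_n),
    [/\ open U1, U1 (c q), U1 `<=` cod c, smooth_on U1 pi &
     forall x, U1 x -> pi x *m coefs_mx c x = 0 /\
       forall r (X : 'M[R]_(r, n)), X *m coefs_mx c x = 0 -> X *m pi x = X].
  apply: smooth_kernel_projector.
  - exact: open_cod.
  - exact: smooth_coefs_mx.
  - exact: cod_chart.
  move=> _ [p cp <-]; rewrite !coefs_mxE //.
  rewrite !eqmxMfull ?row_full_unit ?uJ //.
  exact: rank_forms_mx.
pose B x := row_mx (coefs_mx c x)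
  (juxtapose (fun j => extd_in c j x *m (pD x)^T)).
have BP x r (X : 'M[R]_(r, n)) : U1 x -> let p := chart_inv c x in
    X *m B x = 0 <-> (X *m J p <= char_distr eta p)%MS.
  move=> U1x p; have [p' cp' E] := U1c _ U1x.
  have Ep : p' = p by rewrite /p -E chart_funK.
  rewrite Ep in cp' E; rewrite -E in U1x *.
  have [pD0 pDX] := pDP _ U1x.
  rewrite mul_mx_row -[0]row_mx0; split.
    move=> /eq_row_mx[X0 /mul_juxtapose_eq0 XE]; apply/sub_char_distrP; split.
      by rewrite -mulmxA -coefs_mxE.
    move=> j; have := XE j.
    rewrite extd_inE // -/(J p) !mulmxA => {}XE.
    (* D, read in the chart [c], is fixed by [pD]; testing against the rows of [pD] thus tests
       against all of D. *)
    have : (distr eta p *m J' p) *m pD (c p) = distr eta p *m J' p.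
      apply: pDX; rewrite coefs_mxE // mulmxA -/(J p) -(mulmxA _ (J' p)) J'J //.
      by rewrite mulmx1; apply/sub_distrP.
    move=> /(congr1 (mulmxr (J p))) /=.
    rewrite -[in RHS]mulmxA J'J // mulmx1 => <-.
    by rewrite !trmx_mul !mulmxA XE !mul0mx.
  case/sub_char_distrP => X0 XE.
  have X0' : X *m coefs_mx c (c p) = 0 by rewrite coefs_mxE // mulmxA.
  rewrite X0'; congr row_mx; apply/mul_juxtapose_eq0 => j.
  rewrite extd_inE // -/(J p) !mulmxA -mulmxA -trmx_mul.
  have : (pD (c p) *m J p <= distr eta p)%MS.
    by apply/sub_distrP; rewrite -mulmxA -coefs_mxE.
  by move=> /submxP[Z ->]; rewrite trmx_mul mulmxA XE mul0mx.
have [U2 [pi [oU2 U2q U21 spi piP]]] : exists U2 (pi : 'rV[R]_n -> 'M[R]_n),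
    [/\ open U2, U2 (c q), U2 `<=` U1, smooth_on U2 pi &
     forall x, U2 x -> pi x *m B x = 0 /\
       forall r (X : 'M[R]_(r, n)), X *m B x = 0 -> X *m pi x = X].
  apply: smooth_kernel_projector => //.
    apply: smooth_row_mx => //; first exact: smooth_sub (smooth_coefs_mx Mc).
    apply: (smooth_juxtapose (B := fun j x => extd_in c j x *m (pD x)^T)) => // j.
    apply: smooth_mulmx => //; last exact: smooth_trmx.
    exact: smooth_sub (smooth_extd_in j Mc).
  have rB x : U1 x -> \rank (B x) = (n - \rank (char_distr eta (chart_inv c x)))%N.
    move=> U1x; set p := chart_inv c x.
    have cp : dom c p by apply/dom_chart_inv/U1c.
    have -> : \rank (char_distr eta p) = \rank (kermx (B x)).
      rewrite -[RHS](mxrankMfree _ (B := J p)); last by rewrite row_free_unit uJ.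
      apply: eqmx_rank; apply/andP; split; last exact/(BP _ _ _ U1x)/mulmx_ker.
      rewrite -[char_distr eta p]mulmx1 -(J'J p) // mulmxA submxMr //.
      apply/sub_kermxP/(BP _ _ _ U1x).
      by rewrite -/p -mulmxA J'J // mulmx1.
    by rewrite mxrank_ker subKn // rank_leq_row.
  by move=> x U1x; rewrite !rB //; congr (_ - _)%N; exact: rank_char_distr.
have U2c := subset_trans U21 U1c.
pose A := dom c `&` c @^-1` U2.
have oA : open A by exact: open_chart_preimage.
(* Back from the chart [c] to the preferred chart of each [p], in which [char_distr eta p] is
   written. *)
exists A, (fun p => J' p *m pi (c p) *m J p); split=> //.
  apply: (smooth_endo_chart Mc) => //; first by move=> p [].
  have -> : c @` A = U2.
    rewrite chart_imageE; apply/seteqP; split=> x /=.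
      by move=> [cx]; rewrite chart_invK.
    by move=> U2x; split; [exact: U2c|rewrite chart_invK //; exact: U2c].
  apply: smooth_ext oU2 _ spi => x /U2c [p cp <-].
  by rewrite chart_funK // /endo_in -/(J p) -/(J' p) !mulmxA JJ' // mul1mx -mulmxA
    JJ' // mulmx1.
move=> p [cp U2p]; have [piB piX] := piP _ U2p; split.
  have /(BP _ _ _ (U21 _ U2p)) := piB; rewrite chart_funK // -mulmxA.
  exact: submx_trans (submxMl _ _).
rewrite !mulmxA piX; first by rewrite -mulmxA J'J // mulmx1.
apply/(BP _ _ _ (U21 _ U2p)); rewrite chart_funK // -mulmxA J'J //.
by rewrite mulmx1.
Qed.

End Distributions.

(** * Bump functions *)

Section FlatFunctions.
Variable R : realType.
Implicit Types (P : {poly R}) (t u : R).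

(* Closed under derivation; [flat 1] is the function exp (-1/t) extended by 0. *)
Definition flat P t : R := if 0 < t then P.[t^-1] * expR (- t^-1) else 0.

Lemma flat1_gt0 t : (0 < flat 1 t) = (0 < t).
Proof.
by rewrite /flat; case: ifP => //; rewrite ?ltxx // hornerC mul1r expR_gt0.
Qed.

Lemma flat1_ge0 t : 0 <= flat 1 t.
Proof.
by rewrite /flat; case: ifP => // _; rewrite hornerC mul1r expR_ge0.
Qed.

Lemma flat1_eq0 t : t <= 0 -> flat 1 t = 0.
Proof. by move=> t0; rewrite /flat ltNge t0. Qed.

(** The decay rate 1/u is what the difference quotient at 0 requires. The constant combines |P.[u]|
    <= S u^m, where m is [size P], with the Taylor term u^(m+1) / (m+1)! <= exp u. *)
Lemma horner_expRN_le P : exists C, forall u, 1 <= u ->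
  `|P.[u] * expR (- u)| <= C / u.
Proof.
pose S := \sum_(i < size P) `|P`_i|; set m := size P.
exists (S * (m.+1)`!%:R) => u u1; have u0 : 0 < u by exact: lt_le_trans u1.
have PS : `|P.[u]| <= S * u ^+ m.
  rewrite horner_coef mulr_suml; apply: le_trans (ler_norm_sum _ _ _) _.
  apply: ler_sum => i _; rewrite normrM; apply: ler_wpM2l => //.
  rewrite normrX (ger0_norm (ltW u0)); apply: ler_weXn2l => //.
  exact/ltnW/ltn_ord.
have eu : u ^+ m.+1 / (m.+1)`!%:R <= expR u.
  by apply: le_trans (expR_ge1Dxn m (ltW u0)); rewrite lerDr.
have f0 : 0 < (m.+1)`!%:R :> R by rewrite ltr0n fact_gt0.
have S0 : 0 <= S by exact: sumr_ge0.
rewrite normrM [`|expR _|]ger0_norm ?expR_ge0 // expRN.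
have -> : S * (m.+1)`!%:R / u = S * u ^+ m * (u ^+ m.+1 / (m.+1)`!%:R)^-1.
  by rewrite exprS; field; rewrite !gt_eqF // exprn_gt0.
apply: ler_pM => //.
by rewrite lef_pV2 // posrE ?expR_gt0 // divr_gt0 // exprn_gt0.
Qed.

(** With u = 1/t one has du/dt = - u^2, whence the factor ['X^2], and P (u) exp (-u) has derivative
    (P' - P) (u) exp (-u) in u. *)
Lemma is_derive_flat P t : is_derive t 1 (flat P) (flat ('X^2 * (P - P^`())) t).
Proof.
have [t0|t0|->] := ltgtP t 0.
- have E : flat ('X^2 * (P - P^`())) t = 0 by rewrite /flat ltNge ltW.
  rewrite E; apply: (@near_eq_is_derive _ _ _ (cst (0 : R))).
  near=> s; rewrite /flat ifF //; apply/negbTE; rewrite -leNgt ltW //.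
  by near: s; exact: lt_nbhsl.
- pose g u := P.[u] * expR (- u).
  have dg u : is_derive u 1 g ((P^`() - P).[u] * expR (- u)).
    have H1 : is_derive u 1 (expR \o -%R) (expR (- u) * (-1)).
      exact: is_derive1_comp.
    apply: is_derive_eq.
    by rewrite /GRing.scale /= hornerD hornerN; ring.
  have di : is_derive t 1 (fun s => s^-1) (- t^-2).
    apply: DeriveDef; first by apply: derivableV; rewrite ?gt_eqF.
    rewrite deriveV ?gt_eqF // derive_id /GRing.scale /=; ring.
  apply: (@near_eq_is_derive _ _ _ (g \o (fun s => s^-1))).
    near=> s; rewrite /flat ifT //; near: s; exact: lt_nbhsr.
  have := is_derive1_comp (dg t^-1) di.
  move=> H; apply: is_derive_eq; rewrite /flat t0 !hornerE /=.
  by rewrite exprVn; ring.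
have E : flat ('X^2 * (P - P^`())) 0 = 0 by rewrite /flat ltxx.
(* For h > 0 the difference quotient of [flat P] at 0 is u P (u) exp (-u) with u = 1/h, hence the
   polynomial ['X * P] and a bound by C h. *)
have [C CP] := horner_expRN_le ('X * P).
have lim0 : (fun h => h^-1 *: ((flat P \o shift 0) (h *: 1) - flat P 0)) @ 0^'
    --> (0 : R).
  apply/cvgrPdist_le => e e0.
  have C0 : 0 < `|C| + 1 by rewrite ltr_pwDr.
  near=> h; rewrite sub0r normrN.
  have -> : flat P 0 = 0 by rewrite /flat ltxx.
  rewrite /= subr0 addr0 /flat [h *: 1]mulr1; case: ifP => h0; last first.
    by rewrite scaler0 normr0 ltW.
  have h1 : 1 <= h^-1.
    rewrite invf_ge1 //; apply: ltW; rewrite -[h]ger0_norm ?ltW //.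
    by near: h; exact: dnbhs0_lt.
  have := CP _ h1; rewrite hornerM hornerX invrK => {}CP.
  rewrite /GRing.scale /= mulrA; apply: le_trans CP _.
  apply: (@le_trans _ _ ((`|C| + 1) * h)).
    apply: ler_wpM2r; first exact: ltW.
    by rewrite (le_trans (ler_norm C)) // lerDl.
  rewrite mulrC -ler_pdivlMr //; apply: ltW; rewrite -[h]ger0_norm ?ltW //.
  by near: h; apply: dnbhs0_lt; rewrite divr_gt0.
rewrite E; apply: DeriveDef; first by apply/cvg_ex; exists 0.
exact: cvg_lim lim0.
Unshelve. all: by end_near. Qed.

Lemma smooth_flat_comp n (U : set 'rV[R]_n) (g : 'rV[R]_n -> R) P : open U ->
  smooth_on U g -> smooth_on U (fun x => flat P (g x)).
Proof.
move=> oU sg k.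
apply: (@Ck_family _ _ [set h | exists P, h = flat P] _ _ _ (flat P)) => //.
  move=> _ [Q ->]; split=> [t|]; first by have [] := is_derive_flat Q t.
  exists ('X^2 * (Q - Q^`())); apply/funext => t.
  by rewrite derive1E; have [_ ->] := is_derive_flat Q t.
by exists P.
Qed.

End FlatFunctions.

Section SmoothFunctions.
Variables (R : realType) (n : nat) (M : manifold R n).
Implicit Types (c d : chart R n M) (p : M) (b g : M -> R).

Definition smooth_fun g := forall c, atlas M c ->
  smooth_on (cod c) (fun x => g (chart_inv c x)).

Lemma smooth_fun_cst (a : R) : smooth_fun (fun=> a).
Proof. by move=> c Mc; exact: smooth_cst. Qed.

Lemma smooth_funM b g :
  smooth_fun b -> smooth_fun g -> smooth_fun (fun p => b p * g p).
Proof.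
by move=> sb sg c Mc; apply: smooth_mul; [exact: open_cod|exact: sb|exact: sg].
Qed.

Lemma smooth_funD b g :
  smooth_fun b -> smooth_fun g -> smooth_fun (fun p => b p + g p).
Proof.
by move=> sb sg c Mc; apply: smooth_add; [exact: open_cod|exact: sb|exact: sg].
Qed.

Lemma smooth_fun_flat P g : smooth_fun g -> smooth_fun (fun p => flat P (g p)).
Proof.
move=> sg c Mc.
exact: (smooth_flat_comp P (@open_cod _ _ _ c) (sg c Mc)).
Qed.

Lemma smooth_funV g : (forall p, g p != 0) ->
  smooth_fun g -> smooth_fun (fun p => (g p)^-1).
Proof. by move=> g0 sg c Mc; apply: smooth_inv; [exact: open_cod| |exact: sg]. Qed.

Lemma smooth_fun_prod (I : Type) (r : seq I) (F : I -> M -> R) :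
  (forall i, smooth_fun (F i)) -> smooth_fun (fun p => \prod_(i <- r) F i p).
Proof.
by move=> sF c Mc; apply: smooth_prod => [|i _]; [exact: open_cod|exact: sF].
Qed.

Lemma smooth_fun_sum (I : Type) (r : seq I) (F : I -> M -> R) :
  (forall i, smooth_fun (F i)) -> smooth_fun (fun p => \sum_(i <- r) F i p).
Proof.
by move=> sF c Mc; apply: smooth_sum => [|i _]; [exact: open_cod|exact: sF].
Qed.

Lemma smooth_fun_continuous g : smooth_fun g -> continuous g.
Proof.
move=> sg p; pose c := chart_at p.
have cp : dom c p := chart_at_dom p.
have gE : \forall q \near p, g (chart_inv c (c q)) = g q.
  near=> q; rewrite chart_funK //; near: q; apply: open_nbhs_nbhs.
  by split; [exact: open_dom|exact: cp].
have cg : {for p, continuous (fun q => g (chart_inv c (c q)))}.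
  apply: (@continuous_comp _ _ _ c (fun x => g (chart_inv c x))).
    exact: chart_fun_continuous.
  apply: smooth_continuous (sg c (chart_at_atlas p)) _; exact: cod_chart.
move: cg; rewrite /prop_for /continuous_at (nbhs_singleton gE).
exact: cvg_trans (near_eq_cvg gE).
Unshelve. all: by end_near. Qed.

Lemma smooth_fun_local g : (forall p, exists A h,
    [/\ open A, A p, smooth_fun h & forall q, A q -> g q = h q]) ->
  smooth_fun g.
Proof.
move=> loc c Mc; apply: smooth_local => _ [p cp <-].
have [A [h [oA Ap sh gh]]] := loc p.
have sub : c @` (dom c `&` A) `<=` cod c by move=> _ [q [cq _] <-]; exists q.
exists (c @` (dom c `&` A)); first by exists p.
apply: smooth_ext (smooth_sub sub (sh c Mc)); first exact: open_chart_image.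
by move=> _ [q [cq Aq] <-]; rewrite chart_funK // gh.
Qed.

Implicit Types s t : M -> 'M[R]_n.
Local Notation smooth_endoT := (smooth_endo setT).

Lemma smooth_endo_local s : (forall p, exists A t,
    [/\ open A, A p, smooth_endo A t & forall q, A q -> s q = t q]) ->
  smooth_endoT s.
Proof.
move=> loc c Mc; apply: smooth_local => _ [p [cp _] <-].
have [A [t [oA Ap st sE]]] := loc p.
exists (c @` (dom c `&` A)); first by exists p.
apply: smooth_ext (st c Mc); first exact: open_chart_image.
by move=> _ [q [cq Aq] <-]; rewrite chart_funK // /endo_in sE.
Qed.

Lemma smooth_endo_sub (A B : set M) s :
  A `<=` B -> smooth_endo B s -> smooth_endo A s.
Proof.
move=> AB sB c Mc; apply: smooth_sub (sB c Mc).
by move=> _ [q [cq Aq] <-]; exists q => //; split=> //; exact: AB.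
Qed.

Lemma smooth_endo0 (A : set M) : open A -> smooth_endo A (fun=> 0).
Proof.
move=> oA c Mc; apply: smooth_ext (@smooth_cst _ _ _ _ 0).
  exact: open_chart_image.
by move=> x _; rewrite /endo_in mulmx0 mul0mx.
Qed.

Lemma smooth_endoD (A : set M) s t : open A ->
  smooth_endo A s -> smooth_endo A t -> smooth_endo A (fun p => s p + t p).
Proof.
move=> oA ss st c Mc; have oc : open (c @` (dom c `&` A)).
  exact: open_chart_image.
apply: smooth_ext oc _ (smooth_addmx oc (ss c Mc) (st c Mc)) => x _.
by rewrite /endo_in mulmxDr mulmxDl.
Qed.

Lemma smooth_endoZ (A : set M) g s : open A ->
  smooth_fun g -> smooth_endo A s -> smooth_endo A (fun p => g p *: s p).
Proof.
move=> oA sg ss c Mc; have oc : open (c @` (dom c `&` A)).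
  exact: open_chart_image.
have sub : c @` (dom c `&` A) `<=` cod c by move=> _ [q [cq _] <-]; exists q.
apply: smooth_ext oc _ (smooth_scalemx oc (smooth_sub sub (sg c Mc)) (ss c Mc)).
by move=> x _; rewrite /endo_in -scalemxAr -scalemxAl.
Qed.

Lemma smooth_endo_sum (A : set M) (I : Type) (r : seq I) (F : I -> M -> 'M[R]_n) :
  open A -> (forall i, smooth_endo A (F i)) ->
  smooth_endo A (fun p => \sum_(i <- r) F i p).
Proof.
move=> oA sF; elim: r => [|i r IH].
  rewrite (_ : (fun p => _) = fun=> 0); first exact: smooth_endo0.
  by apply/funext => p; rewrite big_nil.
rewrite (_ : (fun p => _) = fun p => F i p + \sum_(j <- r) F j p).
  exact: smooth_endoD.
by apply/funext => p; rewrite big_cons.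
Qed.

(** [K] is the image of a compact Euclidean ball, hence closed because M is Hausdorff. This makes
    the extension by 0 beyond the chart domain smooth. *)
Lemma bump_fun (A : set M) q : open A -> A q -> exists b K,
  [/\ smooth_fun b, closed K, K `<=` A, forall p, 0 <= b p & 0 < b q /\
   forall p, ~ K p -> b p = 0].
Proof.
move=> oA Aq; pose c := chart_at q.
have cq : dom c q := chart_at_dom q; have Mc : atlas M c := chart_at_atlas q.
have oV : open (c @` (dom c `&` A)) by exact: open_chart_image.
have /nbhs_ballP[e /= e0 eV] : nbhs (c q) (c @` (dom c `&` A)).
  by apply: open_nbhs_nbhs; split=> //; exists q.
(* The norm on row vectors is the sup norm, which is not smooth; the sum of squares is, and it
   dominates the square of the norm. *)
pose rho (x : 'rV[R]_n) := \sum_i (x 0 i - c q 0 i) ^+ 2.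
pose e2 := e / 2; have e20 : 0 < e2 by rewrite divr_gt0.
have rhoV x : rho x <= e2 ^+ 2 -> (c @` (dom c `&` A)) x /\ `|x - c q| <= e2.
  move=> rx; have xe : `|x - c q| <= e2.
    rewrite [leLHS]/Num.norm /= mx_normrE; apply: bigmax_le; first exact: ltW.
    move=> [i j] _; rewrite ord1 !mxE /= -(@ler_pXn2r _ 2) ?nnegrE ?(ltW e20) //.
    rewrite real_normK ?num_real //; apply: le_trans rx.
    rewrite /rho (bigD1 j) //= lerDl.
    by apply: sumr_ge0 => l _; exact: sqr_ge0.
  split=> //; apply: eV; rewrite -ball_normE /= distrC (le_lt_trans xe) //.
  by rewrite /e2 ltr_pdivrMr // ltr_pMr // ltr1n.
have srho U : open U -> smooth_on U rho.
  move=> oU; apply: smooth_sum => // i _.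
  have sd : smooth_on U (fun x => x 0 i + - c q 0 i).
    by apply: smooth_add => //; [exact: smooth_coord|exact: smooth_cst].
  by apply: smooth_ext (smooth_mul oU sd sd) => // x _; rewrite -expr2.
pose B := [set x | rho x <= e2 ^+ 2].
have cB : compact B.
  apply: bounded_closed_compact.
    exists (`|c q| + e2); split; first exact: num_real.
    move=> r er x /rhoV[_ xe]; apply: le_trans (ltW er).
    by rewrite -[x](subrK (c q)) addrC (le_trans (ler_normD _ _)) // lerD2l.
  apply: (@closed_comp _ _ rho [set t | t <= e2 ^+ 2]); last exact: closed_le.
  by move=> x _; apply: (smooth_continuous (srho setT openT)).
pose K := chart_inv c @` B.
have cK : closed K.
  apply: compact_closed; first exact: manifold_hausdorff.
  apply: continuous_compact cB; apply: continuous_in_subspaceT => x.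
  rewrite inE => /rhoV[[p [cp _] <-] _].
  by apply: chart_inv_continuous; exists p.
have KA : K `<=` A by move=> _ [x /rhoV[[p [cp Ap] <-] _] <-]; rewrite chart_funK.
pose b p := if `[< dom c p >] then flat 1 (e2 ^+ 2 - rho (c p)) else 0.
have bK p : ~ K p -> b p = 0.
  move=> nKp; rewrite /b; case: asboolP => // cp; apply: flat1_eq0.
  rewrite subr_le0 leNgt; apply/negP => lt; apply: nKp.
  by exists (c p); rewrite ?chart_funK // /B /= ltW.
exists b, K; split=> //.
- move=> d Md; apply: smooth_local => _ [p dp <-].
  have [cp|ncp] := pselect (dom c p).
    exists (d @` (dom d `&` dom c)); first by exists p.
    have oO := @open_overlap _ _ _ d c.
    have s1 : smooth_on (d @` (dom d `&` dom c))
        (fun x => rho ((c \o chart_inv d) x)).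
      apply: (@smooth_comp _ _ _ _ setT) => //; first exact: transition_smooth.
      exact: srho openT.
    have s2 : smooth_on (d @` (dom d `&` dom c))
        (fun x => e2 ^+ 2 + - rho ((c \o chart_inv d) x)).
      by apply: smooth_add => //; [exact: smooth_cst|exact: smooth_opp].
    apply: smooth_ext (smooth_flat_comp 1 oO s2) => //.
    move=> _ [r [dr cr] <-]; rewrite /b /= chart_funK //.
    by case: asboolP.
  (* [K] lies in the domain of [c], so a point outside that domain has a neighbourhood in the
     complement of [K], where [b] vanishes. *)
  have nKp : ~ K p by move=> [x /rhoV[[r [cr _] <-] _] E]; apply: ncp;
    rewrite -E chart_funK.
  have oKC : open (~` K) by exact: closed_openC.
  exists (d @` (dom d `&` ~` K)); first by exists p.
  apply: smooth_ext (@smooth_cst _ _ _ _ 0); first exact: open_chart_image.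
  by move=> _ [r [dr nKr] <-]; rewrite chart_funK // bK.
- by move=> p; rewrite /b; case: ifP => // _; exact: flat1_ge0.
split=> //; rewrite /b; case: asboolP => // _; rewrite flat1_gt0 /rho big1 ?subr0.
  by rewrite exprn_gt0.
by move=> i _; rewrite subrr expr0n.
Qed.

End SmoothFunctions.

(** * A global projector onto the characteristic distribution *)

Section GlobalProjector.
Variables (R : realType) (n : nat) (M : manifold R n) (k : nat).
Variable eta : 'I_k -> oneform M.
Hypothesis pc : precontact eta.
Local Notation V := (char_distr eta).

(* A projector onto [V], multiplied by the weight [b]; unlike projectors, such
   pairs are stable under sums. *)
Definition weighted_projector (b : M -> R) (s : M -> 'M[R]_n) :=
  [/\ smooth_fun b, forall p, 0 <= b p, smooth_endo setT s &
    forall p, (s p <= V p)%MS /\ V p *m s p = b p *: V p].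

Lemma weighted_projector0 : weighted_projector (fun=> 0) (fun=> 0).
Proof.
split=> //; first exact: smooth_fun_cst.
  exact/smooth_endo0/openT.
by move=> p; rewrite sub0mx mulmx0 scale0r.
Qed.

Lemma weighted_projectorZ g b s : smooth_fun g -> (forall p, 0 <= g p) ->
  weighted_projector b s ->
  weighted_projector (fun p => g p * b p) (fun p => g p *: s p).
Proof.
move=> sg g0 [sb b0 ss sV]; split.
- exact: smooth_funM.
- by move=> p; exact: mulr_ge0.
- by apply: smooth_endoZ => //; exact: openT.
move=> p; have [s1 s2] := sV p; split; first exact: scalemx_sub.
by rewrite -scalemxAr s2 scalerA.
Qed.

Lemma local_weighted_projector q :
  exists b s, weighted_projector b s /\ 0 < b q.
Proof.
have [A [s [oA Aq ss sV]]] := local_char_projector pc q.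
have [b [K [sb cK KA b0 [bq bK]]]] := bump_fun oA Aq.
exists b, (fun p => b p *: s p); split=> //; split=> //.
  (* [A] and the complement of [K] form an open cover of M; the values of [s] outside [A] are
     multiplied by 0. *)
  apply: smooth_endo_local => p.
  have [Ap|nAp] := pselect (A p).
    by exists A, (fun p => b p *: s p); split=> //; exact: smooth_endoZ.
  exists (~` K), (fun=> 0); split=> //.
  - exact: closed_openC.
  - by move=> /KA.
  - exact/smooth_endo0/closed_openC.
  - by move=> r /bK ->; rewrite scale0r.
move=> p; have [Ap|nAp] := pselect (A p).
  have [s1 s2] := sV p Ap; split; first exact: scalemx_sub.
  by rewrite -scalemxAr s2.
by rewrite bK ?scale0r ?sub0mx ?mulmx0 // => /KA.
Qed.

(** A Lindelöf argument. Each basic open set on which some weight is positive everywhere receives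
    one such weight, placed at its index under an injection of the basis into the integers. *)
Lemma countable_weighted_projectors :
  exists (b : nat -> M -> R) (s : nat -> M -> 'M[R]_n),
    (forall i, weighted_projector (b i) (s i)) /\
    forall p, exists i, 0 < b i p.
Proof.
have [B /countable_injP[f finj] [_ Bbase]] := manifold_second_countable M.
pose good (W : set M) := exists b s,
  weighted_projector b s /\ forall p, W p -> 0 < b p.
have : forall i, exists bs : (M -> R) * (M -> 'M[R]_n),
    weighted_projector bs.1 bs.2 /\
    forall W, B W -> f W = i -> good W -> forall p, W p -> 0 < bs.1 p.
  move=> i; have [[W [BW fW [b [s [bsW Wb]]]]]|no] :=
      pselect (exists W, [/\ B W, f W = i & good W]).
    exists (b, s); split=> // W' BW' fW' _.
    by have -> // : W' = W by apply: finj; rewrite ?inE // fW'.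
  (* Indices that correspond to no such basic set receive the zero pair, which is harmless in a
     sum. *)
  exists (fun=> 0, fun=> 0); split; first exact: weighted_projector0.
  by move=> W BW fW gW; case: no; exists W.
move=> /choice[bs bsP]; exists (fun i => (bs i).1), (fun i => (bs i).2).
split=> [i|p]; first by have [] := bsP i.
have [b [s [bsp bp]]] := local_weighted_projector p.
have cb : {for p, continuous b} by case: bsp => /smooth_fun_continuous/(_ p).
have nb : nbhs p [set q | 0 < b q].
  have n0 : nbhs (b p) [set t | 0 < t].
    by apply: open_nbhs_nbhs; split=> //; exact: open_gt.
  exact: (cb _ n0).
have [W [BW Wp] Wb] := Bbase p _ nb.
exists (f W); have [_ H] := bsP (f W).
by apply: (H W) => //; exists b, s.
Qed.

(* The weights are multiplied by cut-off factors which make them locally finite: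
   near a point where [b j > 0], the [i]-th factor vanishes as soon as
   [1 / (i + 1)] is small with respect to [b j]. *)
Lemma locally_finite_weighted_projectors :
  exists (b : nat -> M -> R) (s : nat -> M -> 'M[R]_n),
    [/\ forall i, weighted_projector (b i) (s i),
      forall p, exists i, 0 < b i p &
      forall p, exists A N, [/\ open A, A p &
        forall i q, (N <= i)%N -> A q -> b i q = 0 /\ s i q = 0]].
Proof.
have [b [s [bs bpos]]] := countable_weighted_projectors.
have sb i : smooth_fun (b i) by have [] := bs i.
have b0 i p : 0 <= b i p by have [_ + _ _] := bs i; exact.
pose h i p := \prod_(j < i) flat 1 (i.+1%:R^-1 + -1 * b j p).
have sh i : smooth_fun (h i).
  apply: smooth_fun_prod => j; apply: smooth_fun_flat.
  apply: smooth_funD; first exact: smooth_fun_cst.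
  by apply: smooth_funM => //; exact: smooth_fun_cst.
have h0 i p : 0 <= h i p by apply: prodr_ge0 => j _; exact: flat1_ge0.
exists (fun i p => h i p * b i p), (fun i p => h i p *: s i p); split.
- by move=> i; apply: weighted_projectorZ.
(* At the least [i] with [0 < b i p] the earlier weights vanish at [p], so each cut-off factor
   equals [flat 1 i.+1%:R^-1], which is positive. *)
- move=> p; have ex : exists i, 0 < b i p by exact: bpos.
  case: (ex_minnP ex) => i bi mini; exists i.
  rewrite mulr_gt0 //; apply: prodr_gt0 => j _; rewrite flat1_gt0.
  have -> : b j p = 0.
    apply/eqP; rewrite eq_le b0 andbT leNgt; apply/negP => /mini.
    by rewrite leqNgt ltn_ord.
  by rewrite mulr0 addr0 invr_gt0 ltr0n.
move=> p; have [j bj] := bpos p.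
pose e := b j p / 2; have e0 : 0 < e by rewrite divr_gt0.
have [N /ltW Ne] : exists N : nat, e^-1 < N%:R.
  by exists (Num.bound e^-1); apply: Num.Theory.archi_boundP; rewrite invr_ge0 ltW.
exists [set q | e < b j q], (maxn j.+1 N); split.
- apply: (@open_comp _ _ (b j) [set t | e < t]); last exact: open_gt.
  by move=> q _; exact: (smooth_fun_continuous (sb j)).
- by rewrite /= /e ltr_pdivrMr // ltr_pMr // ltr1n.
move=> i q; rewrite geq_max => /andP[ji Ni] /= eb.
have -> : h i q = 0; last by rewrite mul0r scale0r.
rewrite /h (bigD1 (Ordinal ji)) //= flat1_eq0 ?mul0r //.
rewrite mulN1r subr_le0; apply: le_trans (ltW eb).
rewrite -[leRHS]invrK lef_pV2 ?posrE ?invr_gt0 ?ltr0n //.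
by apply: le_trans Ne _; rewrite ler_nat (leq_trans Ni).
Qed.

Lemma global_char_projector : exists P : M -> 'M[R]_n, smooth_endo setT P /\
  forall p, (P p <= V p)%MS /\ V p *m P p = V p.
Proof.
have [b [s [bs bpos fin]]] := locally_finite_weighted_projectors.
have [A AP] := choice fin; have [N NP] := choice AP.
pose S p := \sum_(i < N p) b i p; pose T p := \sum_(i < N p) s i p.
have b0 i p : 0 <= b i p by have [_ + _ _] := bs i; exact.
(* The bound [N q] may jump with [q]. On [A p] the terms from [N p] on vanish, so there the sum can
   be taken up to the fixed bound [N p], and smoothness can be read off. *)
have near_sum (W : nmodType) (F : nat -> M -> W) p q : A p q ->
    (forall i r q, (N r <= i)%N -> A r q -> F i q = 0) ->
    \sum_(i < N q) F i q = \sum_(i < N p) F i q.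
  move=> Apq F0; pose m := maxn (N q) (N p).
  have ext l r : (l <= m)%N -> (forall i, (l <= i)%N -> F i r = 0) ->
      \sum_(i < l) F i r = \sum_(i < m) F i r.
    move=> lm F0r; rewrite (big_ord_widen _ (fun i => F i r) lm).
    rewrite [RHS](bigID (fun i : 'I_m => (i < l)%N)) /= [X in _ = _ + X]big1 ?addr0 //.
    by move=> i; rewrite -leqNgt; exact: F0r.
  rewrite !ext ?leq_maxl ?leq_maxr //.
    by move=> i Ni; apply: (F0 i p).
  by move=> i Ni; apply: (F0 i q) => //; have [] := NP q.
have S0 p : 0 < S p.
  have [i bi] := bpos p.
  have iN : (i < N p)%N.
    rewrite ltnNge; apply/negP => Ni; have [_ Ap H] := NP p.
    by have [b0i _] := H i p Ni Ap; rewrite b0i ltxx in bi.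
  rewrite /S (bigD1 (Ordinal iN)) //= ltr_pwDl //.
  by apply: sumr_ge0 => j _; exact: b0.
have sS : smooth_fun S.
  apply: smooth_fun_local => p; have [oA Ap _] := NP p.
  exists (A p), (fun q => \sum_(i < N p) b i q); split=> //.
    by apply: smooth_fun_sum => i; have [] := bs i.
  move=> q Apq; apply: near_sum Apq _ => i r r' Ni Ar.
  by have [_ _ H] := NP r; case: (H i r' Ni Ar).
have sT : smooth_endo setT T.
  apply: smooth_endo_local => p; have [oA Ap _] := NP p.
  exists (A p), (fun q => \sum_(i < N p) s i q); split=> //.
    apply: smooth_endo_sum => // i; apply: (@smooth_endo_sub _ _ _ _ setT) => //.
    by have [] := bs i.
  move=> q Apq; apply: near_sum Apq _ => i r r' Ni Ar.
  by have [_ _ H] := NP r; case: (H i r' Ni Ar).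
(* On V the sum [T] is multiplication by the total weight [S]; dividing by [S] leaves the identity
   on V. *)
exists (fun p => (S p)^-1 *: T p); split.
  apply: smooth_endoZ => //; first exact: openT.
  by apply: smooth_funV => // p; rewrite gt_eqF.
move=> p; split.
  apply: scalemx_sub; apply: summx_sub => i _.
  by have [_ _ _ /(_ p)[]] := bs i.
rewrite -scalemxAr mulmx_sumr.
have -> : \sum_(i < N p) V p *m s i p = S p *: V p.
  by rewrite scaler_suml; apply: eq_bigr => i _; have [_ _ _ /(_ p)[]] := bs i.
by rewrite scalerA mulVf ?scale1r // gt_eqF.
Qed.

End GlobalProjector.

(** * Gluing charts *)

(* The charts of a manifold to be glued, given without a topology. *)
Record gluing (R : realType) (m : nat) := Gluing {
  glue_pt : Type;
  glue_idx : Type;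
  glue_dom : glue_idx -> set glue_pt;
  glue_map : glue_idx -> glue_pt -> 'rV[R]_m;
  glue_inv : glue_idx -> 'rV[R]_m -> glue_pt;
  glue_at : glue_pt -> glue_idx;
  glue_at_dom : forall e, glue_dom (glue_at e) e;
  glue_mapK : forall i e, glue_dom i e -> glue_inv i (glue_map i e) = e;
  open_glue_overlap : forall i j, open (glue_map i @` (glue_dom i `&` glue_dom j));
  smooth_glue_trans : forall i j,
    smooth_on (glue_map i @` (glue_dom i `&` glue_dom j))
      (glue_map j \o glue_inv i)
}.

(** A separate name for the type of points, on which the topology determined by [G] can be
    declared. *)
Definition glued (R : realType) (m : nat) (G : gluing R m) : Type := glue_pt G.

Section GluedTopology.
Variables (R : realType) (m : nat) (G : gluing R m).
Local Notation T := (glued G).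
Local Notation D := (@glue_dom R m G).
Local Notation phi := (@glue_map R m G).
Local Notation psi := (@glue_inv R m G).

HB.instance Definition _ := gen_eqMixin T.
HB.instance Definition _ := gen_choiceMixin T.

Definition glued_open (W : set T) := forall i, open (phi i @` (D i `&` W)).

Lemma glue_imageE i (W : set T) :
  phi i @` (D i `&` W) = [set x | (phi i @` D i) x /\ W (psi i x)].
Proof.
apply/seteqP; split=> [_ [p [cp Ap] <-]|x [[p cp <-]]] /=.
  by rewrite glue_mapK //; split=> //; exists p.
by rewrite glue_mapK // => Wp; exists p.
Qed.

Lemma open_glue_cod i : open (phi i @` D i).
Proof. by have := @open_glue_overlap _ _ G i i; rewrite setIid. Qed.

Lemma glued_openT : glued_open setT.
Proof. by move=> i; rewrite setIT; exact: open_glue_cod. Qed.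

Lemma glued_openI : setI_closed glued_open.
Proof.
move=> A B oA oB i; rewrite (_ : _ @` _ = phi i @` (D i `&` A) `&`
  phi i @` (D i `&` B)); first exact: openI.
by rewrite !glue_imageE; apply/seteqP; split=> x /=; tauto.
Qed.

Lemma glued_open_bigU (I : Type) (f : I -> set T) :
  (forall i, glued_open (f i)) -> glued_open (\bigcup_i f i).
Proof.
move=> of_ i; rewrite (_ : _ @` _ = \bigcup_j phi i @` (D i `&` f j)).
  by apply: bigcup_open => j _; exact: of_.
rewrite glue_imageE; apply/seteqP; split=> [x [cx [j _ fj]]|x [j _]].
  by exists j => //; rewrite glue_imageE.
by rewrite glue_imageE => -[cx fj]; split=> //; exists j.
Qed.

HB.instance Definition _ := isOpenTopological.Build T
  glued_openT glued_openI glued_open_bigU.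

Lemma glued_open_dom i : open (D i : set T).
Proof.
rewrite -[open _]/(glued_open _) => j; exact: open_glue_overlap.
Qed.

Lemma glued_open_preimage i (B : set 'rV[R]_m) :
  open B -> open ((D i `&` phi i @^-1` B) : set T).
Proof.
move=> oB; rewrite -[open _]/(glued_open _) => j.
rewrite (_ : _ @` _ = phi j @` (D j `&` D i) `&` (phi i \o psi j) @^-1` B);
  last first.
  by rewrite !glue_imageE; apply/seteqP; split=> x /=; tauto.
rewrite openE => x [ox Bx].
have nB : nbhs ((phi i \o psi j) x) B by exact: open_nbhs_nbhs.
have ct := smooth_continuous (@smooth_glue_trans R m G j i) ox.
near=> y; split; near: y; last exact: (ct _ nB).
by apply: open_nbhs_nbhs; split=> //; exact: open_glue_overlap.
Unshelve. all: by end_near. Qed.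

Lemma glue_map_continuous i (e : T) : D i e ->
  {for e, continuous (phi i : T -> 'rV[R]_m)}.
Proof.
move=> De A; rewrite nbhsE => -[B [oB Be] BA].
suff : nbhs e (D i `&` phi i @^-1` B).
  by apply: filterS => f [_ /BA].
by apply: open_nbhs_nbhs; split=> //; exact: glued_open_preimage.
Qed.

Lemma glue_inv_continuous i x : (phi i @` D i) x ->
  {for x, continuous (psi i : 'rV[R]_m -> T)}.
Proof.
move=> cx A; rewrite nbhsE => -[W [oW We] WA].
suff : nbhs x (phi i @` (D i `&` W)).
  by apply: filterS; rewrite glue_imageE => y [_ /WA].
apply: open_nbhs_nbhs; split; first exact: (oW : glued_open W).
by rewrite glue_imageE.
Qed.

Definition glued_chart i : chart R m T :=
  @Chart R m T (D i) (phi i) (psi i) (@glued_open_dom i) (@open_glue_cod i)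
    (@glue_mapK R m G i) (@glue_map_continuous i) (@glue_inv_continuous i).

(** Within one chart, disjoint open sets of R^m are pulled back. The second alternative is meant for
    points of a bundle over distinct base points, which are separated in the base. *)
Lemma glued_hausdorff :
  (forall e f : T, e <> f -> (exists i, D i e /\ D i f) \/
    exists A B : set T, [/\ open A, open B, A e, B f & A `&` B = set0]) ->
  hausdorff_space T.
Proof.
move=> sep; rewrite open_hausdorff => e f /eqP ef.
suff [A [B [oA oB Ae Bf AB]]] : exists A B : set T,
    [/\ open A, open B, A e, B f & A `&` B = set0].
  by exists (A, B) => /=; [split; exact/mem_set|split=> //; exact/eqP].
have [[i [De Df]]|//] := sep e f ef.
have : phi i e != phi i f.
  apply/eqP => E; apply: ef.
  by rewrite -(glue_mapK De) -(glue_mapK Df) E.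
have := @norm_hausdorff R 'rV[R]_m; rewrite open_hausdorff => /[apply].
move=> [[A B] /= [/set_mem Ae /set_mem Bf] [oA oB /eqP AB]].
exists (D i `&` phi i @^-1` A), (D i `&` phi i @^-1` B).
split=> //; [exact: glued_open_preimage|exact: glued_open_preimage|].
apply/seteqP; split=> // g [[_ Ag] [_ Bg]].
by have : (A `&` B) (phi i g) by []; rewrite AB.
Qed.

End GluedTopology.

Lemma rV_second_countable (R : realType) (m : nat) :
  @second_countable 'rV[R]_m.
Proof.
pose b (vk : {ffun 'I_m -> rat} * nat) : set 'rV[R]_m :=
  ball (\row_i (ratr (vk.1 i) : R)) vk.2.+1%:R^-1.
exists (range b); first exact: sub_countable (card_image_le _ _) (countableP _).
split; first by move=> _ [vk _ <-]; exact: ball_open.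
move=> x A /nbhs_ballP[e /= e0 eA].
(* The radius 1 / (k + 1) is then below e / 2, so a ball of this radius that contains [x] lies in
   the ball of radius [e] about [x]. *)
pose k := Num.bound (2 / e).
have k0 : 0 < k.+1%:R^-1 :> R by rewrite invr_gt0 ltr0n.
have ke : k.+1%:R^-1 < e / 2 :> R.
  rewrite -[ltRHS]invf_div ltf_pV2 ?posrE ?ltr0n ?divr_gt0 //.
  apply: lt_trans (Num.Theory.archi_boundP _) _; first by rewrite ltW ?divr_gt0.
  by rewrite ltr_nat.
have /choice[v vP] : forall i, exists q : rat, `|x 0 i - ratr q| < k.+1%:R^-1.
  move=> i; have /rat_in_itvoo[q] : x 0 i - k.+1%:R^-1 < x 0 i + k.+1%:R^-1.
    by rewrite ltrD2l (lt_trans _ k0) // oppr_lt0.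
  rewrite in_itv /= => /andP[q1 q2]; exists q.
  move: q1 q2; move: (_^-1) (ratr q) (x 0 i) => r t u q1 q2.
  by rewrite ltr_norml; apply/andP; split; lra.
have xb : b ([ffun i => v i], k) x.
  rewrite /b -ball_normE /= distrC [ltLHS]/Num.norm /= mx_normrE.
  apply/bigmax_ltP; split=> // -[i j] _; rewrite ord1 !mxE ffunE; exact: vP.
exists (b ([ffun i => v i], k)).
  by split=> //; exists ([ffun i => v i], k).
move=> y yb; apply: eA; apply: (@ball_split _ _ (\row_i (ratr ([ffun i => v i] i) : R))).
  by apply/ball_sym; apply: le_ball xb; exact: ltW.
by apply: le_ball yb; exact: ltW.
Qed.

Section GluedManifold.
Variables (R : realType) (m : nat) (G : gluing R m).
Local Notation T := (glued G).
Local Notation D := (@glue_dom R m G).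
Local Notation phi := (@glue_map R m G).
Local Notation psi := (@glue_inv R m G).

Lemma glued_second_countable (I : set (glue_idx G)) : countable I ->
  (forall e, exists2 i, I i & D i e) -> @second_countable T.
Proof.
move=> cI cov; have [B cB [oB Bbase]] := rV_second_countable R m.
pose b (iA : glue_idx G * set 'rV[R]_m) : set T :=
  D iA.1 `&` phi iA.1 @^-1` iA.2.
exists (b @` (I `*` B)); first exact: sub_countable (card_image_le _ _) (countableX cI cB).
split.
  by move=> _ [[i A] [/= Ii BA] <-]; apply: glued_open_preimage; exact: oB.
move=> e A; rewrite nbhsE => -[W [oW We] WA].
have [i Ii De] := cov e.
have : nbhs (phi i e) (phi i @` (D i `&` W)).
  by apply: open_nbhs_nbhs; split; [exact: (oW : glued_open W)|exists e].
move=> /Bbase[C [BC Ce] CW].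
exists (b (i, C)).
  by split; [exists (i, C)|split].
move=> f [/= Df Cf]; apply: WA.
by have [g [Dg Wg] E] := CW _ Cf; rewrite -(glue_mapK Df) -E glue_mapK.
Qed.

Hypothesis hG : hausdorff_space T.
Hypothesis cG : @second_countable T.

Lemma glued_transition_smooth (c d : chart R m T) :
  range (@glued_chart R m G) c -> range (@glued_chart R m G) d ->
  smooth_on (c @` (dom c `&` dom d)) (d \o chart_inv c).
Proof. by move=> [i _ <-] [j _ <-]; exact: smooth_glue_trans. Qed.

Lemma glued_chart_atlas (e : T) :
  range (@glued_chart R m G) (glued_chart (glue_at e)).
Proof. by exists (glue_at e). Qed.

Definition glued_manifold : manifold R m :=
  @Manifold R m T hG cG (range (@glued_chart R m G))
    (fun e => glued_chart (glue_at e)) glued_chart_atlas (@glue_at_dom R m G)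
    glued_transition_smooth.

Variable a : glue_idx G -> 'rV[R]_m -> 'cV[R]_m.
Hypothesis sa : forall i, smooth_on (phi i @` D i) (a i).
Hypothesis aE : forall i j x, (phi i @` (D i `&` D j)) x ->
  a i x = jacobian (phi j \o psi i) x *m a j (phi j (psi i x)).

Definition glued_covector (e : glued_manifold) : 'cV[R]_m :=
  a (glue_at e) (phi (glue_at e) e).

Lemma coefs_glued_covector i x : (phi i @` D i) x ->
  coefs glued_covector (glued_chart i : chart R m glued_manifold) x = a i x.
Proof.
move=> [e De <-]; rewrite (aE (j := glue_at e)); last first.
  by exists e => //; split=> //; exact: glue_at_dom.
by rewrite /coefs /glued_covector /= glue_mapK.
Qed.

Lemma glued_covector_smooth (c : chart R m glued_manifold) :
  atlas glued_manifold c -> smooth_on (cod c) (coefs glued_covector c).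
Proof.
move=> [i _ <-]; apply: smooth_ext (sa i); first exact: open_glue_cod.
by move=> x cx; rewrite coefs_glued_covector.
Qed.

Definition glued_form : oneform glued_manifold :=
  @OneForm R m glued_manifold glued_covector glued_covector_smooth.

End GluedManifold.

(** * Openness of the contact condition *)

Section ContactForms.
Variables (R : realType) (m k : nat).
Variable a : 'I_k -> 'rV[R]_m -> 'cV[R]_m.

Definition columns_mx (y : 'rV[R]_m) : 'M[R]_(m, k) := \matrix_(i, j) a j y i 0.

Lemma mul_columns_mx r (X : 'M[R]_(r, m)) y i j :
  (X *m columns_mx y) i j = (X *m a j y) i 0.
Proof. by rewrite !mxE; apply: eq_bigr => l _; rewrite mxE. Qed.

Lemma mul_columns_eq0 (X : 'rV[R]_m) y :
  X *m columns_mx y = 0 <-> forall j, X *m a j y = 0.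
Proof.
split=> [X0 j|X0]; apply/matrixP => i l; rewrite !ord1.
  by rewrite -mul_columns_mx X0 !mxE.
by rewrite mul_columns_mx X0 !mxE.
Qed.

(** Vanishing of the characteristic subspace, read in one coordinate system at an arbitrary point of
    it. *)
Definition contact_at (y : 'rV[R]_m) := forall X : 'rV[R]_m,
  X *m columns_mx y = 0 ->
  (forall j (Y : 'rV[R]_m), Y *m columns_mx y = 0 ->
     X *m antisym_derive (a j) y *m Y^T = 0) ->
  X = 0.

(** Independence at [y0] persists nearby, so the common kernel has constant rank there and is the
    image of a smooth projector [pi]. Replacing the test vectors by the rows of [pi], the contact
    condition says that a smooth matrix has full row rank, which is open. *)
Lemma open_contact_at U y0 : open U -> U y0 ->
  (forall j, smooth_on U (a j)) -> row_free (columns_mx y0)^T ->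
  contact_at y0 ->
  exists A, [/\ open A, A y0, A `<=` U & forall y, A y -> contact_at y].
Proof.
move=> oU Uy0 sa fC ctc.
have sC : smooth_on U columns_mx.
  apply/(smooth_mxP oU) => i j; have /(smooth_mxP oU)/(_ i 0) := sa j.
  by apply: smooth_ext => // y _; rewrite [RHS]mxE.
have [A1 [oA1 A1y A1U fA1]] := open_row_free oU (smooth_trmx oU sC) Uy0 fC.
have rC y : A1 y -> \rank (columns_mx y) = k.
  by move=> /fA1; rewrite /row_free mxrank_tr => /eqP.
have [A2 [pi [oA2 A2y A21 spi piP]]] : exists A2 (pi : 'rV[R]_m -> 'M[R]_m),
    [/\ open A2, A2 y0, A2 `<=` A1, smooth_on A2 pi &
     forall x, A2 x -> pi x *m columns_mx x = 0 /\
       forall r (X : 'M[R]_(r, m)), X *m columns_mx x = 0 -> X *m pi x = X].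
  apply: smooth_kernel_projector => //; first exact: smooth_sub sC.
  by move=> x A1x; rewrite !rC.
have A2U := subset_trans A21 A1U.
pose B y := row_mx (columns_mx y)
  (juxtapose (fun j => antisym_derive (a j) y *m (pi y)^T)).
have sB : smooth_on A2 B.
  apply: smooth_row_mx => //; first exact: smooth_sub sC.
  apply: (smooth_juxtapose (B := fun j y => antisym_derive (a j) y *m (pi y)^T))
    => // j.
  apply: smooth_mulmx => //; last exact: smooth_trmx.
  by apply: smooth_antisym_derive => //; exact: smooth_sub (sa j).
have BP y : A2 y -> contact_at y <-> row_free (B y).
  move=> A2y'; have [pi0 piX] := piP y A2y'.
  have key (X : 'rV_m) j : X *m (antisym_derive (a j) y *m (pi y)^T) = 0 <->
      (forall Y : 'rV_m, Y *m columns_mx y = 0 ->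
       X *m antisym_derive (a j) y *m Y^T = 0).
    split=> [X0 Y Y0|H].
      by rewrite -(piX _ _ Y0) trmx_mul mulmxA -(mulmxA X) X0 mul0mx.
    apply/rowP => i.
    have := H (row i (pi y)); rewrite -row_mul pi0 row0 => /(_ erefl).
    rewrite tr_row colE !mulmxA -colE -(mulmxA X).
    set Z := X *m _ => Z0; have -> : Z 0 i = col i Z 0 0 by rewrite [RHS]mxE.
    by rewrite Z0 !mxE.
  split=> [ct|fB X X0 XE].
    rewrite -kermx_eq0; apply/negPn/negP => /rowV0Pn[X /sub_kermxP XB /eqP XN0].
    apply: XN0; move: XB.
    rewrite mul_mx_row -[0]row_mx0 => /eq_row_mx[X0 /mul_juxtapose_eq0 XE].
    by apply: ct => // j; apply/key.
  apply: (row_free_inj fB); rewrite mul0mx mul_mx_row X0 -[RHS]row_mx0.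
  congr row_mx; apply/mul_juxtapose_eq0 => j; apply/key => Y.
  exact: XE.
have [A [oA Ay AA2 fA]] := open_row_free oA2 sB A2y ((BP _ A2y).1 ctc).
exists A; split=> //; first exact: subset_trans A2U.
by move=> y /[dup] /AA2 A2y' /fA; exact: (BP _ A2y').2.
Qed.

End ContactForms.

Section GluedContact.
Variables (R : realType) (m k : nat) (G : gluing R m).
Hypothesis hG : hausdorff_space (glued G).
Hypothesis cG : @second_countable (glued G).
Local Notation D := (@glue_dom R m G).
Local Notation phi := (@glue_map R m G).
Local Notation psi := (@glue_inv R m G).
Variable a : 'I_k -> glue_idx G -> 'rV[R]_m -> 'cV[R]_m.
Hypothesis sa : forall j i, smooth_on (phi i @` D i) (a j i).
Hypothesis aE : forall j i l x, (phi i @` (D i `&` D l)) x ->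
  a j i x = jacobian (phi l \o psi i) x *m a j l (phi l (psi i x)).
Local Notation Mt := (glued_manifold hG cG).

Definition glued_forms (j : 'I_k) : oneform Mt :=
  glued_form hG cG (sa j) (@aE j).

Lemma extd_glued_forms j (e : Mt) : extd (glued_forms j) e =
  antisym_derive (a j (glue_at e)) (phi (glue_at e) e).
Proof.
set i := glue_at e; have De : (phi i @` D i) (phi i e).
  by exists e => //; exact: glue_at_dom.
have H v : 'D_v (coefs (glued_forms j) (glued_chart i)) (phi i e) =
    'D_v (a j i) (phi i e).
  apply: near_eq_derive; near=> y; apply: (coefs_glued_covector hG cG (@aE j)).
  near: y; apply: open_nbhs_nbhs; split=> //; exact: open_glue_cod.
by apply/matrixP => u v; rewrite [LHS]mxE [RHS]mxE !H.
Unshelve. all: by end_near. Qed.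

Lemma forms_mx_glued (e : Mt) : forms_mx glued_forms e =
  columns_mx (a^~ (glue_at e)) (phi (glue_at e) e).
Proof. by apply/matrixP => u v; rewrite !mxE. Qed.

Lemma glued_contact :
  (forall e : Mt, contact_at (a^~ (glue_at e)) (phi (glue_at e) e)) ->
  contact glued_forms.
Proof.
move=> ct e; apply/eqP; rewrite -submx0; apply/row_subP => u.
have : (row u (char_distr glued_forms e) <= char_distr glued_forms e)%MS.
  exact: row_sub.
move=> /sub_char_distrP[]; rewrite forms_mx_glued => X0 XE.
rewrite (_ : row u _ = 0) ?sub0mx //; apply: (ct e) => // j Y Y0.
have := XE j; rewrite extd_glued_forms.
have : (Y <= distr glued_forms e)%MS by apply/sub_distrP; rewrite forms_mx_glued.
by move=> /submxP[Z ->] XE0; rewrite trmx_mul mulmxA XE0 mul0mx.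
Qed.

End GluedContact.

(** * Open submanifolds of a glued manifold *)

Section RestrictGluing.
Variables (R : realType) (m : nat) (G : gluing R m).
Local Notation D := (@glue_dom R m G).
Local Notation phi := (@glue_map R m G).
Local Notation psi := (@glue_inv R m G).
Variable W : glue_idx G -> set 'rV[R]_m.
Hypothesis oW : forall i, open (W i).

Definition kept : set (glued G) := fun e => exists i, D i e /\ W i (phi i e).

Variable z : glue_idx G -> glue_pt G.
Hypothesis z_dom : forall i, D i (z i).
Hypothesis zW : forall i, W i (phi i (z i)).
Hypothesis z_inj : injective z.

Definition kept_pt := {e : glue_pt G | kept e}.

Lemma z_kept i : kept (z i).
Proof. by exists i. Qed.

Lemma kept_ptP (e f : kept_pt) : sval e = sval f -> e = f.
Proof.
by case: e f => [e ke] [f kf] /= ef; subst f; rewrite (Prop_irrelevance ke kf).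
Qed.

(** Chart inverses are total functions, so a value is needed off [kept]; the point [z i] serves as
    default. *)
Definition keep (i : glue_idx G) (e : glue_pt G) : kept_pt :=
  match pselect (kept e) with
  | left h => exist _ e h
  | right _ => exist _ (z i) (z_kept i)
  end.

Lemma keepK i e : kept e -> sval (keep i e) = e.
Proof. by rewrite /keep; case: pselect. Qed.

Lemma open_kept : open kept.
Proof.
rewrite (_ : kept = \bigcup_i (D i `&` phi i @^-1` W i)).
  by apply: bigcup_open => i _; exact: glued_open_preimage.
by apply/seteqP; split=> e [i ? //]; exists i.
Qed.

(** The preferred chart of a kept point is one in whose region [W i] it lies, which is where the
    contact condition will be known. At [z i] it has to be the chart [i], so that the zero section
    is computed in the frame centred at its own base point; injectivity of [z] makes this demand
    consistent. *)
Lemma center_exists : exists c : kept_pt -> glue_idx G, forall e,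
  [/\ D (c e) (sval e), W (c e) (phi (c e) (sval e)) &
      forall i, sval e = z i -> c e = i].
Proof.
suff /choice[c cP] : forall e : kept_pt, exists i, [/\ D i (sval e),
    W i (phi i (sval e)) & forall l, sval e = z l -> i = l] by exists c.
case=> e ke /=; have [[i ez]|nz] := pselect (exists i, e = z i).
  exists i; rewrite ez; split=> [||l] //; exact: z_inj.
have [i [De We]] := ke; exists i; split=> // l ez.
by case: nz; exists l.
Qed.

Definition center := sval (cid center_exists).

Lemma centerP e : [/\ D (center e) (sval e), W (center e) (phi (center e) (sval e)) &
  forall i, sval e = z i -> center e = i].
Proof. exact: (svalP (cid center_exists)). Qed.

Definition kept_dom i : set kept_pt := fun e => D i (sval e).

Lemma kept_image i (A : set (glued G)) :
  (fun e : kept_pt => phi i (sval e)) @` (kept_dom i `&` (fun e => A (sval e))) =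
  phi i @` (D i `&` (A `&` kept)).
Proof.
apply/seteqP; split=> [_ [e [De Ae] <-]|_ [e [De [Ae ke]] <-]].
  by exists (sval e) => //; split=> //; split=> //; exact: (svalP e).
by exists (exist _ e ke).
Qed.

Lemma kept_mapK i e : kept_dom i e -> keep i (psi i (phi i (sval e))) = e.
Proof.
move=> De; apply: kept_ptP; rewrite glue_mapK // keepK //.
exact: (svalP e).
Qed.

Lemma open_kept_overlap i j : open ((fun e : kept_pt => phi i (sval e)) @`
  (kept_dom i `&` kept_dom j)).
Proof.
rewrite (kept_image i (D j)).
have ojk : glued_open (D j `&` kept).
  by apply: openI open_kept; exact: glued_open_dom.
exact: ojk.
Qed.

Lemma smooth_kept_trans i j :
  smooth_on ((fun e : kept_pt => phi i (sval e)) @` (kept_dom i `&` kept_dom j))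
    ((fun e : kept_pt => phi j (sval e)) \o (fun y => keep i (psi i y))).
Proof.
have sub : (fun e : kept_pt => phi i (sval e)) @` (kept_dom i `&` kept_dom j) `<=`
    phi i @` (D i `&` D j).
  by move=> _ [e [Di Dj] <-]; exists (sval e).
apply: smooth_ext (smooth_sub sub (@smooth_glue_trans R m G i j)).
  exact: open_kept_overlap.
by move=> _ [e [Di Dj] <-] /=; rewrite kept_mapK // glue_mapK.
Qed.

Definition restrict_gluing : gluing R m :=
  @Gluing R m kept_pt (glue_idx G) kept_dom (fun i e => phi i (sval e))
    (fun i y => keep i (psi i y)) center
    (fun e => let: And3 h _ _ := centerP e in h)
    kept_mapK open_kept_overlap smooth_kept_trans.

Lemma open_restrict (A : set (glued G)) : open A ->
  open ((fun e => A (sval e)) : set (glued restrict_gluing)).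
Proof.
move=> oA; rewrite -[open _]/(glued_open _) => i.
rewrite (kept_image i A).
have oAk : glued_open (A `&` kept) by exact: openI open_kept.
exact: oAk.
Qed.

Lemma restrict_hausdorff :
  (forall e f : glued G, e <> f -> (exists i, D i e /\ D i f) \/
    exists A B : set (glued G), [/\ open A, open B, A e, B f & A `&` B = set0]) ->
  hausdorff_space (glued restrict_gluing).
Proof.
move=> sep; apply: glued_hausdorff => e f ef.
have [||[A [B [oA oB Ae Bf AB]]]] := sep (sval e) (sval f).
- by move=> E; apply: ef; exact: kept_ptP.
- by move=> [i [De Df]]; left; exists i.
right; exists (fun e => A (sval e)), (fun e => B (sval e)).
split=> //; [exact: open_restrict|exact: open_restrict|].
by apply/seteqP; split=> // g [/= Ag Bg]; have : (A `&` B) (sval g) by [];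
  rewrite AB.
Qed.

Lemma restrict_second_countable (I : set (glue_idx G)) : countable I ->
  (forall e, exists2 i, I i & D i e) -> @second_countable (glued restrict_gluing).
Proof.
move=> cI cov; apply: (glued_second_countable (G := restrict_gluing) cI).
by move=> e; have [i] := cov (sval e); exists i.
Qed.

End RestrictGluing.

(** * The thickening and its forms *)

(* Around [q], bases of the images of the projector [P] on covectors and of the
   relations [z *m (forms_mx eta p)^T = 0] between the forms. *)
Record adapted_frame (R : realType) (n : nat) (M : manifold R n) (k : nat)
    (eta : 'I_k -> oneform M) (P : M -> 'M[R]_n) (r t : nat) (q : M) := Frame {
  frame_dom : set M;
  frame_open : open frame_dom;
  frame_center : frame_dom q;
  frame_chart : frame_dom `<=` dom (chart_at q);
  FA : M -> 'M[R]_(n, r);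
  CA : M -> 'M[R]_(r, n);
  FK : M -> 'M[R]_(t, k);
  CK : M -> 'M[R]_(k, t);
  CA_FA : forall p, frame_dom p -> CA p *m FA p = 1%:M;
  FA_CA : forall p, frame_dom p -> FA p *m CA p = P p;
  FK_CK : forall p, frame_dom p -> FK p *m CK p = 1%:M;
  FK_forms : forall p, frame_dom p -> FK p *m (forms_mx eta p)^T = 0;
  CK_FK : forall p (z : 'rV[R]_k), frame_dom p -> z *m (forms_mx eta p)^T = 0 ->
    z *m CK p *m FK p = z;
  smooth_FA : smooth_on (chart_at q @` frame_dom) (fun x =>
    let p := chart_inv (chart_at q) x in jac (chart_at q) (chart_at p) p *m FA p);
  smooth_CA : smooth_on (chart_at q @` frame_dom) (fun x =>
    let p := chart_inv (chart_at q) x in CA p *m jac (chart_at p) (chart_at q) p);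
  smooth_FK : smooth_on (chart_at q @` frame_dom)
    (fun x => FK (chart_inv (chart_at q) x));
  smooth_CK : smooth_on (chart_at q @` frame_dom)
    (fun x => CK (chart_inv (chart_at q) x))
}.

(** Covectors are columns, so [P p] acts on them from the left, and a factorisation of [P] in the
    chart at [q] gives both a frame of its image and the coordinates in it. [FA] and [CA] are then
    rewritten in the preferred chart of each [p]. The relations have rank [k - s], being the left
    kernel of a matrix of rank [s] with [k] rows. *)
Lemma adapted_frame_exists (R : realType) (n : nat) (M : manifold R n) (k : nat)
    (eta : 'I_k -> oneform M) (P : M -> 'M[R]_n) (r s : nat) (q : M) :
  smooth_endo setT P -> (forall p, P p *m P p = P p) ->
  (forall p, \rank (P p) = r) -> (forall p, \rank (forms_mx eta p) = s) ->
  inhabited (adapted_frame eta P r (k - s) q).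
Proof.
move=> sP PP rP rN.
pose c := chart_at q; have Mc : atlas M c := chart_at_atlas q.
have cq : dom c q := chart_at_dom q.
pose J p := jac c (chart_at p) p; pose J' p := jac (chart_at p) c p.
have JJ' p : dom c p -> J p *m J' p = 1%:M.
  by move=> cp; apply: jacK => //; [exact: chart_at_atlas|exact: chart_at_dom].
have J'J p : dom c p -> J' p *m J p = 1%:M.
  by move=> cp; apply: jacK => //; [exact: chart_at_atlas|exact: chart_at_dom].
have uJ p : dom c p -> J p \in unitmx by move=> /JJ'/mulmx1_unit[].
have oc : open (cod c) by exact: open_cod.
pose Pc x := endo_in c P (chart_inv c x).
have PcE p : dom c p -> Pc (c p) = J p *m P p *m J' p.
  by move=> cp; rewrite /Pc chart_funK.
have [U1 [Fr [Co [oU1 U1q U1c [sFr sCo] FrCo]]]] : exists A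
    (Fr : 'rV[R]_n -> 'M[R]_(r, n)) (Co : 'rV[R]_n -> 'M[R]_(n, r)),
    [/\ open A, A (c q), A `<=` cod c, smooth_on A Fr /\ smooth_on A Co &
     forall x, A x -> Fr x *m Co x = 1%:M /\ Co x *m Fr x = Pc x].
  apply: smooth_frame => //.
  - by have := sP c Mc; rewrite setIT.
  - exact: cod_chart.
  - move=> _ [p cp <-]; rewrite PcE //.
    rewrite -!mulmxA (mulmxA (J' p)) J'J // mul1mx (mulmxA (P p)) PP.
    by [].
  move=> _ [p cp <-]; rewrite PcE //.
  rewrite mxrankMfree; last by rewrite row_free_unit; case: (mulmx1_unit (J'J p cp)).
  by rewrite eqmxMfull ?row_full_unit ?uJ.
have sNT : smooth_on (cod c) (fun x => (coefs_mx eta c x)^T).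
  by apply: smooth_trmx => //; exact: smooth_coefs_mx.
have NTE p : dom c p -> (coefs_mx eta c (c p))^T = (forms_mx eta p)^T *m (J p)^T.
  by move=> cp; rewrite coefs_mxE // trmx_mul.
have rNT p : dom c p -> \rank (coefs_mx eta c (c p))^T = s.
  move=> cp; rewrite mxrank_tr coefs_mxE // eqmxMfull ?row_full_unit ?uJ //.
have [U2 [pi [oU2 U2q U2c spi piP]]] : exists A (pi : 'rV[R]_n -> 'M[R]_k),
    [/\ open A, A (c q), A `<=` cod c, smooth_on A pi &
     forall x, A x -> pi x *m (coefs_mx eta c x)^T = 0 /\
       forall r (X : 'M[R]_(r, k)), X *m (coefs_mx eta c x)^T = 0 -> X *m pi x = X].
  apply: smooth_kernel_projector => //; first exact: cod_chart.
  by move=> _ [p cp <-]; rewrite !rNT.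
have pipi x : U2 x -> pi x *m pi x = pi x.
  by move=> /piP[pi0 H]; exact: H.
have rpi x : U2 x -> \rank (pi x) = (k - s)%N.
  move=> U2x; have [p cp E] := U2c _ U2x; have [pi0 H] := piP _ U2x.
  rewrite -(rNT _ cp) E -mxrank_ker; apply: eqmx_rank; apply/andP; split.
    exact/sub_kermxP.
  by rewrite -[X in (X <= _)%MS](H _ _ (mulmx_ker _)) submxMl.
have [U3 [FK [CK [oU3 U3q U32 [sFK sCK] FKCK]]]] := smooth_frame oU2 spi U2q pipi rpi.
pose A := dom c `&` c @^-1` (U1 `&` U3).
have oA : open A by apply: open_chart_preimage; exact: openI.
have cA : c @` A `<=` U1 `&` U3 by move=> _ [p [_ ?] <-].
have ocA : open (c @` A).
  by have := open_chart_image (c := c) oA; rewrite setIA setIid.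
have sub1 : c @` A `<=` U1 by move=> x /cA[].
have sub3 : c @` A `<=` U3 by move=> x /cA[].
(* Relations between the forms do not depend on the chart: a change of chart multiplies the
   transposed coefficient matrix on the right by an invertible matrix. *)
have NT0 p a (X : 'M[R]_(a, k)) : A p ->
    X *m (forms_mx eta p)^T = 0 <-> X *m (coefs_mx eta c (c p))^T = 0.
  move=> [cp _]; rewrite NTE // mulmxA; split=> [->|]; first by rewrite mul0mx.
  have uJT : (J p)^T \in unitmx by rewrite unitmx_tr uJ.
  by move=> X0; rewrite -[LHS](mulmxK uJT) X0 mul0mx.
split; apply: (@Frame _ _ _ _ _ _ _ _ _ A oA _ _ (fun p => J' p *m Co (c p))
  (fun p => Fr (c p) *m J p) (fun p => FK (c p)) (fun p => CK (c p))).
- by split.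
- by move=> p [].
- move=> p [cp [/FrCo[FC _] _]].
  by rewrite -mulmxA (mulmxA (J p)) JJ' // mul1mx.
- move=> p [cp [/FrCo[_ CF] _]].
  rewrite -mulmxA (mulmxA (Co _)) CF PcE // !mulmxA J'J // mul1mx.
  by rewrite -mulmxA J'J // mulmx1.
- by move=> p [cp [_ /FKCK[]]].
- move=> p Ap; apply/NT0 => //; have [_ [_ U3p]] := Ap.
  have [FC CF] := FKCK _ U3p; have [pi0 _] := piP _ (U32 _ U3p).
  have FE : FK (c p) = FK (c p) *m pi (c p) by rewrite -CF mulmxA FC mul1mx.
  by rewrite FE -mulmxA pi0 mulmx0.
- move=> p x Ap /(NT0 _ _ _ Ap) x0; have [_ [_ U3p]] := Ap.
  have [_ CF] := FKCK _ U3p; have [_ H] := piP _ (U32 _ U3p).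
  by rewrite -mulmxA CF H.
- apply: smooth_ext (smooth_sub sub1 sCo) => // _ [p [cp _] <-].
  by rewrite /= chart_funK // -/(J p) mulmxA JJ' // mul1mx.
- apply: smooth_ext (smooth_sub sub1 sFr) => // _ [p [cp _] <-].
  by rewrite /= chart_funK // -mulmxA -/(J' p) JJ' // mulmx1.
- apply: smooth_ext (smooth_sub sub3 sFK) => // _ [p [cp _] <-].
  by rewrite chart_funK.
- apply: smooth_ext (smooth_sub sub3 sCK) => // _ [p [cp _] <-].
  by rewrite chart_funK.
Qed.

(** * Coordinates on the total space *)

Section Coordinates.
Variables (R : realType) (n r k t : nat).

Definition coord_base (y : 'rV[R]_(n + (r * k + t))) : 'rV[R]_n := lsubmx y.
Definition coord_al (y : 'rV[R]_(n + (r * k + t))) : 'M[R]_(r, k) :=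
  vec_mx (lsubmx (rsubmx y)).
Definition coord_z (y : 'rV[R]_(n + (r * k + t))) : 'rV[R]_t :=
  rsubmx (rsubmx y).
Definition coords (x : 'rV[R]_n) (a : 'M[R]_(r, k)) (b : 'rV[R]_t) :=
  row_mx x (row_mx (mxvec a) b).

Lemma coord_baseK x a b : coord_base (coords x a b) = x.
Proof. by rewrite /coord_base row_mxKl. Qed.

Lemma coord_alK x a b : coord_al (coords x a b) = a.
Proof. by rewrite /coord_al row_mxKr row_mxKl mxvecK. Qed.

Lemma coord_zK x a b : coord_z (coords x a b) = b.
Proof. by rewrite /coord_z !row_mxKr. Qed.

Lemma coordsK y : coords (coord_base y) (coord_al y) (coord_z y) = y.
Proof. by rewrite /coords /coord_al vec_mxK !hsubmxK. Qed.

Section Smooth.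
Variables (l : nat) (U : set 'rV[R]_l).
Hypothesis oU : open U.

Lemma smooth_coords x a b : smooth_on U x -> smooth_on U a -> smooth_on U b ->
  smooth_on U (fun y => coords (x y) (a y) (b y)).
Proof.
move=> sx sa sb; do 2!apply: smooth_row_mx => //.
apply/(smooth_mxP oU) => i jl; case/mxvec_indexP: jl => j h.
have /(smooth_mxP oU)/(_ j h) := sa.
by apply: smooth_ext => // y _; rewrite ord1 mxvecE.
Qed.

End Smooth.

Lemma smooth_coord_base U : open U -> smooth_on U coord_base.
Proof.
move=> oU; apply/(smooth_mxP oU) => i j.
by apply: smooth_ext (@smooth_coord _ _ U (lshift _ j)) => // y _;
  rewrite ord1 mxE.
Qed.

Lemma smooth_coord_al U : open U -> smooth_on U coord_al.
Proof.
move=> oU; apply/(smooth_mxP oU) => i j.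
apply: smooth_ext (@smooth_coord _ _ U (rshift _ (lshift _ (mxvec_index i j)))) => //.
by move=> y _; rewrite !mxE.
Qed.

Lemma smooth_coord_z U : open U -> smooth_on U coord_z.
Proof.
move=> oU; apply/(smooth_mxP oU) => i j.
by apply: smooth_ext (@smooth_coord _ _ U (rshift _ (rshift _ j))) => // y _;
  rewrite ord1 !mxE.
Qed.

Lemma open_coord_base (X : set 'rV[R]_n) :
  open X -> open [set y | X (coord_base y)].
Proof.
apply: open_comp => y _.
exact: smooth_continuous (smooth_coord_base openT) _.
Qed.

End Coordinates.

Section Thickening.
Variables (R : realType) (n k r t : nat) (M : manifold R n).
Variables (eta : 'I_k -> oneform M) (P : M -> 'M[R]_n).
Variable fr : forall q, adapted_frame eta P r t q.
Local Notation c_ q := (chart_at q).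
Local Notation U_ q := (frame_dom (fr q)).

(* [al] is the matrix of k covectors at [base], in the coordinates of the chart
   [chart_at base]. *)
Record thick_pt := ThickPt {
  base : M;
  al : 'M[R]_(n, k);
  zz : 'rV[R]_k;
  thickP : P base *m al = al /\ zz *m (forms_mx eta base)^T = 0
}.

Lemma thick_eq (e f : thick_pt) :
  base e = base f -> al e = al f -> zz e = zz f -> e = f.
Proof.
case: e f => [p a z h] [p' a' z' h'] /= pp' aa' zz'; subst p' a' z'.
by rewrite (Prop_irrelevance h h').
Qed.

Lemma thick0P p : P p *m (0 : 'M[R]_(n, k)) = 0 /\
  (0 : 'rV[R]_k) *m (forms_mx eta p)^T = 0.
Proof. by rewrite mulmx0 mul0mx. Qed.

Definition thick0 p : thick_pt := ThickPt (thick0P p).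

(** Made total, with the zero vector over [p] as default, because chart inverses are total. *)
Definition thick p (a : 'M[R]_(n, k)) (z : 'rV[R]_k) : thick_pt :=
  match pselect (P p *m a = a /\ z *m (forms_mx eta p)^T = 0) with
  | left h => ThickPt h
  | right _ => thick0 p
  end.

Lemma base_thick p a z : base (thick p a z) = p.
Proof. by rewrite /thick; case: pselect. Qed.

Lemma thickE p a z : P p *m a = a /\ z *m (forms_mx eta p)^T = 0 ->
  al (thick p a z) = a /\ zz (thick p a z) = z.
Proof. by rewrite /thick; case: pselect. Qed.

Local Notation m := (n + (r * k + t))%N.

Definition thick_map q (e : thick_pt) : 'rV[R]_m :=
  coords (c_ q (base e)) (CA (fr q) (base e) *m al e)
    (zz e *m CK (fr q) (base e)).

Definition thick_inv q (y : 'rV[R]_m) : thick_pt :=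
  let p := chart_inv (c_ q) (coord_base y) in
  thick p (FA (fr q) p *m coord_al y) (coord_z y *m FK (fr q) p).

Definition thick_dom q : set thick_pt := fun e => U_ q (base e).

Lemma frame_fibre q p (a : 'M[R]_(r, k)) (b : 'rV[R]_t) : U_ q p ->
  P p *m (FA (fr q) p *m a) = FA (fr q) p *m a /\
  b *m FK (fr q) p *m (forms_mx eta p)^T = 0.
Proof.
move=> Up; rewrite -(FA_CA Up) -(mulmxA b) FK_forms // mulmx0; split=> //.
by rewrite -mulmxA (mulmxA (CA _ _)) CA_FA // mul1mx.
Qed.

Lemma thick_mapK q e : thick_dom q e -> thick_inv q (thick_map q e) = e.
Proof.
move=> Ue; have cp : dom (c_ q) (base e) by exact: frame_chart Ue.
have [Pa zN] := thickP e.
rewrite /thick_inv /thick_map coord_baseK coord_alK coord_zK chart_funK //.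
rewrite mulmxA FA_CA // Pa CK_FK //.
by have [? ?] := thickE (thickP e); apply: thick_eq; rewrite ?base_thick.
Qed.

Lemma thick_invP q y : (c_ q @` U_ q) (coord_base y) ->
  thick_dom q (thick_inv q y) /\ thick_map q (thick_inv q y) = y.
Proof.
move=> [p Up E]; have cp : dom (c_ q) p by exact: frame_chart Up.
rewrite /thick_dom /thick_map /thick_inv -E chart_funK // base_thick; split=> //.
have [-> ->] := thickE (frame_fibre (coord_al y) (coord_z y) Up).
by rewrite mulmxA CA_FA // mul1mx -mulmxA FK_CK // mulmx1 E coordsK.
Qed.

Lemma thick_image q (A : set M) :
  thick_map q @` (thick_dom q `&` (fun e => A (base e))) =
  [set y | (c_ q @` (U_ q `&` A)) (coord_base y)].
Proof.
apply/seteqP; split=> [_ [e [Ue Ae] <-]|y [p [Up Ap] E]] /=.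
  by rewrite coord_baseK; exists (base e).
have cp : dom (c_ q) p by exact: frame_chart Up.
have [|Ue ye] := @thick_invP q y; first by rewrite -E; exists p.
exists (thick_inv q y) => //; split=> //.
by rewrite /thick_inv -E chart_funK // base_thick.
Qed.

Lemma open_frame_image q (A : set M) : open A -> open (c_ q @` (U_ q `&` A)).
Proof.
move=> oA; rewrite -(setIidr (@frame_chart _ _ _ _ _ _ _ _ _ (fr q))) -setIA.
by apply: open_chart_image; apply: openI => //; exact: frame_open.
Qed.

Lemma open_thick_image q (A : set M) : open A ->
  open (thick_map q @` (thick_dom q `&` (fun e => A (base e)))).
Proof.
by move=> oA; rewrite thick_image; exact/open_coord_base/open_frame_image.
Qed.

Lemma open_thick_overlap q q' :
  open (thick_map q @` (thick_dom q `&` thick_dom q')).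
Proof. exact: (@open_thick_image q _ (@frame_open _ _ _ _ _ _ _ _ _ (fr q'))). Qed.

(** The transition is that of M on the base and linear in the fibres, with matrices [S1] and [S2].
    The frames are smooth only after conversion from the preferred chart of [p] to the charts at [q]
    and [q']; the Jacobians inserted in [S1] for this purpose multiply to the identity. *)
Lemma smooth_thick_trans q q' :
  smooth_on (thick_map q @` (thick_dom q `&` thick_dom q'))
    (thick_map q' \o thick_inv q).
Proof.
have [Mq Mq'] := (chart_at_atlas q, chart_at_atlas q').
pose X := c_ q @` (U_ q `&` U_ q').
pose O := thick_map q @` (thick_dom q `&` thick_dom q').
have oX : open X by exact/open_frame_image/frame_open.
have oO : open O by exact: open_thick_overlap.
have OX y : O y -> X (coord_base y).
  by rewrite /O (thick_image q (U_ q')).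
have Xov : X `<=` c_ q @` (dom (c_ q) `&` dom (c_ q')).
  by move=> _ [p [Up Up'] <-]; exists p => //; split; [exact: frame_chart Up|exact: frame_chart Up'].
have Xq : X `<=` c_ q @` U_ q by move=> _ [p [Up Up'] <-]; exists p.
pose T := c_ q' \o chart_inv (c_ q).
have XT x : X x -> (c_ q' @` U_ q') (T x).
  move=> [p [Up Up'] <-]; rewrite /T /= chart_funK; first by exists p.
  exact: frame_chart Up.
have oU' : open (c_ q' @` U_ q').
  by have := open_frame_image (q := q') openT; rewrite setIT.
have sT : smooth_on X T by exact: smooth_sub Xov (transition_smooth Mq Mq').
pose S1 x := let p := chart_inv (c_ q) x in CA (fr q') p *m FA (fr q) p.
pose S2 x := let p := chart_inv (c_ q) x in FK (fr q) p *m CK (fr q') p.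
have sS1 : smooth_on X S1.
  have s1 := smooth_comp_mx oX oU' XT sT (smooth_CA (fr q')).
  have s2 := smooth_sub Xov (smooth_jac_inv Mq Mq').
  have s3 := smooth_sub Xq (smooth_FA (fr q)).
  apply: smooth_ext (smooth_mulmx oX (smooth_mulmx oX s1 s2) s3) => //.
  move=> _ [p [Up Up'] <-].
  have [cp cp'] := (frame_chart Up, frame_chart Up').
  have [Mp pp] := (chart_at_atlas p, chart_at_dom p).
  rewrite /S1 /T /= (chart_funK cp) (chart_funK cp').
  rewrite -!mulmxA; congr (_ *m _); rewrite !mulmxA.
  by rewrite -(jac_comp Mp Mq' Mq) // jacK // mul1mx.
have sS2 : smooth_on X S2.
  have s1 := smooth_comp_mx oX oU' XT sT (smooth_CK (fr q')).
  have s2 := smooth_sub Xq (smooth_FK (fr q)).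
  apply: smooth_ext (smooth_mulmx oX s2 s1) => //.
  move=> _ [p [Up Up'] <-].
  have [cp cp'] := (frame_chart Up, frame_chart Up').
  by rewrite /S2 /T /= (chart_funK cp) (chart_funK cp').
have sb := smooth_coord_base oO.
have s1 : smooth_on O (fun y => T (coord_base y)).
  exact: smooth_comp_mx OX sb sT.
have s2 : smooth_on O (fun y => S1 (coord_base y) *m coord_al y).
  apply: smooth_mulmx => //; last exact: smooth_coord_al.
  exact: smooth_comp_mx OX sb sS1.
have s3 : smooth_on O (fun y => coord_z y *m S2 (coord_base y)).
  apply: smooth_mulmx => //; first exact: smooth_coord_z.
  exact: smooth_comp_mx OX sb sS2.
apply: smooth_ext (smooth_coords oO s1 s2 s3) => // y /OX [p [Up Up'] E].
have cp := frame_chart Up.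
rewrite /= /thick_map /thick_inv /T /S1 /S2 -E /= !(chart_funK cp) base_thick.
have [-> ->] := thickE (frame_fibre (coord_al y) (coord_z y) Up).
by rewrite !mulmxA.
Qed.

Definition thickening : gluing R m :=
  @Gluing R m thick_pt M thick_dom thick_map thick_inv base
    (fun e => frame_center (fr (base e))) thick_mapK open_thick_overlap
    smooth_thick_trans.

Lemma open_base_preimage (A : set M) :
  open A -> open ((fun e => A (base e)) : set (glued thickening)).
Proof.
move=> oA; rewrite -[open _]/(glued_open _) => q.
exact: open_thick_image.
Qed.

Lemma thickening_separation (e f : glued thickening) : e <> f ->
  (exists i, thick_dom i e /\ thick_dom i f) \/
  exists A B : set (glued thickening),
    [/\ open A, open B, A e, B f & A `&` B = set0].
Proof.
move=> ef; have [bef|/eqP bef] := pselect (base e = base f).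
  left; exists (base e); rewrite /thick_dom -bef.
  by split; exact: frame_center.
right; have := @manifold_hausdorff _ _ M; rewrite open_hausdorff => /(_ _ _ bef).
move=> [[A B] /= [/set_mem Ae /set_mem Bf] [oA oB /eqP AB]].
exists (fun e => A (base e)), (fun e => B (base e)).
split=> //; [exact: open_base_preimage|exact: open_base_preimage|].
by apply/seteqP; split=> // g [/= Ag Bg]; have : (A `&` B) (base g) by [];
  rewrite AB.
Qed.

Lemma countable_frames : exists2 I : set M, countable I &
  forall p, exists2 q, I q & U_ q p.
Proof.
have [[p0 _]|no] := pselect (exists p0 : M, True); last first.
  by exists set0 => // p; case: no; exists p.
have [B cB [_ Bbase]] := manifold_second_countable M.
(* One frame domain is selected for each basic open set contained in some frame domain, with the
   point [p0] as default for the others. *)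
have /choice[sel selP] : forall W : set M, exists q,
    (exists q', W `<=` U_ q') -> W `<=` U_ q.
  move=> W; have [[q Wq]|nq] := pselect (exists q', W `<=` U_ q').
    by exists q.
  by exists p0.
exists (sel @` B); first exact: sub_countable (card_image_le _ _) cB.
move=> p; have np : nbhs p (U_ p).
  by apply: open_nbhs_nbhs; split; [exact: frame_open|exact: frame_center].
have [W [BW Wp] Wb] := Bbase p _ np.
by exists (sel W); [exists W|apply: selP => //; exists p].
Qed.

End Thickening.

(** * Differentials of functions in coordinates *)

Section Gradient.
Variable R : realType.

Definition grad m (h : 'rV[R]_m -> R) (y : 'rV[R]_m) : 'cV[R]_m :=
  \col_i 'D_(delta_mx 0 i) h y.

Lemma mul_grad m (h : 'rV[R]_m -> R) y (X : 'rV[R]_m) :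
  differentiable h y -> X *m grad h y = ('D_X h y)%:M.
Proof.
move=> dh; apply/matrixP => i j; rewrite !ord1 [RHS]mxE eqxx mulr1n.
by rewrite derive_sum_delta // mxE; apply: eq_bigr => l _; rewrite mxE.
Qed.

Lemma smooth_grad m U (h : 'rV[R]_m -> R) : open U ->
  smooth_on U h -> smooth_on U (grad h).
Proof.
move=> oU sh; apply/(smooth_mxP oU) => i j.
apply: smooth_ext (smooth_derive (delta_mx 0 i) sh) => // y _.
by rewrite [RHS]mxE.
Qed.

Lemma grad_comp m l (f : 'rV[R]_m -> 'rV[R]_l) (h : 'rV[R]_l -> R) y :
  differentiable f y -> differentiable h (f y) ->
  grad (h \o f) y = jacobian f y *m grad h (f y).
Proof.
move=> df dh; apply/row_matrixP => i.
have dhf : differentiable (h \o f) y by exact: differentiable_comp.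
rewrite row_mul [LHS]rowE (mul_grad _ dhf) (derive_comp _ df dh).
by rewrite row_jacobian // mul_grad.
Qed.

(** The identity d (d h) = 0, which is Schwarz's theorem. *)
Lemma antisym_derive_grad m U (h : 'rV[R]_m -> R) y : open U -> U y ->
  smooth_on U h -> antisym_derive (grad h) y = 0.
Proof.
move=> oU Uy sh; have sg := smooth_grad oU sh.
have dg : differentiable (grad h) y by exact: smooth_differentiable sg Uy.
have E u i : ('D_u (grad h) y) i 0 = 'D_u ('D_(delta_mx 0 i) h) y.
  rewrite (derive_mxE _ _ _ dg); apply: near_eq_derive; near=> x.
  by rewrite mxE.
have S i j := schwarz (delta_mx 0 i) (delta_mx 0 j) oU sh Uy.
apply/matrixP => i j; rewrite [RHS]mxE; apply: etrans (mxE _ _ _ _) _.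
apply/eqP; rewrite subr_eq0; apply/eqP.
exact: etrans (E _ _) (etrans (S i j) (esym (E _ _))).
Unshelve. all: by end_near. Qed.

Lemma antisym_deriveD m (a b : 'rV[R]_m -> 'cV[R]_m) y :
  differentiable a y -> differentiable b y ->
  antisym_derive (fun x => a x + b x) y =
  antisym_derive a y + antisym_derive b y.
Proof.
move=> da db.
have E v : 'D_v (fun x => a x + b x) y = 'D_v a y + 'D_v b y.
  by apply: deriveD; exact: diff_derivable.
apply/matrixP => i j.
have AE f : antisym_derive f y i j =
    ('D_(delta_mx 0 i) f y) j 0 - ('D_(delta_mx 0 j) f y) i 0 by rewrite mxE.
apply: etrans (AE _) _; rewrite (E (delta_mx 0 i)) (E (delta_mx 0 j)).
rewrite [RHS]mxE (AE a) (AE b); move: ('D__ a y) ('D__ a y) ('D__ b y) ('D__ b y).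
by move=> A B C D; rewrite !mxE opprD addrACA.
Qed.

End Gradient.

Section CoordinateDerivatives.
Variables (R : realType) (n r k t : nat).
Local Notation m := (n + (r * k + t))%N.
Implicit Types (X y : 'rV[R]_m).

Lemma differentiable_coord_base y :
  differentiable (@coord_base R n r k t) y.
Proof. exact: (smooth_differentiable (smooth_coord_base openT)). Qed.

Lemma derive_coord_base y X :
  'D_X (@coord_base R n r k t) y = coord_base X.
Proof.
apply/rowP => j; rewrite (derive_mxE _ _ _ (differentiable_coord_base y)).
have -> : (fun x : 'rV[R]_m => coord_base x 0 j) = fun x => x 0 (lshift _ j).
  by apply/funext => x; rewrite mxE.
by rewrite derive_coord [RHS]mxE.
Qed.

Lemma derive_coord_al y X i j :
  'D_X (fun x => (coord_al x : 'M[R]_(r, k)) i j) y =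
  (coord_al X : 'M[R]_(r, k)) i j.
Proof.
have E (x : 'rV[R]_m) : (coord_al x : 'M[R]_(r, k)) i j =
    x 0 (rshift n (lshift t (mxvec_index i j))) by rewrite !mxE.
by rewrite (funext E) derive_coord E.
Qed.

Lemma derive_coord_z y X j :
  'D_X (fun x => (coord_z x : 'rV[R]_t) 0 j) y = (coord_z X : 'rV[R]_t) 0 j.
Proof.
have E (x : 'rV[R]_m) : (coord_z x : 'rV[R]_t) 0 j =
    x 0 (rshift n (rshift (r * k) j)) by rewrite !mxE.
by rewrite (funext E) derive_coord E.
Qed.

Lemma mul_col_mx0 X (u : 'cV[R]_n) :
  X *m (col_mx u 0 : 'cV_m) = coord_base X *m u.
Proof. by rewrite -[X in X *m _]hsubmxK mul_row_col mulmx0 addr0. Qed.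

Lemma smooth_col_mx0 U (u : 'rV[R]_m -> 'cV[R]_n) : open U -> smooth_on U u ->
  smooth_on U (fun y => col_mx (u y) 0 : 'cV[R]_m).
Proof.
move=> oU su; apply/(smooth_mxP oU) => i j.
case: (split_ordP i) => l ->.
  have /(smooth_mxP oU)/(_ l j) := su.
  by apply: smooth_ext => // y _; rewrite col_mxEu.
apply: smooth_ext (@smooth_cst _ _ _ U 0) => // y _.
by rewrite col_mxEd mxE.
Qed.

Lemma derive_col_mx0 (u : 'rV[R]_m -> 'cV[R]_n) y X : differentiable u y ->
  'D_X (fun y => col_mx (u y) 0 : 'cV[R]_m) y = col_mx ('D_X u y) 0.
Proof.
move=> du.
have dc : differentiable (fun y => col_mx (u y) 0 : 'cV[R]_m) y.
  apply/differentiable_mxP => i j; case: (split_ordP i) => l ->.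
    rewrite (_ : (fun _ => _) = fun x => u x l j).
      by have /differentiable_mxP := du; apply.
    by apply/funext => x; rewrite col_mxEu.
  rewrite (_ : (fun _ => _) = cst 0); first exact: differentiable_cst.
  by apply/funext => x; rewrite col_mxEd mxE.
apply/matrixP => i j; rewrite (derive_mxE _ _ _ dc).
case: (split_ordP i) => l ->.
  have -> : (fun x => (col_mx (u x) 0 : 'cV[R]_m) (lshift _ l) j) =
      fun x => u x l j by apply/funext => x; rewrite col_mxEu.
  by rewrite [RHS]col_mxEu (derive_mxE _ _ _ du).
have -> : (fun x => (col_mx (u x) 0 : 'cV[R]_m) (rshift _ l) j) = cst 0.
  by apply/funext => x; rewrite col_mxEd mxE.
by rewrite derive_cst [RHS]col_mxEd mxE.
Qed.

End CoordinateDerivatives.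

Section ThickForms.
Variables (R : realType) (n k r t : nat) (M : manifold R n).
Variables (eta : 'I_k -> oneform M) (P : M -> 'M[R]_n).
Variable fr : forall q, adapted_frame eta P r t q.
Local Notation c_ q := (chart_at q).
Local Notation U_ q := (frame_dom (fr q)).
Local Notation m := (n + (r * k + t))%N.
Local Notation phi := (thick_map fr).
Local Notation psi := (thick_inv fr).
Local Notation D := (thick_dom fr).

Definition FA_in q (x : 'rV[R]_n) : 'M[R]_(n, r) :=
  let p := chart_inv (c_ q) x in jac (c_ q) (chart_at p) p *m FA (fr q) p.

(* The covector [eta j + al_j] on [M]. *)
Definition thick_covector j q (y : 'rV[R]_m) : 'cV[R]_n :=
  coefs (eta j) (c_ q) (coord_base y) +
  FA_in q (coord_base y) *m col j (coord_al y).

(** In a chart this function depends on the base point too, through [FK]; hence the full gradient in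
    the form below. *)
Definition thick_z j q (y : 'rV[R]_m) : R :=
  (coord_z y *m FK (fr q) (chart_inv (c_ q) (coord_base y))) 0 j.

(* The form [pi^* eta j + al_j \o d pi + d z_j]. *)
Definition thick_form j q (y : 'rV[R]_m) : 'cV[R]_m :=
  col_mx (thick_covector j q y) 0 + grad (thick_z j q) y.

Lemma thick_codE q : phi q @` D q = [set y | (c_ q @` U_ q) (coord_base y)].
Proof.
have := thick_image fr q setT; rewrite setIT => <-.
by congr (_ @` _); apply/seteqP; split=> // e [].
Qed.

Lemma open_thick_cod q : open (phi q @` D q).
Proof. exact: (@open_glue_cod _ _ (thickening fr) q). Qed.

Lemma thick_cod_base q y : (phi q @` D q) y -> (c_ q @` U_ q) (coord_base y).
Proof. by rewrite thick_codE. Qed.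

Lemma open_frame_cod q : open (c_ q @` U_ q).
Proof. by have := open_frame_image (fr := fr) (q := q) openT; rewrite setIT. Qed.

Lemma frame_sub_cod q : c_ q @` U_ q `<=` cod (c_ q).
Proof. by move=> _ [p Up <-]; apply/cod_chart/(frame_chart Up). Qed.

Lemma smooth_thick_covector j q : smooth_on (phi q @` D q) (thick_covector j q).
Proof.
have oO := @open_thick_cod q.
have sb := smooth_coord_base (r := r) (k := k) (t := t) oO.
have ocod := @open_frame_cod q.
have s1 := smooth_sub (@frame_sub_cod q)
  (oneform_smooth (eta j) (chart_at_atlas q)).
have OU y : (phi q @` D q) y -> (c_ q @` U_ q) (coord_base y).
  exact: thick_cod_base.
apply: smooth_addmx => //; first exact: smooth_comp_mx OU sb s1.
apply: smooth_mulmx => //; first exact: smooth_comp_mx OU sb (smooth_FA (fr q)).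
have sal := smooth_coord_al (r := r) (k := k) (t := t) oO.
apply/(smooth_mxP oO) => i l; have /(smooth_mxP oO)/(_ i j) := sal.
by apply: smooth_ext => // y _; rewrite [RHS]mxE.
Qed.

Lemma smooth_thick_z j q : smooth_on (phi q @` D q) (thick_z j q).
Proof.
have oO := @open_thick_cod q.
have sb := smooth_coord_base (r := r) (k := k) (t := t) oO.
have OU y : (phi q @` D q) y -> (c_ q @` U_ q) (coord_base y).
  exact: thick_cod_base.
have s1 := smooth_comp_mx oO (@open_frame_cod q) OU sb (smooth_FK (fr q)).
have sz := smooth_coord_z (r := r) (k := k) (t := t) oO.
by have /(smooth_mxP oO)/(_ 0 j) := smooth_mulmx oO sz s1.
Qed.

Lemma smooth_thick_form j q : smooth_on (phi q @` D q) (thick_form j q).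
Proof.
have oO := @open_thick_cod q.
apply: smooth_addmx => //; first exact: smooth_col_mx0 (smooth_thick_covector j q).
exact: smooth_grad (smooth_thick_z j q).
Qed.

Lemma thick_covectorE j q e : D q e -> thick_covector j q (phi q e) =
  jac (c_ q) (chart_at (base e)) (base e) *m (eta j (base e) + col j (al e)).
Proof.
move=> De; have cp : dom (c_ q) (base e) by exact: frame_chart De.
rewrite /thick_covector /FA_in coord_baseK coord_alK chart_funK // coefsE //.
rewrite -mulmxA -mulmxDr; congr (_ *m (_ + _)).
have [Pa _] := thickP e.
by rewrite !colE !mulmxA FA_CA // Pa.
Qed.

Lemma thick_zE j q e : D q e -> thick_z j q (phi q e) = zz e 0 j.
Proof.
move=> De; have cp : dom (c_ q) (base e) by exact: frame_chart De.
have [_ zN] := thickP e.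
by rewrite /thick_z coord_baseK coord_zK chart_funK // CK_FK.
Qed.

(** On points of the total space [thick_z] is the j-th entry of [zz], whatever the chart, so its
    gradient transforms by the chain rule. The other summand is pulled back from the base, and the
    projection to the base intertwines the transitions of the two manifolds. *)
Lemma thick_form_change j q q' y : (phi q @` (D q `&` D q')) y ->
  thick_form j q y =
  jacobian (phi q' \o psi q) y *m thick_form j q' (phi q' (psi q y)).
Proof.
move=> Oy; have [Mq Mq'] := (chart_at_atlas q, chart_at_atlas q').
have oO : open (phi q @` (D q `&` D q')) by exact: open_thick_overlap.
have strans := @smooth_thick_trans _ _ _ _ _ _ _ _ fr q q'.
have dt : differentiable (phi q' \o psi q) y by exact: smooth_differentiable Oy.
have dz' : differentiable (thick_z j q') ((phi q' \o psi q) y).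
  apply: smooth_differentiable (smooth_thick_z j q') _.
  by case: Oy => e [De De'] <-; rewrite /= thick_mapK //; exists e.
rewrite /thick_form mulmxDr; congr (_ + _); last first.
  rewrite -(grad_comp dt dz'); apply/colP => i; rewrite [LHS]mxE [RHS]mxE.
  apply: near_eq_derive; near=> x.
  have : (phi q @` (D q `&` D q')) x by near: x; exact: open_nbhs_nbhs.
  by move=> [e [De De'] <-]; rewrite /= thick_mapK // !thick_zE.
have [e [De De'] ey] := Oy; set p := base e.
have [cp cp'] := (frame_chart De, frame_chart De').
have E : thick_covector j q y =
    jac (c_ q) (c_ q') p *m thick_covector j q' (phi q' (psi q y)).
  rewrite -ey thick_mapK // !thick_covectorE // mulmxA -jac_comp //.
  - exact: chart_at_atlas.
  - exact: chart_at_dom.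
rewrite E; set u := thick_covector j q' _.
have dT : differentiable (c_ q' \o chart_inv (c_ q)) (coord_base y).
  by rewrite -ey coord_baseK; exact: differentiable_transition.
apply/row_matrixP => i; rewrite rowE row_mul row_jacobian // !mul_col_mx0.
rewrite mulmxA; congr (_ *m _).
have <- : 'D_(delta_mx 0 i) (@coord_base R n r k t \o (phi q' \o psi q)) y =
    coord_base ('D_(delta_mx 0 i) (phi q' \o psi q) y).
  rewrite (derive_comp _ dt (differentiable_coord_base _)).
  exact: derive_coord_base.
have -> : jac (c_ q) (c_ q') p = jacobian (c_ q' \o chart_inv (c_ q)) (coord_base y).
  by rewrite jac.unlock -ey coord_baseK.
rewrite -(deriveEjacobian _ dT) -(derive_coord_base y (delta_mx 0 i)).
rewrite -(derive_comp _ (differentiable_coord_base y) dT).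
apply: near_eq_derive; near=> x.
have : (phi q @` (D q `&` D q')) x by near: x; exact: open_nbhs_nbhs.
move=> [f [Df Df'] <-]; rewrite /= thick_mapK // !coord_baseK chart_funK //.
exact: frame_chart Df.
Unshelve. all: by end_near. Qed.

End ThickForms.

(** * The zero section *)

Section ZeroSection.
Variables (R : realType) (n k r t : nat) (M : manifold R n).
Variables (eta : 'I_k -> oneform M) (P : M -> 'M[R]_n).
Variable fr : forall q, adapted_frame eta P r t q.
Hypothesis PV : forall p, (P p <= char_distr eta p)%MS /\
  char_distr eta p *m P p = char_distr eta p.
Variable p : M.
Local Notation m := (n + (r * k + t))%N.
Local Notation c := (chart_at p).
Local Notation U := (frame_dom (fr p)).
Local Notation FAp := (FA (fr p) p).
Local Notation FKp := (FK (fr p) p).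
Local Notation y0 := (thick_map fr p (thick0 eta P p)).
Implicit Types X Y : 'rV[R]_m.

Let Up : U p. Proof. exact: frame_center. Qed.
Let cp : dom c p. Proof. exact: chart_at_dom. Qed.
Let Mc : atlas M c. Proof. exact: chart_at_atlas. Qed.

Lemma zero_coordsE : y0 = coords (c p) 0 0.
Proof. by rewrite /thick_map /= mulmx0 mul0mx. Qed.

Lemma zero_cod : (thick_map fr p @` thick_dom fr p) y0.
Proof. by exists (thick0 eta P p). Qed.

Lemma zero_base : coord_base y0 = c p.
Proof. by rewrite zero_coordsE coord_baseK. Qed.

Lemma zero_al : coord_al y0 = 0.
Proof. by rewrite zero_coordsE coord_alK. Qed.

Lemma zero_z : coord_z y0 = 0.
Proof. by rewrite zero_coordsE coord_zK. Qed.

Lemma thick_covector_zero j : thick_covector fr j p y0 = eta j p.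
Proof.
rewrite thick_covectorE // /= jac_refl // mul1mx.
by rewrite colE mul0mx addr0.
Qed.

Lemma FA_in_zero : FA_in fr p (c p) = FAp.
Proof. by rewrite /FA_in chart_funK // jac_refl // mul1mx. Qed.

(** The fibre coordinates vanish on the zero section, so the product rule leaves no derivative of
    the frame. The same happens with [FA_in] in [derive_thick_covector_zero]. *)
Lemma derive_thick_z_zero X j :
  'D_X (thick_z fr j p) y0 = (coord_z X *m FKp) 0 j.
Proof.
pose F l (y : 'rV[R]_m) := FK (fr p) (chart_inv c (coord_base y)) l j.
have -> : thick_z fr j p = fun y : 'rV[R]_m => \sum_l coord_z y 0 l * F l y.
  by apply/funext => y; rewrite /thick_z mxE.
have oO := @open_thick_cod _ _ _ _ _ _ _ _ fr p.
rewrite derive_sum_mul.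
- rewrite mxE; apply: eq_bigr => l _.
  rewrite zero_z mxE mul0r add0r derive_coord_z mulrC /F zero_base.
  by rewrite chart_funK.
- move=> l; have /(smooth_mxP oO)/(_ 0 l) s := smooth_coord_z oO.
  exact: smooth_differentiable s zero_cod.
move=> l; have sFK := smooth_comp_mx oO (@open_frame_cod _ _ _ _ _ _ _ _ fr p)
  (@thick_cod_base _ _ _ _ _ _ _ _ fr p) (smooth_coord_base oO) (smooth_FK (fr p)).
have /(smooth_mxP oO)/(_ l j) s := sFK.
exact: smooth_differentiable s zero_cod.
Qed.

Lemma mul_thick_form_zero X j : X *m thick_form fr j p y0 =
  coord_base X *m eta j p + ((coord_z X *m FKp) 0 j)%:M.
Proof.
rewrite /thick_form mulmxDr mul_col_mx0 thick_covector_zero.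
rewrite mul_grad ?derive_thick_z_zero //.
exact: smooth_differentiable (smooth_thick_z fr j p) zero_cod.
Qed.

Lemma mul_columns_zero X :
  X *m columns_mx (fun j => thick_form fr j p) y0 =
  coord_base X *m forms_mx eta p + coord_z X *m FKp.
Proof.
apply/matrixP => i j; rewrite !ord1 mul_columns_mx mul_thick_form_zero.
by rewrite [LHS]mxE [RHS]mxE mul_forms_mx [X in _ + X]mxE.
Qed.

Lemma derive_thick_covector_zero X j :
  'D_X (thick_covector fr j p) y0 =
  'D_(coord_base X) (coefs (eta j) c) (c p) + FAp *m col j (coord_al X).
Proof.
have oO := @open_thick_cod _ _ _ _ _ _ _ _ fr p.
have dcov : differentiable (thick_covector fr j p) y0.
  exact: smooth_differentiable (smooth_thick_covector fr j p) zero_cod.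
have db : differentiable (@coord_base R n r k t) y0 by exact: differentiable_coord_base.
have dco : differentiable (coefs (eta j) c) (coord_base y0).
  rewrite zero_base.
  apply: smooth_differentiable (oneform_smooth (eta j) Mc) _; exact: cod_chart.
have dcob : differentiable (coefs (eta j) c \o @coord_base R n r k t) y0.
  exact: differentiable_comp.
pose F i l (y : 'rV[R]_m) := FA_in fr p (coord_base y) i l.
pose A l (y : 'rV[R]_m) := (coord_al y : 'M[R]_(r, k)) l j.
have dF i l : differentiable (F i l) y0.
  have sFA := smooth_comp_mx oO (@open_frame_cod _ _ _ _ _ _ _ _ fr p)
    (@thick_cod_base _ _ _ _ _ _ _ _ fr p) (smooth_coord_base oO)
    (smooth_FA (fr p)).
  have /(smooth_mxP oO)/(_ i l) s := sFA.
  exact: smooth_differentiable s zero_cod.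
have dA l : differentiable (A l) y0.
  have /(smooth_mxP oO)/(_ l j) s := smooth_coord_al oO.
  exact: smooth_differentiable s zero_cod.
apply/colP => i; rewrite (derive_mxE _ _ _ dcov).
have -> : (fun y => thick_covector fr j p y i 0) =
    (fun y => coefs (eta j) c (coord_base y) i 0) +
    (fun y => \sum_l F i l y * A l y).
  apply/funext => y; rewrite /thick_covector mxE.
  by congr (_ + _); rewrite mxE; apply: eq_bigr => l _; rewrite [X in _ * X]mxE.
have dS : differentiable (fun y => \sum_l F i l y * A l y) y0.
  rewrite (_ : (fun y => _) = \sum_l (F i l * A l)).
    by apply: differentiable_sum => l; exact: differentiableM.
  by apply/funext => y; rewrite fct_sumE.
have dc1 : differentiable (fun y => coefs (eta j) c (coord_base y) i 0) y0.
  by have /differentiable_mxP := dcob; apply.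
rewrite deriveD; [|exact: diff_derivable dc1|exact: diff_derivable dS].
rewrite [RHS]mxE; congr (_ + _).
  rewrite -(derive_mxE _ i 0 dcob) (derive_comp _ db dco) zero_base.
  by rewrite derive_coord_base.
rewrite derive_sum_mul // mxE; apply: eq_bigr => l _.
rewrite {2}/A zero_al [X in _ + X * _]mxE mul0r addr0 derive_coord_al.
by rewrite /F zero_base FA_in_zero [X in _ = _ * X]mxE.
Qed.

(** The gradient of z_j is closed and drops out. In the last bracket [FAp] turns the fibre
    coordinates into the covectors that are paired with the base vectors. *)
Lemma antisym_thick_form_zero X Y j :
  X *m antisym_derive (thick_form fr j p) y0 *m Y^T =
  coord_base X *m extd (eta j) p *m (coord_base Y)^T +
  (coord_base Y *m FAp *m col j (coord_al X) -
   coord_base X *m FAp *m col j (coord_al Y)).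
Proof.
have oO := @open_thick_cod _ _ _ _ _ _ _ _ fr p.
have scov := smooth_thick_covector fr j p.
have dcov : differentiable (thick_covector fr j p) y0.
  exact: smooth_differentiable scov zero_cod.
have d1 : differentiable (fun y => col_mx (thick_covector fr j p y) 0 : 'cV[R]_m) y0.
  exact: smooth_differentiable (smooth_col_mx0 oO scov) zero_cod.
have sz := smooth_thick_z fr j p.
have d2 : differentiable (grad (thick_z fr j p)) y0.
  exact: smooth_differentiable (smooth_grad oO sz) zero_cod.
have dco : differentiable (coefs (eta j) c) (c p).
  apply: smooth_differentiable (oneform_smooth (eta j) Mc) _; exact: cod_chart.
rewrite (antisym_deriveD d1 d2) (antisym_derive_grad oO zero_cod sz) addr0.
rewrite antisym_deriveP // !derive_col_mx0 // !mul_col_mx0.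
rewrite !derive_thick_covector_zero -[extd (eta j) p]/(antisym_derive _ _).
rewrite antisym_deriveP // !mulmxDr !mulmxA opprD addrACA.
by [].
Qed.

Lemma FA_full r' (X : 'M[R]_(r, r')) : FAp *m X = 0 -> X = 0.
Proof. by move=> X0; rewrite -[X]mul1mx -(CA_FA Up) -mulmxA X0 mulmx0. Qed.

Lemma mul_P_FA : P p *m FAp = FAp.
Proof. by rewrite -(FA_CA Up) -mulmxA CA_FA // mulmx1. Qed.

Lemma mul_P_id (X : 'rV[R]_n) : (X <= char_distr eta p)%MS -> X *m P p = X.
Proof. by move=> /submxP[Z ->]; have [_ PV2] := PV p; rewrite -mulmxA PV2. Qed.

(** The vectors [coord_base X *m N] and [coord_z X *m FKp] of R^k are orthogonal since
    [FKp *m N^T = 0]; if they sum to 0, the first one has norm 0. *)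
Lemma columns_zero_eq0 X :
  X *m columns_mx (fun j => thick_form fr j p) y0 = 0 <->
  coord_base X *m forms_mx eta p = 0 /\ coord_z X = 0.
Proof.
rewrite mul_columns_zero; set N := forms_mx eta p.
split=> [/eqP|[-> ->]]; last by rewrite mul0mx addr0.
rewrite addr_eq0 => /eqP E.
have N0 : coord_base X *m N = 0.
  have : coord_base X *m N *m (coord_base X *m N)^T = 0.
    by rewrite {1}E trmx_mul mulNmx -mulmxA (mulmxA FKp) FK_forms // mul0mx mulmx0
      oppr0.
  move=> /(congr1 (fun A : 'M[R]_1 => A 0 0)); rewrite [LHS]mxE [RHS]mxE => S0.
  apply/rowP => j; rewrite [RHS]mxE; apply/eqP; rewrite -sqrf_eq0; apply/eqP.
  have := @psumr_eq0P _ _ predT (fun j => (coord_base X *m N) 0 j ^+ 2) _ _ j isT.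
  apply=> [l _|]; first exact: sqr_ge0.
  by rewrite -[RHS]S0; apply: eq_bigr => l _; rewrite [_^T l 0]mxE expr2.
split=> //; have Z0 : coord_z X *m FKp = 0.
  by apply/eqP; rewrite -oppr_eq0 -E N0.
by rewrite -[coord_z X]mulmx1 -(FK_CK Up) mulmxA Z0 mul0mx.
Qed.

(** A vector [u] of R^k annihilating all values of the forms is orthogonal to the image of eta,
    hence is a relation; it is also orthogonal to all relations, so [u *m u^T = 0]. *)
Lemma row_free_columns_zero :
  row_free (columns_mx (fun j => thick_form fr j p) y0)^T.
Proof.
rewrite -kermx_eq0; apply/negPn/negP => /rowV0Pn[u /sub_kermxP uC /eqP u0].
apply: u0; set N := forms_mx eta p.
have H X : (coord_base X *m N + coord_z X *m FKp) *m u^T = 0.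
  rewrite -mul_columns_zero -mulmxA -[columns_mx _ _ *m _]trmxK trmx_mul trmxK uC.
  by rewrite trmx0 mulmx0.
have Nu : N *m u^T = 0.
  apply/row_matrixP => i; rewrite row0 rowE mulmxA.
  have := H (coords (delta_mx 0 i) 0 0).
  by rewrite coord_baseK coord_zK mul0mx addr0.
have Fu : FKp *m u^T = 0.
  apply/row_matrixP => i; rewrite row0 rowE mulmxA.
  have := H (coords 0 0 (delta_mx 0 i)).
  by rewrite coord_baseK coord_zK mul0mx add0r.
have uN : u *m N^T = 0 by rewrite -[LHS]trmxK trmx_mul trmxK Nu trmx0.
have uu : u *m u^T = 0.
  transitivity (u *m CK (fr p) p *m FKp *m u^T); first by rewrite CK_FK.
  by rewrite -mulmxA Fu mulmx0.
move/(congr1 (fun A : 'M[R]_1 => A 0 0)): uu; rewrite [LHS]mxE [RHS]mxE => S0.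
apply/rowP => j; rewrite [RHS]mxE; apply/eqP; rewrite -sqrf_eq0; apply/eqP.
have := @psumr_eq0P _ _ predT (fun j => u 0 j ^+ 2) _ _ j isT.
apply=> [l _|]; first exact: sqr_ge0.
by rewrite -[RHS]S0; apply: eq_bigr => l _; rewrite [_^T l 0]mxE expr2.
Qed.

(** The definition of V places its vectors in the first argument of d eta_j; antisymmetry moves them
    to the second. *)
Lemma extd_char (X Y : 'rV[R]_n) j : X *m forms_mx eta p = 0 ->
  (Y <= char_distr eta p)%MS -> X *m extd (eta j) p *m Y^T = 0.
Proof.
move=> X0 /sub_char_distrP[_ YE].
have /submxP[Z ->] : (X <= distr eta p)%MS by apply/sub_distrP.
have E : (extd (eta j) p)^T = - extd (eta j) p.
  by apply/matrixP => u v; rewrite !mxE opprB.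
apply: trmx_inj; rewrite trmx0 trmx_mul trmxK trmx_mul E mulNmx mulmxN.
by rewrite trmx_mul !mulmxA YE mul0mx oppr0.
Qed.

Lemma contact_at_zero : (0 < k)%N ->
  contact_at (fun j => thick_form fr j p) y0.
Proof.
move=> k0 X /columns_zero_eq0[X0 z0] XE.
set xi := coord_base X in X0; set A := coord_al X.
have {XE}key j (u : 'rV[R]_n) (B : 'M[R]_(r, k)) : u *m forms_mx eta p = 0 ->
    xi *m extd (eta j) p *m u^T + (u *m FAp *m col j A - xi *m FAp *m col j B) = 0.
  move=> u0; have := XE j (coords u B 0); rewrite antisym_thick_form_zero.
  rewrite coord_baseK coord_alK; apply; apply/columns_zero_eq0.
  by rewrite coord_baseK coord_zK.
have xiF : xi *m FAp = 0.
  (* The vertical test vector with the single entry (i, j0) reads off the i-th coordinate of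
     [xi *m FAp] in the form of index [j0]. *)
  apply/rowP => i; pose j0 := Ordinal k0.
  have := key j0 0 (delta_mx i j0); rewrite mul0mx => /(_ erefl).
  rewrite trmx0 mulmx0 add0r !mul0mx add0r.
  move=> /eqP; rewrite oppr_eq0 => /eqP.
  have -> : col j0 (delta_mx i j0 : 'M[R]_(r, k)) = delta_mx i 0.
    by apply/matrixP => a b; rewrite !mxE !eqxx andbT ord1 eqxx andbT.
  rewrite -colE => /(congr1 (fun N : 'M[R]_1 => N 0 0)).
  by rewrite [LHS]mxE [RHS]mxE => ->; rewrite mxE.
have A0 : A = 0.
  apply/matrixP => i j; rewrite [RHS]mxE.
  have Aj : col j A = 0.
    (* The covector [FAp *m col j A] is fixed by [P p], so it is enough to pair it with the rows of
       [P p]. These lie in V, where the term with d eta_j vanishes. *)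
    apply: FA_full; rewrite -mul_P_FA -mulmxA; apply/row_matrixP => l.
    rewrite row_mul row0.
    have PlV : (row l (P p) <= char_distr eta p)%MS.
      by have [PV1 _] := PV p; exact: submx_trans (row_sub _ _) PV1.
    have := key j (row l (P p)) 0.
    rewrite (extd_char j X0 PlV) add0r [col j 0]colE mul0mx mulmx0 subr0.
    by rewrite mulmxA; apply; have /sub_char_distrP[] := PlV.
  by move: Aj => /(congr1 (fun N : 'cV[R]_r => N i 0)); rewrite !mxE.
have xi0 : xi = 0.
  (* With [A] gone, horizontal test vectors in D leave exactly the equations of V. *)
  have xiV : (xi <= char_distr eta p)%MS.
    apply/sub_char_distrP; split=> // j; apply/rowP => l.
    have dl : row l (distr eta p) *m forms_mx eta p = 0.
      by apply/sub_distrP; exact: row_sub.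
    have := key j (row l (distr eta p)) 0 dl.
    rewrite A0 ![col j 0]colE !mul0mx !mulmx0 subrr addr0.
    rewrite tr_row colE !mulmxA -colE => /(congr1 (fun N : 'M[R]_1 => N 0 0)).
    by rewrite [LHS]mxE [RHS]mxE => ->; rewrite mxE.
  by rewrite -(mul_P_id xiV) -(FA_CA Up) mulmxA xiF mul0mx.
rewrite -[X]coordsK -/A -/xi A0 xi0 z0 /coords.
by rewrite linear0 !row_mx0.
Qed.

(** Vectors tangent to M include no vertical ones, so nothing forces [X] to vanish along V; its base
    component stays free, as the conclusion allows, and only the fibre components have to be
    killed. *)
Lemma coisotropic_zero X :
  X *m columns_mx (fun j => thick_form fr j p) y0 = 0 ->
  (forall j (u : 'rV[R]_n),
    X *m antisym_derive (thick_form fr j p) y0 *m (row_mx u 0)^T = 0) ->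
  (X <= (row_mx 1%:M 0 : 'M[R]_(n, m)))%MS.
Proof.
move=> /columns_zero_eq0[X0 z0] XE.
set xi := coord_base X in X0; set A := coord_al X.
have A0 : A = 0.
  apply/matrixP => i j; rewrite [RHS]mxE.
  have Aj : col j A = 0.
    apply: FA_full; rewrite -mul_P_FA -mulmxA; apply/row_matrixP => l.
    rewrite row_mul row0.
    have PlV : (row l (P p) <= char_distr eta p)%MS.
      by have [PV1 _] := PV p; exact: submx_trans (row_sub _ _) PV1.
    have := XE j (row l (P p)).
    rewrite (_ : row_mx _ 0 = coords (row l (P p)) 0 0); last first.
      by rewrite /coords linear0 row_mx0.
    rewrite antisym_thick_form_zero coord_baseK coord_alK.
    rewrite (extd_char j X0 PlV) add0r [col j 0]colE mul0mx mulmx0 subr0.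
    by rewrite mulmxA.
  by move: Aj => /(congr1 (fun N : 'cV[R]_r => N i 0)); rewrite !mxE.
apply/submxP; exists xi; rewrite mul_mx_row mulmx1 mulmx0.
by rewrite -[LHS]coordsK -/A -/xi A0 z0 /coords linear0 row_mx0.
Qed.

End ZeroSection.

(** * Restriction to the contact neighbourhood, and the embedding *)

Section RestrictedForms.
Variables (R : realType) (m : nat) (G : gluing R m).
Local Notation D := (@glue_dom R m G).
Local Notation phi := (@glue_map R m G).
Local Notation psi := (@glue_inv R m G).
Variable W : glue_idx G -> set 'rV[R]_m.
Hypothesis oW : forall i, open (W i).
Variable z : glue_idx G -> glue_pt G.
Hypothesis z_dom : forall i, D i (z i).
Hypothesis zW : forall i, W i (phi i (z i)).
Hypothesis z_inj : injective z.
Local Notation G' := (restrict_gluing oW z_dom zW z_inj).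
Variable a : glue_idx G -> 'rV[R]_m -> 'cV[R]_m.

Lemma restrict_smooth (i : glue_idx G') : smooth_on (phi i @` D i) (a i) ->
  smooth_on (@glue_map R m G' i @` @glue_dom R m G' i) (a i).
Proof. by apply: smooth_sub => _ [e De <-]; exists (sval e). Qed.

Lemma restrict_compat (i l : glue_idx G') :
  (forall x, (phi i @` (D i `&` D l)) x ->
    a i x = jacobian (phi l \o psi i) x *m a l (phi l (psi i x))) ->
  forall x, (@glue_map R m G' i @` (@glue_dom R m G' i `&` @glue_dom R m G' l)) x ->
    a i x = jacobian (@glue_map R m G' l \o @glue_inv R m G' i) x *m
      a l (@glue_map R m G' l (@glue_inv R m G' i x)).
Proof.
move=> aE x Ox; have [e [Di Dl] ex] := Ox.
have Ox' : (phi i @` (D i `&` D l)) x by exists (sval e).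
rewrite (aE x Ox') -(@jacobian_near _ _ _ (phi l \o psi i)).
- by rewrite /= keepK // -ex glue_mapK //; exact: (svalP e).
- exact: smooth_differentiable (@smooth_glue_trans _ _ G i l) Ox'.
near=> y.
have [f [Df _] <-] : (@glue_map R m G' i @`
    (@glue_dom R m G' i `&` @glue_dom R m G' l)) y.
  near: y; apply: open_nbhs_nbhs; split=> //.
  exact: (@open_glue_overlap _ _ G').
by rewrite /= glue_mapK // keepK //; exact: (svalP f).
Unshelve. all: by end_near. Qed.

End RestrictedForms.

Section CoisotropicEmbedding.
Variables (R : realType) (n k r t : nat) (M : manifold R n).
Hypothesis k_gt0 : (0 < k)%N.
Variables (eta : 'I_k -> oneform M) (P : M -> 'M[R]_n).
Variable fr : forall q, adapted_frame eta P r t q.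
Hypothesis PV : forall p, (P p <= char_distr eta p)%MS /\
  char_distr eta p *m P p = char_distr eta p.
Local Notation m := (n + (r * k + t))%N.
Local Notation G := (thickening fr).
Local Notation z := (thick0 eta P : glue_idx G -> glue_pt G).

Lemma contact_neighborhoods : exists W : glue_idx G -> set 'rV[R]_m,
  [/\ forall q, open (W q), forall q, W q (thick_map fr q (z q)) &
    forall q y, W q y -> contact_at (fun j => thick_form fr j q) y].
Proof.
suff /choice[W WP] : forall q : M, exists A : set 'rV[R]_m,
    [/\ open A, A (thick_map fr q (z q)) &
      forall y, A y -> contact_at (fun j => thick_form fr j q) y].
  by exists W; split=> q; have [] := WP q.
move=> q; have [|||||A [oA Aq _ Act]] := @open_contact_at R m k
  (fun j => thick_form fr j q) (thick_map fr q @` thick_dom fr q)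
  (thick_map fr q (z q)).
- exact: open_thick_cod.
- exact: zero_cod.
- by move=> j; exact: smooth_thick_form.
- exact: row_free_columns_zero.
- exact: contact_at_zero.
by exists A.
Qed.

Let W := sval (cid contact_neighborhoods).
Let WP := svalP (cid contact_neighborhoods).
Let oW q : open (W q). Proof. by have [H _ _] := WP; exact: H. Qed.
Let zW q : W q (@glue_map R m G q (z q)).
Proof. by have [_ H _] := WP; exact: H. Qed.
Let W_contact q y : W q y -> contact_at (fun j => thick_form fr j q) y.
Proof. by have [_ _ H] := WP; exact: H. Qed.
Let z_dom q : @glue_dom R m G q (z q). Proof. exact: frame_center. Qed.
Let z_inj : injective z. Proof. by move=> p q /(congr1 (@base _ _ _ _ _ _)). Qed.

Local Notation G' := (restrict_gluing oW z_dom zW z_inj).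

Let G'_hausdorff : hausdorff_space (glued G').
Proof. exact/restrict_hausdorff/thickening_separation. Qed.

Let G'_second_countable : @second_countable (glued G').
Proof.
have [I cI Icov] := countable_frames fr.
by apply: restrict_second_countable; [exact: cI|move=> e; exact: (Icov (base e))].
Qed.

Let form_smooth j i : smooth_on (@glue_map R m G' i @` @glue_dom R m G' i)
  (thick_form fr j i).
Proof. exact/restrict_smooth/smooth_thick_form. Qed.

Let form_compat j i l x :
  (@glue_map R m G' i @` (@glue_dom R m G' i `&` @glue_dom R m G' l)) x ->
  thick_form fr j i x = jacobian (@glue_map R m G' l \o @glue_inv R m G' i) x *m
    thick_form fr j l (@glue_map R m G' l (@glue_inv R m G' i x)).
Proof.
apply: (@restrict_compat R m G W oW z z_dom zW z_inj (thick_form fr j)).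
by move=> y; exact: thick_form_change.
Qed.

Definition thick_manifold : manifold R m :=
  glued_manifold G'_hausdorff G'_second_countable.

Definition thick_forms : 'I_k -> oneform thick_manifold :=
  glued_forms G'_hausdorff G'_second_countable form_smooth form_compat.

Definition zero_section (p : M) : thick_manifold :=
  exist _ (thick0 eta P p) (z_kept z_dom zW p).

Lemma glue_at_zero p : @glue_at R m G' (zero_section p) = p.
Proof. by have [_ _] := centerP z_dom zW z_inj (zero_section p); exact. Qed.

Lemma thick_contact : contact thick_forms.
Proof.
apply: glued_contact => e; apply: W_contact.
by have [] := centerP z_dom zW z_inj e.
Qed.

Lemma zero_section_map q p : frame_dom (fr q) p ->
  @glue_map R m G' q (zero_section p) = coords (chart_at q p) 0 0.
Proof. by move=> Up; rewrite /= /thick_map /= mulmx0 mul0mx. Qed.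

Lemma chart_at_zero p :
  chart_at (zero_section p) = glued_chart (p : glue_idx G') :> chart R m thick_manifold.
Proof. exact: (congr1 (@glued_chart R m G') (glue_at_zero p)). Qed.

Let zero_coords (x : 'rV[R]_n) : 'rV[R]_m :=
  coords x (0 : 'M[R]_(r, k)) (0 : 'rV[R]_t).

Let smooth_zero_coords : smooth_on setT zero_coords.
Proof.
have sid : smooth_on setT (fun x : 'rV[R]_n => x).
  by apply/(smooth_mxP openT) => i j; rewrite ord1; exact: smooth_coord.
exact: (smooth_coords openT sid (@smooth_cst _ _ _ _ _) (@smooth_cst _ _ _ _ _)).
Qed.

Let zero_coordsM x : zero_coords x = x *m row_mx 1%:M 0.
Proof. by rewrite /zero_coords /coords linear0 row_mx0 mul_mx_row mulmx1 mulmx0. Qed.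

Let jacobian_zero_coords x : jacobian zero_coords x = row_mx 1%:M 0.
Proof.
have dz y : differentiable zero_coords y.
  exact: smooth_differentiable smooth_zero_coords _.
apply/row_matrixP => i; rewrite row_jacobian // [RHS]rowE -zero_coordsM.
apply/matrixP => a j; rewrite (derive_mxE _ _ _ (dz x)) ord1.
have E y : zero_coords y = row_mx y 0 by rewrite /zero_coords /coords linear0 row_mx0.
case: (split_ordP j) => l ->.
  have H y : zero_coords y 0 (lshift _ l) = y 0 l by rewrite E row_mxEl.
  by rewrite (funext H) derive_coord H.
have H y : zero_coords y 0 (rshift _ l) = 0 by rewrite E row_mxEr mxE.
by rewrite (funext H) derive_cst H.
Qed.

Let frame_near p : \forall q \near p, frame_dom (fr p) q.
Proof.
by apply: open_nbhs_nbhs; split; [exact: frame_open|exact: frame_center].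
Qed.

(** The preferred chart at the image of [p] is the one built over the preferred chart at [p]; in
    this pair of charts the zero section is x |-> (x, 0, 0) near [p]. *)
Lemma tangent_zero_section p : tangent_map zero_section p = row_mx 1%:M 0.
Proof.
rewrite /tangent_map chart_at_zero -(jacobian_zero_coords (chart_at p p)).
apply/esym/jacobian_near.
  exact: smooth_differentiable smooth_zero_coords _.
near=> x; have [q Uq <-] : (chart_at p @` frame_dom (fr p)) x.
  near: x; apply: open_nbhs_nbhs; split; first exact: open_frame_cod.
  by exists p => //; exact: frame_center.
have cq := frame_chart Uq.
by rewrite /= /zero_coords chart_funK // -zero_section_map.
Unshelve. all: by end_near. Qed.

Lemma zero_section_continuous : continuous zero_section.
Proof.
move=> p; pose g q := @glue_inv R m G' p (zero_coords (chart_at p q)).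
have gE : \forall q \near p, g q = zero_section q.
  near=> q; have Uq : frame_dom (fr p) q by near: q; exact: frame_near.
  by rewrite /g /zero_coords -zero_section_map // (@glue_mapK _ _ G').
have cg : {for p, continuous (g : M -> thick_manifold)}.
  apply: (@continuous_comp _ _ _ (chart_at p)
    (fun x => @glue_inv R m G' p (zero_coords x) : thick_manifold)).
    exact/chart_fun_continuous/chart_at_dom.
  apply: (@continuous_comp _ _ _ zero_coords
    (@glue_inv R m G' p : _ -> thick_manifold)).
    exact: smooth_continuous smooth_zero_coords _.
  apply: (@glue_inv_continuous _ _ G').
  rewrite /zero_coords -zero_section_map; last exact: frame_center.
  by exists (zero_section p) => //; exact: frame_center.
move: cg; rewrite /prop_for /continuous_at (nbhs_singleton gE).
exact: cvg_trans (near_eq_cvg gE).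
Unshelve. all: by end_near. Qed.

Lemma smooth_zero_section : smooth_map zero_section.
Proof.
split; first exact: zero_section_continuous.
move=> c _ Mc [q _ <-]; have Mq : atlas M (chart_at q) := chart_at_atlas q.
pose O := c @` (dom c `&` frame_dom (fr q)).
have oO : open O by exact/open_chart_image/frame_open.
have sub : O `<=` c @` (dom c `&` dom (chart_at q)).
  by move=> _ [p [cp Up] <-]; exists p => //; split=> //; exact: frame_chart Up.
have sT := smooth_sub sub (transition_smooth Mc Mq).
have s := smooth_comp_mx oO openT (fun _ _ => I) sT smooth_zero_coords.
apply: smooth_ext s => // _ [p [cp Up] <-].
by rewrite /= /zero_coords chart_funK // -zero_section_map.
Qed.

Lemma embedding_zero_section : embedding zero_section.
Proof.
split.
- exact: smooth_zero_section.
- move=> p; rewrite tangent_zero_section; apply/row_freeP.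
  by exists (col_mx 1%:M 0); rewrite mul_row_col mulmx1 mul0mx addr0.
- by move=> p q /(congr1 (fun e => base (sval e))).
(* The zero section is a section of the bundle projection, so [A] is the trace of its own preimage
   under that projection. *)
move=> A oA; exists (fun e => A (base (sval e))) => //.
apply: (@open_restrict R m G W oW z z_dom zW z_inj (fun e => A (base e))).
exact: open_base_preimage.
Qed.

Lemma thick_forms_zero j p :
  thick_forms j (zero_section p) = thick_form fr j p (thick_map fr p (thick0 eta P p)).
Proof.
by rewrite -[thick_forms j _]/(glued_covector _ _) /glued_covector glue_at_zero.
Qed.

Lemma pullback_zero_section j p : pullback zero_section (thick_forms j) p = eta j p.
Proof.
rewrite /pullback tangent_zero_section thick_forms_zero.
apply/row_matrixP => i; rewrite row_mul rowE -zero_coordsM mul_thick_form_zero.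
by rewrite coord_baseK coord_zK mul0mx mxE raddf0 addr0 [RHS]rowE.
Qed.

Lemma coisotropic_zero_section : coisotropic thick_forms k zero_section.
Proof.
split; first by rewrite k_gt0 leqnn.
move=> p; apply/row_subP => u; set B := (\bigcap_(_ < _ | _) _)%MS.
have /sub_bigcapmxP XB : (row u B <= B)%MS by exact: row_sub.
rewrite tangent_zero_section.
have XBj j : row u B *m thick_form fr j p (thick_map fr p (thick0 eta P p)) = 0 /\
    forall v : 'rV[R]_n, row u B *m antisym_derive (thick_form fr j p)
      (thick_map fr p (thick0 eta P p)) *m (row_mx v 0)^T = 0.
  have := XB j (ltn_ord j); rewrite sub_capmx => /andP[/sub_kermxP X0 /sub_kermxP XE].
  rewrite thick_forms_zero in X0; split=> // v.
  move: XE; rewrite extd_glued_forms tangent_zero_section glue_at_zero mulmxA => XE.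
  have -> : row_mx v 0 = v *m (row_mx 1%:M 0 : 'M[R]_(n, m)).
    by rewrite mul_mx_row mulmx1 mulmx0.
  by rewrite trmx_mul mulmxA XE mul0mx.
apply: (coisotropic_zero PV (fr := fr) (p := p)).
  by apply/mul_columns_eq0 => j; have [] := XBj j.
by move=> j v; have [_] := XBj j.
Qed.

End CoisotropicEmbedding.

Theorem theorem9p11 (R : realType) (n k : nat) (k_gt0 : (0 < k)%N)
    (M : manifold R n) (eta : 'I_k -> oneform M) (pc : precontact eta) :
  exists (m : nat) (Mt : manifold R m) (etat : 'I_k -> oneform Mt)
         (f : M -> Mt),
    [/\ contact etat,
        embedding f,
        forall (j : 'I_k) (p : M), pullback f (etat j) p = eta j p &
        coisotropic etat k f].
Proof.
have [P [sP PV]] := global_char_projector pc.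
have [_ [d rd] _ [r rV]] := pc.
have rP p : \rank (P p) = r.
  rewrite -(rV p); apply: eqmx_rank; have [-> <-] := PV p.
  by rewrite submxMl.
have PP p : P p *m P p = P p.
  by have [/submxP[Z PE] VP] := PV p; rewrite {1 3}PE -mulmxA VP.
have rN p : \rank (forms_mx eta p) = (n - d)%N.
  by rewrite -(rd p) rank_distr subKn // rank_leq_row.
pose fr q := inhabited_witness (adapted_frame_exists q sP PP rP rN).
(* The dimension is n + (r * k + (k - (n - d))): [r] is the rank of V, and the forms have rank n -
   d, which leaves relations of rank k - (n - d). *)
exists _, (thick_manifold k_gt0 fr PV), (thick_forms k_gt0 fr PV),
  (zero_section k_gt0 fr PV).
split.
- exact: thick_contact.
- exact: embedding_zero_section.
- exact: pullback_zero_section.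
- exact: coisotropic_zero_section.
Qed.
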